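(* Suppose $\tau\le m/n\le 1/\tau$ for some $\tau\in(0,1)$, and suppose the loss functions $\{\psi_i\}_{i\in[m]}$ satisfy the loss-function assumption stated in the context. Let $A_0,B_0\in\mathbb{R}^{m\times n}$ be two random matrices with independent entries such that $\mathbb{E}A_{0;ij}=\mathbb{E}B_{0;ij}=0$ and $\mathbb{E}A_{0;ij}^2=\mathbb{E}B_{0;ij}^2$ for all $i\in[m],j\in[n]$. Further assume that $$M\equiv\max_{i\in[m],j\in[n]}\big(\mathbb{E}|A_{0;ij}|^{\bar{\mathsf q}}+\mathbb{E}|B_{0;ij}|^{\bar{\mathsf q}}\big)<\infty.$$ Let $A\equiv A_0/\sqrt m$ and $B\equiv B_0/\sqrt m$. Then there exists $C_0>0$ depending only on $\tau$, $\{q_\ell\}_{\ell=0}^3$ and $M$ such that the following hold. For any $\mathcal{S}_n\subset[-L_n,L_n]^n$ with $L_n\ge1$ and any $\mathsf g\in C^3(\mathbb{R})$, $$\Big|\mathbb{E}\,\mathsf g\Big(\min_{w\in\mathcal{S}_n}H_\psi(w,A)\Big)-\mathbb{E}\,\mathsf g\Big(\min_{w\in\mathcal{S}_n}H_\psi(w,B)\Big)\Big|\le C_0\,K_{\mathsf g}\,\mathsf r_{\mathsf f}(L_n),$$ where $K_{\mathsf g}\equiv1+\max_{\ell\in\{0,1,2,3\}}\lVert\mathsf g^{(\ell)}\rVert_\infty$ and $$\mathsf r_{\mathsf f}(L_n)\equiv\inf_{\rho\in(0,\bar\rho)}\bigg\{\mathscr M_\psi(\rho)+\mathscr D_\psi^3(\rho)\inf_{\delta\in(0,\omega_n)}\bigg[\mathscr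 M_{\mathsf f}(L_n,\delta)+\Big(\frac1m\sum_{i=1}^mL_{\psi_i}^{\mathsf q}\Big)^{1/3}\frac{L_n^{\bar{\mathsf q}/3}\log_+^{2/3}(L_n/\delta)}{n^{1/6}}\bigg]\bigg\},$$ with $\omega_n\equiv n^{-(q_0q_1+4)/2}$ and $\mathscr M_{\mathsf f}(L_n,\delta)\equiv\sup|\mathsf f(w)-\mathsf f(w')|$, the supremum being over all $w,w'\in[-L_n,L_n]^n$ with $\lVert w-w'\rVert_\infty\le\delta$. Consequently, for any $z\in\mathbb{R}$ and $\epsilon>0$, $$\mathbb{P}\Big(\min_{w\in\mathcal{S}_n}H_\psi(w,A)>z+3\epsilon\Big)\le\mathbb{P}\Big(\min_{w\in\mathcal{S}_n}H_\psi(w,B)>z+\epsilon\Big)+C_1(1\vee\epsilon^{-3})\,\mathsf r_{\mathsf f}(L_n),$$ where $C_1>0$ is an absolute multiple of $C_0$.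
   Context: Notation: $[m]=\{1,\dots,m\}$; $a\vee b=\max\{a,b\}$; $\log_+(a)=1\vee\log a$ for $a>0$; $\lVert\cdot\rVert_\infty$ is the sup norm of functions or vectors. Cost function: for measurable $\psi_i:\mathbb{R}\to\mathbb{R}_{\ge0}$ ($i\in[m]$), measurable $\mathsf f:\mathbb{R}^n\to\mathbb{R}$, $w\in\mathbb{R}^n$ and an $m\times n$ matrix $A$, $$H_\psi(w,A)\equiv\frac1m\sum_{i=1}^m\psi_i\big((Aw)_i\big)+\mathsf f(w).$$ Loss-function assumption: there exist reals $q_\ell\ge0$ ($\ell=0,1,2,3$), constants $\bar\rho\in(0,1]$ and $\{L_{\psi_i}\ge1:i\in[m]\}$, and measurable functions $\mathscr D_\psi,\mathscr M_\psi:(0,\bar\rho)\to\mathbb{R}_{\ge0}$ with $\mathscr M_\psi(\rho)\le1\le\mathscr D_\psi(\rho)$, such that: (1) $\sup_{x\in\mathbb{R}}|\psi_i(x)|/(1+|x|^{q_0})\le L_{\psi_i}$ for all $i\in[m]$; (2) there exist functions $\{\psi_{i;\rho}:\mathbb{R}\to\mathbb{R}_{\ge0}\}_{\rho\in(0,\bar\rho)}$ such that (i) $\psi_{i;\rho}\in C^3(\mathbb{R})$, (ii) $\max_{i\in[m]}\lVert\psi_{i;\rho}-\psi_i\rVert_\infty\le\mathscr M_\psi(\rho)$, (iii) $\max_{\ell=1,2,3}\max_{i\in[m]}\sup_{x\in\mathbb{R}}\frac{|\partial^\ell\psi_{i;\rho}(x)|}{1+|\psi_{i;\rho}(x)|^{q_\ell}}\le\mathscr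 D_\psi(\rho)$. Set $\mathsf q\equiv\max\{q_3,q_1+q_2,3q_1\}$ and $\bar{\mathsf q}\equiv q_0\mathsf q+3$. *)

(* Defs.v *)
From HB Require Import structures.
From mathcomp Require Import all_boot all_order all_algebra.
From mathcomp Require Import all_classical all_reals all_analysis.
Set Implicit Arguments.
Unset Strict Implicit.
Unset Printing Implicit Defensive.
Import Order.TTheory GRing.Theory Num.Theory.
Import numFieldNormedType.Exports.
Local Open Scope classical_set_scope.
Local Open Scope ring_scope.

Definition supnorm (R : realType) (f : R -> R) : \bar R :=
  ereal_sup (range (fun x => `|f x|%:E)).

Definition C3 (R : realType) (f : R -> R) : Prop :=
  (forall k : nat, (k < 3)%N -> forall x : R, derivable (f^`(k))%classic x 1) /\
  continuous (f^`(3))%classic.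

Definition borel_fun (R : realType) (n : nat) (f : 'cV[R]_n -> R) : Prop :=
  measurable_fun
    (setT : set (g_sigma_algebraType (@open 'cV[R]_n))) f.

Definition mutually_independent d (T : measurableType d) (R : realType)
    (P : probability T R) (I : finType) (X : I -> T -> R) : Prop :=
  forall (J : {set I}) (B : I -> set R), (forall i, measurable (B i)) ->
    P (\bigcap_(i in [set` J]) (X i @^-1` B i)) =
    (\prod_(i in J) P (X i @^-1` B i))%E.

Definition independent_entries d (T : measurableType d) (R : realType)
    (P : probability T R) (m n : nat) (X : 'I_m -> 'I_n -> {RV P >-> R}) :
    Prop :=
  mutually_independent P (fun ij : 'I_m * 'I_n => (X ij.1 ij.2 : T -> R)).

Definition scaled_matrix d (T : measurableType d) (R : realType)
    (P : probability T R) (m n : nat) (X : 'I_m -> 'I_n -> {RV P >-> R})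
    (t : T) : 'M[R]_(m, n) :=
  \matrix_(i, j) (X i j t / Num.sqrt m%:R).

Definition cost (R : realType) (m n : nat) (psi : 'I_m -> R -> R)
    (f : 'cV[R]_n -> R) (w : 'cV[R]_n) (A : 'M[R]_(m, n)) : R :=
  m%:R^-1 * (\sum_(i < m) psi i ((A *m w) i 0)) + f w.

(* The minimum over S is read as an infimum, since S need not be compact and
   the losses need not be continuous.  [inf] takes the value 0 on the empty set
   and on sets that are not bounded below.  For S contained in [-L, L]^n, the
   latter can only occur when f is unbounded on that cube, and then the modulus
   [osc f L delta] below is +oo for every delta > 0. *)
Definition min_cost (R : realType) (m n : nat) (psi : 'I_m -> R -> R)
    (f : 'cV[R]_n -> R) (S : set 'cV[R]_n) (A : 'M[R]_(m, n)) : R :=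
  inf [set cost psi f w A | w in S].

Definition cube (R : realType) (n : nat) (L : R) : set 'cV[R]_n :=
  [set w | forall i, - L <= w i 0 <= L].

Definition logplus (R : realType) (a : R) : R := Num.max 1 (ln a).

Definition qq (R : realType) (q1 q2 q3 : R) : R :=
  Num.max q3 (Num.max (q1 + q2) (3 * q1)).

Definition qbar (R : realType) (q0 q1 q2 q3 : R) : R := q0 * qq q1 q2 q3 + 3.

(* Functions of rho are total here; only their values on ]0, rhobar[ matter. *)
Record loss_assumption (R : realType) (m : nat) (q0 q1 q2 q3 rhobar : R)
    (Lpsi : 'I_m -> R) (Mpsi Dpsi : R -> R) (psi : 'I_m -> R -> R) : Prop := {
  loss_ge0 : forall i (x : R), 0 <= psi i x;
  loss_measurable : forall i, measurable_fun setT (psi i);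
  loss_rhobar : 0 < rhobar <= 1;
  loss_L : forall i, 1 <= Lpsi i;
  loss_M_measurable : measurable_fun `]0, rhobar[ Mpsi;
  loss_D_measurable : measurable_fun `]0, rhobar[ Dpsi;
  loss_MD : forall rho : R, 0 < rho < rhobar ->
    0 <= Mpsi rho /\ Mpsi rho <= 1 <= Dpsi rho;
  loss_growth : forall i (x : R), `|psi i x| / (1 + `|x| `^ q0) <= Lpsi i;
  loss_smoothing : exists psir : R -> 'I_m -> R -> R,
    forall rho : R, 0 < rho < rhobar -> forall i,
      [/\ forall x : R, 0 <= psir rho i x,
          C3 (psir rho i),
          (supnorm (fun x : R => (psir rho i x - psi i x)%R) <= (Mpsi rho)%:E)%E &
          forall x : R, [/\
            `|derive1n 1 (psir rho i) x| / (1 + `|psir rho i x| `^ q1) <= Dpsi rho,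
            `|derive1n 2 (psir rho i) x| / (1 + `|psir rho i x| `^ q2) <= Dpsi rho &
            `|derive1n 3 (psir rho i) x| / (1 + `|psir rho i x| `^ q3) <= Dpsi rho]]
}.

Definition max_moment d (T : measurableType d) (R : realType)
    (P : probability T R) (m n : nat) (A0 B0 : 'I_m -> 'I_n -> {RV P >-> R})
    (q : R) : \bar R :=
  (\big[maxe/-oo]_(i < m) \big[maxe/-oo]_(j < n)
     ('E_P[fun t => (`|A0 i j t| `^ q)%R] +
      'E_P[fun t => (`|B0 i j t| `^ q)%R]))%E.

Definition Kg (R : realType) (g : R -> R) : \bar R :=
  (1 + \big[maxe/-oo]_(l < 4) supnorm (g^`(l))%classic)%E.

Definition osc (R : realType) (n : nat) (f : 'cV[R]_n -> R) (L delta : R) :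
    \bar R :=
  ereal_sup [set e | exists w w' : 'cV[R]_n,
    [/\ cube L w, cube L w', forall i, `|w i 0 - w' i 0| <= delta &
        e = `|f w - f w'|%:E]].

Definition omega (R : realType) (n : nat) (q0 q1 : R) : R :=
  n%:R `^ (- (q0 * q1 + 4) / 2).

Definition delta_inf (R : realType) (m n : nat) (q0 q1 q2 q3 : R)
    (Lpsi : 'I_m -> R) (f : 'cV[R]_n -> R) (L : R) : \bar R :=
  let q := qq q1 q2 q3 in
  let qb := qbar q0 q1 q2 q3 in
  ereal_inf [set (osc f L delta +
      ((m%:R^-1 * \sum_(i < m) Lpsi i `^ q) `^ (1 / 3) *
       (L `^ (qb / 3) * logplus (L / delta) `^ (2 / 3)
        / n%:R `^ (1 / 6)))%:E)%E
    | delta in [set delta : R | 0 < delta < omega n q0 q1]].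

Definition rf (R : realType) (m n : nat) (q0 q1 q2 q3 rhobar : R)
    (Lpsi : 'I_m -> R) (Mpsi Dpsi : R -> R) (f : 'cV[R]_n -> R) (L : R) :
    \bar R :=
  ereal_inf [set ((Mpsi rho)%:E +
      (Dpsi rho ^+ 3)%:E * delta_inf q0 q1 q2 q3 Lpsi f L)%E
    | rho in [set rho : R | 0 < rho < rhobar]].

(* Main.v *)
Require Import Defs.
From HB Require Import structures.
From mathcomp Require Import all_boot all_order all_algebra.
From mathcomp Require Import all_classical all_reals all_analysis.
From mathcomp Require Import measurable_realfun zify lra ring.
Set Implicit Arguments.
Unset Strict Implicit.
Unset Printing Implicit Defensive.
Import Order.TTheory GRing.Theory Num.Theory.
Import numFieldNormedType.Exports.
Local Open Scope classical_set_scope.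
Local Open Scope ring_scope.

(* Fix rho and delta. The minimum over S is replaced by the soft-minimum
   - beta^-1 ln (sum_c exp (- beta H c)) over a finite delta-net c of S, with the
   smoothed losses and beta = b m. The law of the matrix enters only through a
   product law on the space of its entries, and Lindeberg's method swaps these
   entries one by one: the second-order Taylor polynomials of
   x |-> g (softmin) in one entry have the same mean under both laws, and its
   third derivative is a combination of Gibbs averages of derivatives of one
   loss psi_i. Chebyshev's association inequality bounds these by the Gibbs
   average of (1 + psi_i)^q, and then by the same average with respect to the
   Gibbs measure that ignores row i. That measure is independent of the i-th
   row, so moments of the i-th row can be integrated under it at the price of a
   constant. Balancing the entropy ln N / beta of the net against the swapping
   error determines b. Expectations of the possibly non-measurable minimum are
   compared with those of the soft-minimum through lower integrals. The
   consequence on probabilities follows by testing with a cubic spline between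
   the two indicators. *)

(** * Product laws and resampling of one coordinate *)

(** The exponents record the argument. The third derivative of the soft-minimum involves psi''',
    psi'' psi' and psi'^3, which are bounded by the powers q3, q1 + q2 and 3 q1 of 1 + psi; their
    maximum is q. Growth of order q0 turns (1 + psi)^q into |x|^(q0 q), and the Taylor remainder
    contributes |x|^3, whence qbar. One swap costs of the order of b^2 m^(-5/2) and there are m n
    swaps, against an entropy of order ell / b, where ell = log_+(L / delta). Balancing makes b^3 of
    order ell sqrt n, which produces n^(-1/6) and ell^(2/3). The obstacle is that the Gibbs weights
    depend on the row whose moments are needed, while a union bound over the net would cost a factor
    exponential in n. With weights that ignore the row, moments at single net points suffice, and
    they are averaged with total weight one. *)

Section product_laws.
Context {R : realType} {I : finType}.

Definition rect (B : I -> set R) : set (I -> R) :=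
  [set a | forall i, B i (a i)].

Definition rects : set (set (I -> R)) :=
  [set rect B | B in [set B | forall i, measurable (B i)]].

(** A copy of [I -> R] with its product sigma-algebra. The generator is closed under intersection,
    which is what uniqueness of laws relies on. *)
Definition coords := g_sigma_algebraType rects.

Definition upd (k : I) (a : I -> R) (x : R) : I -> R :=
  fun i => if i == k then x else a i.
Arguments upd : simpl never.

Lemma updE k a x : upd k a x k = x.
Proof. by rewrite /upd eqxx. Qed.

Lemma updNE k a x i : i != k -> upd k a x i = a i.
Proof. by rewrite /upd => /negbTE ->. Qed.

Lemma rects_setI : setI_closed rects.
Proof.
move=> _ _ [B mB <-] [C mC <-]; exists (fun i => B i `&` C i).
  by move=> i; exact: measurableI.
by apply/seteqP; split => [a /= h|a [h1 h2] i]; [split => i; case: (h i)|split].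
Qed.

Lemma rectsT : rects setT.
Proof. by exists (fun=> setT) => //; apply/seteqP; split. Qed.

Lemma measurable_rect (B : I -> set R) :
  (forall i, measurable (B i)) -> measurable (rect B : set coords).
Proof. by move=> mB; apply: sub_sigma_algebra; exists B. Qed.

Lemma measurable_coord (k : I) :
  measurable_fun setT ((fun a => a k) : coords -> R).
Proof.
move=> _ B mB; rewrite setTI.
rewrite (_ : _ @^-1` _ = rect (fun i => if i == k then B else setT)).
  by apply: measurable_rect => i; case: ifP.
apply/seteqP; split => [a Ba i|a /(_ k)]; last by rewrite eqxx.
by case: ifP => // /eqP ->.
Qed.

Lemma measurable_to_coords d (T : measurableType d) (f : T -> coords) :
  (forall i, measurable_fun setT (fun t => f t i : R)) -> measurable_fun setT f.
Proof.
move=> mf; apply: (@measurability _ _ T coords setT f rects erefl) => _ [_ [B mB <-] <-].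
rewrite setTI (_ : _ @^-1` _ = \bigcap_(i in [set: I]) ((f^~ i) @^-1` B i)).
  apply: fin_bigcap_measurable; first exact: finite_finset.
  by move=> i _; rewrite -[X in measurable X]setTI; exact: mf.
by apply/seteqP; split => [t ht i _|t ht i]; exact: ht.
Qed.

Lemma measurable_upd (k : I) :
  measurable_fun setT ((fun z => upd k z.1 z.2) : coords * R -> coords).
Proof.
apply: measurable_to_coords => i; rewrite /upd.
case: (i == k); first exact: measurable_snd.
exact: (measurableT_comp (measurable_coord i) measurable_fst).
Qed.

Lemma measurable_upd2 (k : I) (a : coords) :
  measurable_fun setT ((fun x => upd k a x) : R -> coords).
Proof.
apply: measurable_to_coords => i; rewrite /upd.
by case: (i == k).
Qed.

(** A predicate instead of a product measure built over [I]: the laws that occur are the joint law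
    of the entries and what resampling makes of it, and both are recognised by their values on
    rectangles. *)
Definition product_law (pi : probability coords R)
    (mu : I -> probability R R) : Prop :=
  forall B : I -> set R, (forall i, measurable (B i)) ->
    pi (rect B) = (\prod_i mu i (B i))%E.

Lemma product_law_unique (pi pi' : probability coords R) mu :
  product_law pi mu -> product_law pi' mu ->
  forall A, measurable A -> pi A = pi' A.
Proof.
move=> h h' A mA; apply: (@measure_unique _ _ coords rects (fun=> setT)) => //.
- exact: rects_setI.
- by move=> _; exact: rectsT.
- by apply/seteqP; split => // x _; exists 0%N.
- by move=> _ [B mB <-]; rewrite [LHS]h// [RHS]h'.
- by move=> _; rewrite [X in (X < _)%E]probability_setT ltry.
Qed.

(** [pi'] is the image of [pi \x nu] under [upd k]; the integral formula is then Tonelli's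
    theorem. *)
Lemma resample_law (pi : probability coords R) mu k (nu : probability R R) :
  product_law pi mu ->
  exists pi' : probability coords R,
    product_law pi' (fun i => if i == k then nu else mu i) /\
    forall f : coords -> \bar R, measurable_fun setT f -> (forall a, 0 <= f a)%E ->
      (\int[pi']_a f a = \int[pi]_a \int[nu]_x f (upd k a x))%E.
Proof.
move=> h.
pose u0 : coords * R -> coords := fun z => upd k z.1 z.2.
pose mu0 := isMeasurableFun.Build _ _ _ _ u0 (measurable_upd k).
pose u : {mfun (coords * R)%type >-> coords} := HB.pack u0 mu0.
have P1 : (pi \x nu)%E [set: coords * R] = 1%E.
  rewrite -setXTT product_measure1E//.
  transitivity (pi setT * nu setT)%E => //.
  by rewrite !probability_setT mule1.
pose Pm : probability (coords * R)%type R :=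
  HB.pack (pi \x nu)%E (Measure_isProbability.Build _ _ _ (pi \x nu)%E P1).
exists (distribution Pm u); split.
  move=> B mB; rewrite /distribution/= /pushforward/=.
  rewrite (_ : _ @^-1` _ =
      rect (fun i => if i == k then setT else B i) `*` B k); last first.
    apply/seteqP; split => [[a x] H|[a x] [H Bx] i].
      split => [i|] /=; last by rewrite -(updE k a x); exact: H.
      by case: eqVneq => // ik; rewrite -(updNE a x ik); exact: H.
    change (B i (upd k a x i)).
    have [->|ik] := eqVneq i k; rewrite ?updE// updNE//.
    by move: (H i) => /=; rewrite (negbTE ik).
  rewrite product_measure1E//; last first.
    by apply: measurable_rect => i; case: ifP.
  rewrite [X in (X * _)%E]h; last by move=> i; case: ifP.
  rewrite (bigD1 k)//= [RHS](bigD1 k)//= !eqxx probability_setT mul1e muleC.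
  by congr (_ * _)%E; apply: eq_bigr => i /negbTE ->.
move=> f mf f0; rewrite ge0_integral_distribution//.
rewrite (@fubini_tonelli1 _ _ _ _ _ pi nu)//.
  exact: measurableT_comp.
by move=> z; exact: f0.
Qed.

(** Resampling a coordinate from its own law changes nothing, by uniqueness. This plays the role of
    conditioning on all the other coordinates. *)
Lemma integral_resample (pi : probability coords R) mu k (f : coords -> \bar R) :
  product_law pi mu -> measurable_fun setT f -> (forall a, 0 <= f a)%E ->
  (\int[pi]_a f a = \int[pi]_a \int[mu k]_x f (upd k a x))%E.
Proof.
move=> h mf f0; have [pi' [h' E]] := resample_law k (mu k) h.
rewrite -E//; apply: eq_measure_integral => A mA _.
apply: (product_law_unique h) => // B mB; rewrite h'//; apply: eq_bigr => i _.
by case: eqVneq => // ->.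
Qed.

Lemma measurable_integral_upd (k : I) (nu : probability R R) (f : coords -> \bar R) :
  measurable_fun setT f -> (forall a, 0 <= f a)%E ->
  measurable_fun setT ((fun a => \int[nu]_x f (upd k a x))%E : coords -> \bar R).
Proof.
move=> mf f0.
have := @measurable_fun_fubini_tonelli_F _ _ coords R R nu
  (fun z => f (upd k z.1 z.2)).
apply; last by move=> z; exact: f0.
exact: measurableT_comp mf (measurable_upd k).
Qed.

End product_laws.
Arguments coords : clear implicits.

(** * Lower integrals and comparison of possibly non-measurable integrands *)

Section integral_facts.
Context d (T : measurableType d) (R : realType).

(* [f] and [g] need not be measurable: the integral of a nonnegative function is
   a supremum over the simple functions below it. *)
Lemma le_lower_integral (mu : {measure set T -> \bar R}) (f g : T -> \bar R) :
  (forall x, 0 <= f x)%E -> (forall x, f x <= g x)%E ->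
  (\int[mu]_x f x <= \int[mu]_x g x)%E.
Proof.
move=> f0 fg; have g0 x : (0 <= g x)%E by exact: le_trans (f0 x) (fg x).
rewrite !ge0_integralTE//; apply: le_ereal_sup => _ [h /= hf <-].
by exists h => // x; exact: le_trans (hf x) (fg x).
Qed.

Lemma integral_prob_cst (P : probability T R) (r : R) :
  (\int[P]_t r%:E = r%:E)%E.
Proof. by rewrite -[RHS](expectation_cst P r) unlock. Qed.

Let lower_part (P : probability T R) (h h' e : T -> R) :
  measurable_fun setT h' -> measurable_fun setT e ->
  (forall t, 0 <= h t) -> (forall t, 0 <= h' t) -> (forall t, 0 <= e t) ->
  (forall t, `|h t - h' t| <= e t) ->
  (\int[P]_t (h t)%:E <= \int[P]_t (h' t)%:E + \int[P]_t (e t)%:E)%E /\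
  (\int[P]_t (h' t)%:E <= \int[P]_t (h t)%:E + \int[P]_t (e t)%:E)%E.
Proof.
move=> mh' me h0 h'0 e0 H; split.
  rewrite -ge0_integralD//; last 4 first.
  - by move=> t _; rewrite lee_fin.
  - exact/measurable_EFinP.
  - by move=> t _; rewrite lee_fin.
  - exact/measurable_EFinP.
  apply: le_lower_integral => t; rewrite ?lee_fin//.
  by move: (H t); rewrite ler_norml => /andP[_]; lra.
(* A measurable minorant of [h] with [h' <= l + e]: additivity is applied to [l + e], since [h + e]
   may fail to be measurable. *)
pose l t := Num.max 0 (h' t - e t).
have l0 t : 0 <= l t by rewrite /l le_max lexx.
have ml : measurable_fun setT l.
  by apply: measurable_maxr => //; exact: measurable_funB.
apply: (@le_trans _ _ (\int[P]_t ((l t)%:E + (e t)%:E))%E).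
  apply: le_lower_integral => t; rewrite ?lee_fin//.
  by rewrite -lerBlDr /l le_max lexx orbT.
rewrite ge0_integralD//; last 4 first.
- by move=> t _; rewrite lee_fin.
- exact/measurable_EFinP.
- by move=> t _; rewrite lee_fin.
- exact/measurable_EFinP.
apply: leeD2r; apply: le_lower_integral => t; rewrite ?lee_fin//.
rewrite /l ge_max h0/=.
by move: (H t); rewrite ler_norml => /andP[]; lra.
Qed.

(* [h] need not be measurable: its integral is then the difference of the
   lower integrals of its positive and negative parts, which are not additive,
   hence the factor 2. *)
Lemma integral_approx (P : probability T R) (K : R) (h h' e : T -> R) :
  measurable_fun setT h' -> measurable_fun setT e ->
  (forall t, `|h' t| <= K) -> (forall t, `|h t - h' t| <= e t) ->
  (`| \int[P]_t (h t)%:E - \int[P]_t (h' t)%:E | <=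
   2%:E * \int[P]_t (e t)%:E)%E.
Proof.
move=> mh' me hK H.
have e0 t : 0 <= e t by exact: le_trans (H t).
have K0 : 0 <= K by case: (pselect (exists t : T, True)) => [[t _]|nT];
  [exact: le_trans (hK t)|exfalso; apply: nT; exists point].
have [->|eoo] := eqVneq (\int[P]_t (e t)%:E)%E +oo%E.
  by rewrite gt0_muley ?lte_fin// leey.
have ie0 : (0 <= \int[P]_t (e t)%:E)%E.
  by apply: integral_ge0 => t _; rewrite lee_fin.
have efin : (\int[P]_t (e t)%:E)%E \is a fin_num.
  by rewrite ge0_fin_numE// lt_neqAle eoo leey.
have pos_part (f : T -> R) t : ((fun t => (f t)%:E) ^\+ t)%E = (Num.max (f t) 0)%:E.
  by rewrite funeposE EFin_max.
have neg_part (f : T -> R) t : ((fun t => (f t)%:E) ^\- t)%E = (Num.max (- f t) 0)%:E.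
  by rewrite funenegE EFin_max.
have max_dist (a b : R) : `|Num.max a 0 - Num.max b 0| <= `|a - b|.
  have h1 := ler_norm (a - b); have := ler_norm (b - a); rewrite distrC => h2.
  rewrite ler_norml; apply/andP.
  by have [a0|a0] := leP a 0; have [b0|b0] := leP b 0; split; lra.
rewrite integralE [X in (_ - X)%E]integralE.
under [X in (X - _ - _)%E]eq_integral do rewrite pos_part.
under [X in (_ - X - _)%E]eq_integral do rewrite neg_part.
under [X in (_ - (X - _))%E]eq_integral do rewrite pos_part.
under [X in (_ - (_ - X))%E]eq_integral do rewrite neg_part.
have bfin (f : T -> R) : (forall t, 0 <= f t <= K) ->
    (\int[P]_t (f t)%:E)%E \is a fin_num.
  move=> fK; rewrite ge0_fin_numE; last first.
    by apply: integral_ge0 => t _; rewrite lee_fin; case/andP: (fK t).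
  apply: (@le_lt_trans _ _ (\int[P]_t K%:E)%E).
    by apply: le_lower_integral => t; rewrite lee_fin; case/andP: (fK t).
  by rewrite integral_prob_cst ltry.
have mpos : measurable_fun setT (fun t => Num.max (h' t) 0).
  exact: measurable_maxr.
have mneg : measurable_fun setT (fun t => Num.max (- h' t) 0).
  by apply: measurable_maxr => //; exact: measurableT_comp.
have Hn t : `|- h t - - h' t| <= e t by rewrite opprK addrC distrC.
have ge0 (f : T -> R) t : 0 <= Num.max (f t) 0 by rewrite le_max lexx orbT.
have [p1 p2] := @lower_part P (fun t => Num.max (h t) 0) _ e mpos me
  (ge0 _) (ge0 _) e0 (fun t => le_trans (max_dist _ _) (H t)).
have [n1 n2] := @lower_part P (fun t => Num.max (- h t) 0) _ e mneg me
  (ge0 (fun t => - h t)) (ge0 (fun t => - h' t)) e0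
  (fun t => le_trans (max_dist _ _) (Hn t)).
have f1 : (\int[P]_t (Num.max (h' t) 0)%:E)%E \is a fin_num.
  apply: bfin => t; rewrite le_max lexx orbT/= ge_max K0 andbT.
  by move: (hK t); rewrite ler_norml => /andP[].
have f2 : (\int[P]_t (Num.max (- h' t) 0)%:E)%E \is a fin_num.
  apply: bfin => t; rewrite le_max lexx orbT/= ge_max K0 andbT.
  by move: (hK t); rewrite ler_norml => /andP[]; lra.
have f3 : (\int[P]_t (Num.max (h t) 0)%:E)%E \is a fin_num.
  rewrite ge0_fin_numE; last first.
    by apply: integral_ge0 => t _; rewrite lee_fin le_max lexx orbT.
  by apply: (le_lt_trans p1); apply: lte_add_pinfty; rewrite ltey_eq ?f1 ?efin.
have f4 : (\int[P]_t (Num.max (- h t) 0)%:E)%E \is a fin_num.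
  rewrite ge0_fin_numE; last first.
    by apply: integral_ge0 => t _; rewrite lee_fin le_max lexx orbT.
  by apply: (le_lt_trans n1); apply: lte_add_pinfty; rewrite ltey_eq ?f2 ?efin.
move: p1 p2 n1 n2 => /=.
rewrite -(fineK f1) -(fineK f2) -(fineK f3) -(fineK f4) -(fineK efin).
rewrite -!EFinB -!EFinD -?EFinN -?EFinD -EFinM !lee_fin => p1 p2 n1 n2.
by rewrite ler_norml; apply/andP; split; lra.
Qed.

End integral_facts.

(** * Moments of one variable and of weighted sums *)

Section moments.
Context {R : realType}.
Implicit Types mu nu : probability R R.

Lemma integral_quadratic mu (s c0 c1 c2 : R) :
  mu.-integrable setT (fun x => x%:E) -> (\int[mu]_x x%:E = 0)%E ->
  mu.-integrable setT (fun x => (x ^+ 2)%:E) ->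
  (\int[mu]_x (x ^+ 2)%:E = s%:E)%E ->
  mu.-integrable setT (fun x => (c0 + c1 * x + c2 * x ^+ 2)%:E) /\
  (\int[mu]_x (c0 + c1 * x + c2 * x ^+ 2)%:E = (c0 + c2 * s)%:E)%E.
Proof.
move=> i1 m1 i2 m2.
have E : (fun x : R => (c0 + c1 * x + c2 * x ^+ 2)%:E) =
    (fun x => (c0%:E + c1%:E * x%:E) + c2%:E * (x ^+ 2)%:E)%E.
  by apply/funext => x; rewrite !EFinD !EFinM.
have j0 : mu.-integrable setT (fun x : R => c0%:E).
  exact: finite_measure_integrable_cst.
have j1 : mu.-integrable setT (fun x : R => c1%:E * x%:E)%E.
  exact: integrableZl.
have j2 : mu.-integrable setT (fun x : R => c2%:E * (x ^+ 2)%:E)%E.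
  exact: integrableZl.
have j3 : mu.-integrable setT (fun x : R => c0%:E + c1%:E * x%:E)%E.
  exact: integrableD.
split; rewrite E; first exact: integrableD.
rewrite integralD// integralD// !integralZl// m1 m2 integral_prob_cst.
by rewrite mule0 adde0.
Qed.

(** The comparison value involves [mu] only through its variance [s], so two centred laws with equal
    variances are both compared with the same number. *)
Lemma integral_quadratic_approx mu (s c0 c1 c2 : R) (phi rho : R -> R) :
  mu.-integrable setT (fun x => x%:E) -> (\int[mu]_x x%:E = 0)%E ->
  mu.-integrable setT (fun x => (x ^+ 2)%:E) ->
  (\int[mu]_x (x ^+ 2)%:E = s%:E)%E ->
  mu.-integrable setT (fun x => (phi x)%:E) -> measurable_fun setT rho ->
  (forall x, `|phi x - (c0 + c1 * x + c2 * x ^+ 2)| <= rho x) ->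
  (`| \int[mu]_x (phi x)%:E - (c0 + c2 * s)%:E | <= \int[mu]_x (rho x)%:E)%E.
Proof.
move=> i1 m1 i2 m2 iphi mrho H.
have [iq <-] := integral_quadratic c0 c1 c2 i1 m1 i2 m2.
rewrite -integralB//.
have mb := measurable_int _ (integrableB measurableT iphi iq).
apply: le_trans (le_abse_integral _ _ _) _ => //.
apply: ge0_le_integral => //.
- by apply: measurableT_comp.
- exact/measurable_EFinP.
by move=> x _; rewrite -EFinB lee_fin.
Qed.

(** A one-sided bound is enough to make the linear term disappear. Integrability of [f] follows by
    domination once the integral of [rho] is finite, and otherwise the bound is trivial. *)
Lemma le_integral_affine mu (c0 c1 : R) (f rho : R -> R) :
  mu.-integrable setT (fun x => x%:E) -> (\int[mu]_x x%:E = 0)%E ->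
  measurable_fun setT f -> (forall x, 0 <= f x) ->
  measurable_fun setT rho -> (forall x, 0 <= rho x) ->
  (forall x, f x <= c0 + c1 * x + rho x) ->
  (\int[mu]_x (f x)%:E <= c0%:E + \int[mu]_x (rho x)%:E)%E.
Proof.
move=> i1 m1 mf f0 mrho rho0 H.
have [->|roo] := eqVneq (\int[mu]_x (rho x)%:E)%E +oo%E.
  by rewrite addey// leey.
have irho : mu.-integrable setT (fun x => (rho x)%:E).
  apply/integrableP; split; first exact/measurable_EFinP.
  under eq_integral do rewrite /= ger0_norm//.
  by rewrite lt_neqAle roo leey.
have j0 : mu.-integrable setT (fun x : R => c0%:E).
  exact: finite_measure_integrable_cst.
have j1 : mu.-integrable setT (fun x : R => c1%:E * x%:E)%E.
  exact: integrableZl.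
have j3 : mu.-integrable setT (fun x : R => c0%:E + c1%:E * x%:E)%E.
  exact: integrableD.
have j4 : mu.-integrable setT (fun x : R => c0%:E + c1%:E * x%:E + (rho x)%:E)%E.
  exact: integrableD.
have if_ : mu.-integrable setT (fun x => (f x)%:E).
  apply: le_integrable j4 => //; first exact/measurable_EFinP.
  move=> x _; rewrite -EFinM -!EFinD lee_fin ger0_norm//.
  exact: le_trans (H x) (ler_norm _).
apply: (@le_trans _ _ (\int[mu]_x (c0%:E + c1%:E * x%:E + (rho x)%:E))%E).
  by apply: le_integral => // x _; rewrite -EFinM -!EFinD lee_fin.
rewrite integralD// integralD// integralZl// m1 integral_prob_cst.
by rewrite mule0 adde0.
Qed.

(** In the binomial expansion, a term of degree [l >= 2] in [x] is at most the term of degree 2 if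
    [|x| <= |s|], and at most the pure power of [x] otherwise. The binomial coefficients add up to a
    power of 2. *)
Lemma even_pow_le (r : nat) (s x : R) :
  (s + x) ^+ (r.+1).*2 <= s ^+ (r.+1).*2 + ((r.+1).*2)%:R * s ^+ (r.*2).+1 * x +
    2 ^+ (r.+1).*2 * (s ^+ r.*2 * x ^+ 2 + x ^+ (r.+1).*2).
Proof.
set n := (r.+1).*2.
have nE : n = (r.*2).+2 by rewrite /n doubleS.
have ev (y : R) k : `|y| ^+ k.*2 = y ^+ k.*2.
  by rewrite -mul2n !exprM real_normK ?num_real.
have key (l : nat) : (2 <= l <= n)%N ->
    s ^+ (n - l) * x ^+ l <= s ^+ r.*2 * x ^+ 2 + x ^+ n.
  move=> /andP[l2 ln].
  apply: le_trans (ler_norm _) _; rewrite normrM !normrX.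
  rewrite -(ev s) -(ev x r.+1) -[x ^+ 2](ev x 1%N).
  have [xs|sx] := leP `|x| `|s|.
    apply: (@le_trans _ _ (`|s| ^+ r.*2 * `|x| ^+ 2)); last first.
      by rewrite lerDl exprn_ge0.
    have -> : r.*2 = ((n - l) + (l - 2))%N by rewrite nE; lia.
    rewrite exprD -mulrA ler_wpM2l ?exprn_ge0//.
    have -> : (`|x| ^+ l = `|x| ^+ (l - 2) * `|x| ^+ 2) by rewrite -exprD subnK.
    by rewrite ler_wpM2r ?exprn_ge0// lerXn2r.
  apply: (@le_trans _ _ (`|x| ^+ n)); last first.
    by rewrite lerDr mulr_ge0 ?exprn_ge0.
  have -> : `|x| ^+ n = `|x| ^+ (n - l) * `|x| ^+ l by rewrite -exprD subnK.
  by rewrite ler_wpM2r ?exprn_ge0// lerXn2r// ltW.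
rewrite exprDn nE 2!big_ord_recl /= bin0 bin1 subn0 expr0 mulr1 mulr1n.
rewrite /bump /= !add1n subn1 /= expr1 -mulrA -mulr_natl -addrA lerD2l mulrA lerD2l.
rewrite -[_.+2]nE.
apply: (@le_trans _ _ (\sum_(i < r.*2.+1) ('C(n, i.+2))%:R *
   (s ^+ r.*2 * x ^+ 2 + x ^+ n))).
  apply: ler_sum => i _; rewrite -[X in X <= _]mulr_natl ler_wpM2l//.
  by apply: key; have := ltn_ord i; rewrite nE; lia.
rewrite -mulr_suml ler_wpM2r//.
  have ev0 (y : R) k : 0 <= y ^+ k.*2 by rewrite -ev exprn_ge0.
  by apply: addr_ge0; [apply: mulr_ge0; [exact: ev0|exact: (ev0 x 1%N)]|exact: ev0].
rewrite -natr_sum -natrX ler_nat.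
rewrite -[X in (_ <= X ^ _)%N]addn1 expnDn.
under [X in (_ <= X)%N]eq_bigr do rewrite !exp1n !muln1.
rewrite -!(big_mkord xpredT (fun i => 'C(n, i))) -(big_mkord xpredT (fun i => 'C(n, i.+2))).
rewrite [X in (_ <= X)%N]big_ltn// [X in (_ <= _ + X)%N]big_ltn; last by rewrite nE.
by rewrite [X in (_ <= _ + (_ + X))%N]big_add1 big_add1 nE /= addnA leq_addl.
Qed.

End moments.

Section weighted_moment.
Context {R : realType} {I : finType}.

(** Constant of a Marcinkiewicz-Zygmund type bound: the moment of order 2 r of a sum of N
    independent centred terms is at most this constant times N^r. The power of 2 comes from
    [even_pow_le]. *)
Fixpoint moment_const (B : R) (r : nat) : R :=
  if r is r'.+1 then 2 ^+ (r.*2) * B * (moment_const B r' + 1) else 1.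

Lemma moment_const_ge0 B r : 0 <= B -> 0 <= moment_const B r.
Proof.
move=> B0; elim: r => //= r IH.
by apply: mulr_ge0; [rewrite mulr_ge0// exprn_ge0|rewrite addr_ge0].
Qed.

Definition lincomb (c : I -> R) (J : seq I) (a : coords R I) : R :=
  \sum_(k <- J) c k * a k.

Lemma measurable_lincomb c J : measurable_fun setT (lincomb c J).
Proof.
apply: measurable_sum => k; apply: measurable_funM; first exact: measurable_cst.
exact: measurable_coord.
Qed.

Lemma lincomb_upd c J k a x : k \notin J ->
  lincomb c J (upd k a x) = lincomb c J a.
Proof.
move=> kJ; apply: eq_big_seq => i iJ; rewrite updNE//.
by apply: contraNneq kJ => <-.
Qed.

Lemma expr_double_ge0 (x : R) r : 0 <= x ^+ r.*2.
Proof. by rewrite exprn_even_ge0// odd_double. Qed.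

Ltac nonneg := repeat first
  [done | assumption | apply: expr_double_ge0 | apply: sqr_ge0
  | apply: exprn_ge0 | apply: powR_ge0 | apply: mulr_ge0 | apply: addr_ge0].

Let scaled_even_le (c x : R) l : `|c| <= 1 -> (c * x) ^+ l.*2 <= x ^+ l.*2.
Proof.
move=> c1; rewrite exprMn ler_piMl ?expr_double_ge0//.
by rewrite -mul2n exprM -real_normK ?num_real// -exprM exprn_ile1.
Qed.

Let resampled_pow_le (mu : probability R R) (B w s c : R) (r : nat) :
  0 <= B -> 0 <= w -> `|c| <= 1 ->
  mu.-integrable setT (fun x => x%:E) -> (\int[mu]_x x%:E = 0)%E ->
  (\int[mu]_x (x ^+ 2)%:E <= B%:E)%E ->
  (\int[mu]_x (x ^+ (r.+1).*2)%:E <= B%:E)%E ->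
  (\int[mu]_x (w * (c * x + s) ^+ (r.+1).*2)%:E <=
    (w * s ^+ (r.+1).*2 + 2 ^+ (r.+1).*2 * B * (w * s ^+ r.*2 + w))%:E)%E.
Proof.
move=> B0 w0 c1 i1 m1 m2 m3; set C := 2 ^+ (r.+1).*2.
have C0 : 0 <= C by exact: exprn_ge0.
have mX k : measurable_fun setT (fun x : R => x ^+ k).
  exact: exprn_measurable.
apply: le_trans (@le_integral_affine _ mu (w * s ^+ (r.+1).*2)
    (w * (((r.+1).*2)%:R * s ^+ (r.*2).+1 * c)) _
    (fun x => C * (w * s ^+ r.*2) * x ^+ 2 + C * w * x ^+ (r.+1).*2)
    _ _ _ _ _ _ _) _ => //.
- apply: measurable_funM => //; apply: measurable_funX; apply: measurable_funD => //.
- by move=> x; rewrite mulr_ge0// expr_double_ge0.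
- by apply: measurable_funD; apply: measurable_funM => //; exact: mX.
- by move=> x; nonneg.
- move=> x; rewrite [c * x + s]addrC.
  apply: (@le_trans _ _ (w * (s ^+ (r.+1).*2 +
      ((r.+1).*2)%:R * s ^+ (r.*2).+1 * (c * x) +
      C * (s ^+ r.*2 * x ^+ 2 + x ^+ (r.+1).*2)))); last by lra.
  rewrite ler_wpM2l//; apply: le_trans (even_pow_le r s (c * x)) _.
  rewrite lerD2l ler_wpM2l// lerD ?scaled_even_le// ler_wpM2l ?expr_double_ge0//.
  exact: (scaled_even_le x 1).
rewrite EFinD; apply: leeD2l.
have k1 : 0 <= C * (w * s ^+ r.*2) by nonneg.
have k2 : 0 <= C * w by nonneg.
under eq_integral do rewrite EFinD (EFinM (C * (w * _))) (EFinM (C * w)).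
rewrite ge0_integralD//; last 4 first.
- by move=> x _; rewrite mule_ge0// lee_fin ?sqr_ge0.
- by apply: measurable_funeM; exact/measurable_EFinP.
- by move=> x _; rewrite mule_ge0// lee_fin ?expr_double_ge0.
- by apply: measurable_funeM; exact/measurable_EFinP.
rewrite ge0_integralZl//; last 2 first.
- exact/measurable_EFinP.
- by move=> x _; rewrite lee_fin sqr_ge0.
rewrite ge0_integralZl//; last 2 first.
- exact/measurable_EFinP.
- by move=> x _; rewrite lee_fin expr_double_ge0.
apply: (@le_trans _ _ ((C * (w * s ^+ r.*2))%:E * B%:E + (C * w)%:E * B%:E)%E).
  by apply: leeD; apply: lee_wpmul2l; rewrite // lee_fin; nonneg.
by rewrite -!EFinM -EFinD lee_fin; lra.
Qed.

(* Adding one coordinate at a time, the term of first order in the new coordinate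
   vanishes because [W] does not depend on it. *)
Lemma weighted_even_moment (pi : probability (coords R I) R) mu (B w : R)
    (r : nat) (W : coords R I -> R) (c : I -> R) (J : seq I) :
  product_law pi mu -> 0 <= B -> uniq J ->
  measurable_fun setT W -> (forall a, 0 <= W a) ->
  (\int[pi]_a (W a)%:E = w%:E)%E ->
  (forall k, k \in J -> forall a x, W (upd k a x) = W a) ->
  (forall k, `|c k| <= 1) ->
  (forall k, (mu k).-integrable setT (fun x => x%:E)) ->
  (forall k, \int[mu k]_x x%:E = 0)%E ->
  (forall k l, (0 < l <= r)%N -> \int[mu k]_x (x ^+ l.*2)%:E <= B%:E)%E ->
  (\int[pi]_a (W a * lincomb c J a ^+ r.*2)%:E <=
     (moment_const B r * (size J)%:R ^+ r * w)%:E)%E.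
Proof.
move=> hpi B0 uJ mW W0 Ww WJ c1 i1 m1 mB.
have w0 : 0 <= w by rewrite -lee_fin -Ww integral_ge0// => a _; rewrite lee_fin.
have mWl J' r' : measurable_fun setT (fun a => W a * lincomb c J' a ^+ r').
  apply: measurable_funM => //; apply: measurable_funX; exact: measurable_lincomb.
have Wl0 J' r' a : 0 <= W a * lincomb c J' a ^+ r'.*2.
  by rewrite mulr_ge0// expr_double_ge0.
(* Double induction: adding the coordinate [k] creates, besides the same moment over [J], a moment
   of order [r] over [J], for which the outer hypothesis is used. *)
elim: r mB J uJ WJ => [|r IHr] mB; elim=> [|k J IHJ] uJ WJ.
- by under eq_integral do rewrite expr0 mulr1; rewrite expr0 !mul1r Ww.
- by under eq_integral do rewrite expr0 mulr1; rewrite expr0 !mul1r Ww.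
- under eq_integral do rewrite /lincomb big_nil expr0n/= mulr0.
  by rewrite integral0 lee_fin; nonneg; exact: moment_const_ge0.
have /andP[kJ uJ'] := uJ.
have {}WJ' : forall i, i \in J -> forall a x, W (upd i a x) = W a.
  by move=> i iJ; apply: WJ; rewrite inE iJ orbT.
have {}IHJ := IHJ uJ' WJ'.
have {}IHr := IHr (fun k l h => mB k l ltac:(lia)) J uJ' WJ'.
set C := 2 ^+ (r.+1).*2 : R.
have C0 : 0 <= C by exact: exprn_ge0.
rewrite (integral_resample k hpi)//; last 2 first.
- exact/measurable_EFinP.
- by move=> a; rewrite lee_fin.
apply: (@le_trans _ _ (\int[pi]_a (W a * lincomb c J a ^+ (r.+1).*2 +
    C * B * (W a * lincomb c J a ^+ r.*2 + W a))%:E)%E).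
  apply: ge0_le_integral => //.
  - by move=> a _; apply: integral_ge0 => x _; rewrite lee_fin.
  - apply: (measurable_integral_upd k (mu k) (f := fun a => (W a * lincomb c (k :: J) a ^+ (r.+1).*2)%:E)).
      exact/measurable_EFinP.
    by move=> a; rewrite lee_fin.
  - apply/measurable_EFinP; apply: measurable_funD => //.
    by apply: measurable_funM => //; exact: measurable_funD.
  move=> a _.
  under eq_integral => x _.
    rewrite /lincomb big_cons -/(lincomb c J _) WJ ?mem_head// updE lincomb_upd//.
    over.
  by apply: resampled_pow_le => //; [exact: (mB k 1%N isT)|apply: (mB k r.+1); rewrite leqnn].
under eq_integral do rewrite EFinD.
rewrite ge0_integralD//; last 4 first.
- by move=> a _; rewrite lee_fin.
- exact/measurable_EFinP.
- by move=> a _; rewrite lee_fin; apply: mulr_ge0; [exact: mulr_ge0|exact: addr_ge0].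
- by apply/measurable_EFinP; apply: measurable_funM => //; exact: measurable_funD.
under [X in (_ + X <= _)%E]eq_integral do rewrite EFinM.
rewrite ge0_integralZl//; last 3 first.
- by apply/measurable_EFinP; exact: measurable_funD.
- by move=> a _; rewrite lee_fin addr_ge0.
- by rewrite lee_fin mulr_ge0.
under [X in (_ + _ * X <= _)%E]eq_integral do rewrite EFinD.
rewrite ge0_integralD//; last 4 first.
- by move=> a _; rewrite lee_fin.
- exact/measurable_EFinP.
- by move=> a _; rewrite lee_fin.
- exact/measurable_EFinP.
rewrite Ww.
apply: (@le_trans _ _ ((moment_const B r.+1 * (size J)%:R ^+ r.+1 * w)%:E +
   (C * B)%:E * ((moment_const B r * (size J)%:R ^+ r * w)%:E + w%:E))%E).
  by apply: leeD => //; apply: lee_wpmul2l; [rewrite lee_fin mulr_ge0|exact: leeD2r].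
rewrite -[X in (_ + _ * X <= _)%E]EFinD -[X in (_ + X <= _)%E]EFinM.
rewrite -[X in (X <= _)%E]EFinD lee_fin /= -/C.
set N : R := (size J)%:R; set K := moment_const B r.
have K0 : 0 <= K by exact: moment_const_ge0.
have N0 : 0 <= N by rewrite ler0n.
have -> : (size J).+1%:R = N + 1 :> R by rewrite -natr1.
(* The N increments, each of order N^r, add up to the order N^(r+1). *)
have h1 : N ^+ r.+1 + (N + 1) ^+ r <= (N + 1) ^+ r.+1.
  rewrite [in leRHS]exprSr mulrDr mulr1 lerD2r exprSr ler_wpM2r//.
  by rewrite lerXn2r ?nnegrE ?addr_ge0// lerDl.
have h2 : K * N ^+ r + 1 <= (K + 1) * (N + 1) ^+ r.
  rewrite mulrDl mul1r lerD//; last by rewrite exprn_ege1// lerDr.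
  by rewrite ler_wpM2l// lerXn2r ?nnegrE ?addr_ge0// lerDl.
have CB0 : 0 <= C * B by rewrite mulr_ge0.
apply: (@le_trans _ _ (C * B * (K + 1) * N ^+ r.+1 * w + C * B * ((K + 1) * (N + 1) ^+ r) * w)).
  rewrite lerD2l; move: h2; set P := K * N ^+ r; set Q := (K + 1) * _ => h2.
  by have := ler_wpM2l (mulr_ge0 CB0 w0) h2; rewrite /P; lra.
move: h1; set P := N ^+ r.+1; set Q := (N + 1) ^+ r; set S := (N + 1) ^+ r.+1.
move=> h1; have K1 : 0 <= C * B * (K + 1) * w by rewrite mulr_ge0// mulr_ge0// addr_ge0.
by have := ler_wpM2l K1 h1; lra.
Qed.

End weighted_moment.

(** * Lindeberg's swapping argument *)

Section lindeberg.
Context {R : realType} {I : finType}.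
Variables (mu nu : I -> probability R R) (s : I -> R).
Hypothesis mu1 : forall k, (mu k).-integrable setT (fun x => x%:E).
Hypothesis nu1 : forall k, (nu k).-integrable setT (fun x => x%:E).
Hypothesis mu2 : forall k, (mu k).-integrable setT (fun x => (x ^+ 2)%:E).
Hypothesis nu2 : forall k, (nu k).-integrable setT (fun x => (x ^+ 2)%:E).
Hypothesis mu_mean : forall k, (\int[mu k]_x x%:E = 0)%E.
Hypothesis nu_mean : forall k, (\int[nu k]_x x%:E = 0)%E.
Hypothesis mu_var : forall k, (\int[mu k]_x (x ^+ 2)%:E = (s k)%:E)%E.
Hypothesis nu_var : forall k, (\int[nu k]_x (x ^+ 2)%:E = (s k)%:E)%E.

Variables (phi : coords R I -> R) (K : R) (err : I -> R).
Hypothesis mphi : measurable_fun setT phi.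
Hypothesis phi0 : forall a, 0 <= phi a.
Hypothesis phiK : forall a, phi a <= K.

Variable G : I -> coords R I -> R.
Hypothesis mG : forall k, measurable_fun setT (G k).
Hypothesis G0 : forall k a, 0 <= G k a.
Hypothesis phiG : forall k a, exists c0 c1 c2 : R, exists rho : R -> R,
  [/\ measurable_fun setT rho,
      forall x, `|phi (upd k a x) - (c0 + c1 * x + c2 * x ^+ 2)| <= rho x,
      (\int[mu k]_x (rho x)%:E <= (G k a)%:E)%E &
      (\int[nu k]_x (rho x)%:E <= (G k a)%:E)%E].

Definition hybrid_law (J : seq I) i := if i \in J then nu i else mu i.

(** When [k] is swapped, the remaining coordinates follow a mixture of both families, so the
    remainder has to be integrable under every intermediate law. *)
Hypothesis Gerr : forall (k : I) (J : seq I) (pi : probability (coords R I) R),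
  product_law pi (hybrid_law J) -> (\int[pi]_a (G k a)%:E <= (err k)%:E)%E.

Let phi_int (k : I) a (la : probability R R) :
  la.-integrable setT (fun x => (phi (upd k a x))%:E).
Proof.
apply: (@le_integrable _ _ _ _ _ measurableT _ (EFin \o cst K)).
- apply/measurable_EFinP; exact: measurableT_comp mphi (measurable_upd2 k a).
- by move=> x _; rewrite /= lee_fin !ger0_norm// (le_trans (phi0 a)).
- exact: finite_measure_integrable_cst.
Qed.

(** Both integrals lie within [G k a] of the common value [c0 + c2 * s k]; this explains the factor
    2. *)
Let inner_close k a :
  (\int[mu k]_x (phi (upd k a x))%:E <=
    \int[nu k]_x (phi (upd k a x))%:E + (2 * G k a)%:E)%E /\
  (\int[nu k]_x (phi (upd k a x))%:E <=
    \int[mu k]_x (phi (upd k a x))%:E + (2 * G k a)%:E)%E.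
Proof.
have [c0 [c1 [c2 [rho [mrho H r1 r2]]]]] := phiG k a.
have := le_trans (integral_quadratic_approx (mu1 k) (mu_mean k) (mu2 k)
  (mu_var k) (phi_int k a _) mrho H) r1.
have := le_trans (integral_quadratic_approx (nu1 k) (nu_mean k) (nu2 k)
  (nu_var k) (phi_int k a _) mrho H) r2.
have f1 := integrable_fin_num measurableT (phi_int k a (mu k)).
have f2 := integrable_fin_num measurableT (phi_int k a (nu k)).
rewrite -(fineK f1) -(fineK f2) -!EFinB -!EFinD !lee_fin !ler_norml.
by move=> /andP[h1 h2] /andP[h3 h4]; split; lra.
Qed.

(** As [k] has not been swapped yet, [pi] is its own resampling from [mu k], whereas [pi'] is the
    resampling from [nu k]; the two differ in the inner integral only. *)
Let step k J (pi pi' : probability (coords R I) R) : k \notin J ->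
  product_law pi (hybrid_law J) ->
  (forall f : coords R I -> \bar R, measurable_fun setT f -> (forall a, 0 <= f a)%E ->
      (\int[pi']_a f a = \int[pi]_a \int[nu k]_x f (upd k a x))%E) ->
  (\int[pi]_a (phi a)%:E <= \int[pi']_a (phi a)%:E + (2 * err k)%:E)%E /\
  (\int[pi']_a (phi a)%:E <= \int[pi]_a (phi a)%:E + (2 * err k)%:E)%E.
Proof.
move=> kJ hpi hpi'.
have mphiE : measurable_fun setT (fun a : coords R I => (phi a)%:E).
  exact/measurable_EFinP.
have phiE0 a : (0 <= (phi a)%:E)%E by rewrite lee_fin.
rewrite hpi'// (integral_resample k hpi mphiE phiE0).
have -> : hybrid_law J k = mu k by rewrite /hybrid_law (negbTE kJ).
have i0 (la : probability R R) a : (0 <= \int[la]_x (phi (upd k a x))%:E)%E.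
  by apply: integral_ge0.
have im (la : probability R R) := measurable_integral_upd k la mphiE phiE0.
have mG2 : measurable_fun setT (fun a => (2 * G k a)%:E).
  by apply/measurable_EFinP; apply: measurable_funM.
have G20 a : (0 <= (2 * G k a)%:E)%E by rewrite lee_fin mulr_ge0.
have iG : (\int[pi]_a (2 * G k a)%:E <= (2 * err k)%:E)%E.
  under eq_integral do rewrite EFinM.
  rewrite ge0_integralZl//; last 2 first.
  - exact/measurable_EFinP.
  - by move=> a _; rewrite lee_fin.
  by rewrite EFinM; apply: lee_wpmul2l => //; exact: Gerr hpi.
have pick (l1 l2 : probability R R) :
   (forall a, \int[l1]_x (phi (upd k a x))%:E <=
      \int[l2]_x (phi (upd k a x))%:E + (2 * G k a)%:E)%E ->
   (\int[pi]_a \int[l1]_x (phi (upd k a x))%:E <=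
    \int[pi]_a \int[l2]_x (phi (upd k a x))%:E + (2 * err k)%:E)%E.
  move=> h; apply: (@le_trans _ _ (\int[pi]_a (\int[l2]_x (phi (upd k a x))%:E +
     (2 * G k a)%:E))%E).
    by apply: ge0_le_integral => //; apply: emeasurable_funD.
  by rewrite ge0_integralD//; apply: leeD.
by split; apply: pick => a; have [] := inner_close k a.
Qed.

(** The intermediate laws are built along with the telescoping sum, one resampling at a time; the
    last of them has the marginals [nu] and is therefore [pi']. *)
Lemma lindeberg_swap (pi pi' : probability (coords R I) R) :
  product_law pi mu -> product_law pi' nu ->
  (`| \int[pi]_a (phi a)%:E - \int[pi']_a (phi a)%:E | <=
    (2 * \sum_k err k)%:E)%E.
Proof.
move=> hpi hpi'.
have chain (J : seq I) : uniq J -> exists piJ : probability (coords R I) R,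
    [/\ product_law piJ (hybrid_law J),
     (\int[pi]_a (phi a)%:E <= \int[piJ]_a (phi a)%:E + (2 * \sum_(k <- J) err k)%:E)%E &
     (\int[piJ]_a (phi a)%:E <= \int[pi]_a (phi a)%:E + (2 * \sum_(k <- J) err k)%:E)%E].
  elim: J => [_|k J IH /= /andP[kJ uJ]].
    exists pi; rewrite !big_nil mulr0 adde0; split => //.
  have [piJ [hJ h1 h2]] := IH uJ.
  have [piK [hK hKi]] := resample_law k (nu k) hJ.
  have [g1 g2] := step kJ hJ hKi.
  exists piK; split.
  - move=> B mB; rewrite hK//; apply: eq_bigr => i _; rewrite /hybrid_law inE.
    by case: eqVneq => // ->.
  - apply: le_trans h1 _; rewrite big_cons mulrDr [in leRHS]EFinD addeA.
    by rewrite [leRHS](_ : _ = (\int[piK]_a (phi a)%:E + (2 * err k)%:E +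
      (2 * \sum_(k <- J) err k)%:E)%E)// leeD2r.
  - apply: le_trans g2 _; rewrite big_cons mulrDr [in leRHS]EFinD.
    by rewrite [leRHS]addeCA addeC leeD2l.
have [piJ [hJ h1 h2]] := chain (enum I) (enum_uniq _).
have E : (\int[piJ]_a (phi a)%:E = \int[pi']_a (phi a)%:E)%E.
  apply: eq_measure_integral => A mA _; apply: (product_law_unique hJ) => // B mB.
  by rewrite hpi'//; apply: eq_bigr => i _; rewrite /hybrid_law mem_enum.
move: h1 h2; rewrite E big_enum/=.
have fin (p : probability (coords R I) R) : (\int[p]_a (phi a)%:E)%E \is a fin_num.
  rewrite ge0_fin_numE; last by apply: integral_ge0 => a _; rewrite lee_fin.
  apply: (@le_lt_trans _ _ (\int[p]_a K%:E)%E); last by rewrite integral_prob_cst ltry.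
  by apply: le_lower_integral => a; rewrite lee_fin.
rewrite -(fineK (fin pi)) -(fineK (fin pi')) -EFinB -!EFinD !lee_fin => h1 h2.
by rewrite ler_norml; apply/andP; split; lra.
Qed.

End lindeberg.

(** * Derivatives on the real line and Taylor's bound *)

Section real_derivatives.
Context {R : realType}.
Implicit Types (f g h : R -> R) (x y : R).

Lemma is_derive_mul f g x df dg :
  is_derive x 1 f df -> is_derive x 1 g dg ->
  is_derive x 1 (fun y => f y * g y) (df * g x + f x * dg).
Proof.
move=> hf hg; apply: is_derive_eq (is_deriveM hf hg) _.
by rewrite /GRing.scale/= addrC; congr (_ + _); rewrite mulrC.
Qed.

Lemma is_derive_add f g x df dg :
  is_derive x 1 f df -> is_derive x 1 g dg ->
  is_derive x 1 (fun y => f y + g y) (df + dg).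
Proof. by move=> hf hg; exact: is_deriveD. Qed.

Lemma is_derive_cmul (c : R) f x df :
  is_derive x 1 f df -> is_derive x 1 (fun y => c * f y) (c * df).
Proof.
move=> hf; have := is_derive_mul (is_derive_cst c x 1) hf.
by rewrite mul0r add0r.
Qed.

Lemma is_derive_sub f g x df dg :
  is_derive x 1 f df -> is_derive x 1 g dg ->
  is_derive x 1 (fun y => f y - g y) (df - dg).
Proof. by move=> hf hg; exact: is_deriveB. Qed.

Lemma is_derive_comp f g x df dg :
  is_derive (g x) 1 f df -> is_derive x 1 g dg ->
  is_derive x 1 (fun y => f (g y)) (df * dg).
Proof. by move=> hf hg; exact: is_derive1_comp. Qed.

Lemma is_derive_big (T : Type) (s : seq T) (h : T -> R -> R) x (dh : T -> R) :
  (forall c, is_derive x 1 (h c) (dh c)) ->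
  is_derive x 1 (fun y => \sum_(c <- s) h c y) (\sum_(c <- s) dh c).
Proof.
move=> H; elim: s => [|c s IH].
  rewrite big_nil; under eq_fun do rewrite big_nil; exact: is_derive_cst.
rewrite big_cons; under eq_fun do rewrite big_cons; exact: is_derive_add.
Qed.

Lemma is_derive_continuous h (dh : R -> R) :
  (forall x, is_derive x 1 h (dh x)) -> continuous h.
Proof.
by move=> H x; apply/differentiable_continuous/derivable1_diffP; have [] := H x.
Qed.

Lemma mvt_bound h (dh : R -> R) (X C : R) :
  (forall x, is_derive x 1 h (dh x)) -> h 0 = 0 ->
  (forall y, `|y| <= X -> `|dh y| <= C) ->
  forall y, `|y| <= X -> `|h y| <= C * X.
Proof.
move=> H h0 B y yX.
have C0 : 0 <= C.
  by apply: le_trans (B y yX).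
have hc (a b : R) : {within `[a, b], continuous h}.
  by apply: continuous_subspaceT; exact: is_derive_continuous H.
have key c : `|c| <= `|y| -> `|dh c * y| <= C * X.
  by move=> cy; rewrite normrM ler_pM// B// (le_trans cy).
have [y0|y0] := leP 0 y.
  have [c /[!in_itv]/= /andP[c0 cy]] := MVT_segment y0 (fun x _ => H x) (hc 0 y).
  rewrite h0 !subr0 => ->; apply: key.
  by rewrite !ger0_norm.
have [c /[!in_itv]/= /andP[c0 cy]] := MVT_segment (ltW y0) (fun x _ => H x) (hc y 0).
rewrite h0 !sub0r => hE; rewrite -normrN hE mulrN normrN; apply: key.
by rewrite !ler0_norm ?lerN2// ltW.
Qed.

(** [mvt_bound] is applied three times, to the remainders of [f2], [f1] and [f] in turn. This gives
    the constant 1 in place of 1/6, which only affects numerical constants. *)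
Lemma taylor2_bound f f1 f2 f3 (x B : R) :
  (forall y, is_derive y 1 f (f1 y)) -> (forall y, is_derive y 1 f1 (f2 y)) ->
  (forall y, is_derive y 1 f2 (f3 y)) ->
  (forall y, `|y| <= `|x| -> `|f3 y| <= B) ->
  `|f x - (f 0 + f1 0 * x + f2 0 / 2 * x ^+ 2)| <= B * `|x| ^+ 3.
Proof.
move=> d0 d1 d2 H.
have idd y : is_derive y 1 (fun z : R => z) 1 by exact: is_derive_id.
have b2 := @mvt_bound (fun y => f2 y - f2 0) f3 `|x| B.
have {}b2 : forall y, `|y| <= `|x| -> `|f2 y - f2 0| <= B * `|x|.
  apply: b2 => //; last by rewrite subrr.
  move=> y; apply: is_derive_eq (is_derive_sub (d2 y) (is_derive_cst _ _ _)) _.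
  by rewrite subr0.
have b1 : forall y, `|y| <= `|x| -> `|f1 y - f1 0 - f2 0 * y| <= B * `|x| * `|x|.
  apply: (@mvt_bound _ (fun y => f2 y - f2 0)) => //; last by rewrite subrr mulr0 subr0.
  move=> y; apply: is_derive_eq (is_derive_sub (is_derive_sub (d1 y)
    (is_derive_cst _ _ _)) (is_derive_cmul _ (idd y))) _.
  by rewrite subr0 mulr1.
have b0 := @mvt_bound (fun y => f y - f 0 - f1 0 * y - f2 0 / 2 * (y * y))
   (fun y => f1 y - f1 0 - f2 0 * y) `|x| (B * `|x| * `|x|).
have {}b0 : `|f x - f 0 - f1 0 * x - f2 0 / 2 * (x * x)| <= B * `|x| * `|x| * `|x|.
  apply: b0 => //; last by rewrite subrr !mulr0 !subr0.
  move=> y; apply: is_derive_eq (is_derive_sub (is_derive_sub (is_derive_sub (d0 y)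
    (is_derive_cst _ _ _)) (is_derive_cmul _ (idd y)))
    (is_derive_cmul _ (is_derive_mul (idd y) (idd y)))) _.
  by lra.
rewrite [X in `|X|](_ : _ = f x - f 0 - f1 0 * x - f2 0 / 2 * (x * x)); last by lra.
by apply: le_trans b0 _; rewrite !exprS expr0 mulr1 !mulrA.
Qed.

End real_derivatives.

(** * Gibbs averages and derivatives of the soft-minimum *)

Section averages.
Context {R : realType} {N : finType}.
Implicit Types (p r f g h k : N -> R).

Definition avg p h : R := \sum_c p c * h c.

Lemma ler_avg p h k : (forall c, 0 <= p c) -> (forall c, h c <= k c) ->
  avg p h <= avg p k.
Proof. by move=> p0 hk; apply: ler_sum => c _; rewrite ler_wpM2l. Qed.

Lemma avg_norm_le p h k : (forall c, 0 <= p c) -> (forall c, `|h c| <= k c) ->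
  `|avg p h| <= avg p k.
Proof.
move=> p0 hk; apply: le_trans (ler_norm_sum _ _ _) _; apply: ler_sum => c _.
by rewrite normrM ger0_norm// ler_wpM2l.
Qed.

Lemma avgZ p h (t : R) : avg p (fun c => t * h c) = t * avg p h.
Proof. by rewrite /avg mulr_sumr; apply: eq_bigr => c _; rewrite mulrCA. Qed.

Lemma avg_ge0 p h : (forall c, 0 <= p c) -> (forall c, 0 <= h c) -> 0 <= avg p h.
Proof. by move=> p0 h0; apply: sumr_ge0 => c _; rewrite mulr_ge0. Qed.

(** Twice the difference of the two sides is the double sum of
    [r c * r d * ((f c - f d) * (g c - g d))], whose terms are all non-negative. *)
Lemma chebyshev_sum r f g : (forall c, 0 <= r c) ->
  (forall c d, 0 <= (f c - f d) * (g c - g d)) ->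
  avg r f * avg r g <= (\sum_c r c) * avg r (fun c => f c * g c).
Proof.
move=> r0 fg; rewrite -subr_ge0 -(pmulr_rge0 _ (ltr0Sn R 1)).
have dist (a b : N -> R) : (\sum_c a c) * (\sum_c b c) = \sum_c \sum_d a c * b d.
  exact: big_distrlr.
rewrite [leRHS](_ : _ = \sum_c \sum_d r c * r d * ((f c - f d) * (g c - g d))).
  by apply: sumr_ge0 => c _; apply: sumr_ge0 => d _; rewrite mulr_ge0// mulr_ge0.
pose A := \sum_c \sum_d (r c * (f c * g c)) * r d.
pose A' := \sum_c \sum_d r c * (r d * (f d * g d)).
pose B := \sum_c \sum_d (r c * f c) * (r d * g d).
pose B' := \sum_c \sum_d (r c * g c) * (r d * f d).
transitivity (A + A' - B - B').
  rewrite /A /A' /B /B' -!dist /avg; set x := \sum_c r c; set y := \sum_c r c * f c.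
  set z := \sum_c r c * g c; set t := \sum_c r c * (f c * g c).
  by rewrite mulr_natl; ring.
rewrite /A /A' /B /B' -!(big_split, sumrB) /=; apply: eq_bigr => c _.
rewrite -!(big_split, sumrB) /=; apply: eq_bigr => d _.
ring.
Qed.

Lemma chebyshev_avg p f g : (forall c, 0 <= p c) -> \sum_c p c = 1 ->
  (forall c d, 0 <= (f c - f d) * (g c - g d)) ->
  avg p f * avg p g <= avg p (fun c => f c * g c).
Proof. by move=> p0 p1 /(chebyshev_sum p0); rewrite p1 mul1r. Qed.

End averages.

Section gibbs.
Context {R : realType} {N : finType}.
Variables (c0 : N) (beta : R).
Hypothesis beta_gt0 : 0 < beta.

Definition partition_fun (E : N -> R) : R := \sum_c expR (- beta * E c).
Definition gibbs (E : N -> R) (c : N) : R := expR (- beta * E c) / partition_fun E.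
Definition softmin (E : N -> R) : R := - beta^-1 * ln (partition_fun E).

Lemma partition_fun_gt0 E : 0 < partition_fun E.
Proof.
rewrite /partition_fun (bigD1 c0)//= ltr_wpDr ?expR_gt0// sumr_ge0// => c _.
Qed.

Lemma gibbs_ge0 E c : 0 <= gibbs E c.
Proof. by rewrite divr_ge0 ?expR_ge0// ltW// partition_fun_gt0. Qed.

Lemma gibbs_sum E : \sum_c gibbs E c = 1.
Proof. by rewrite /gibbs -mulr_suml divff// gt_eqF// partition_fun_gt0. Qed.

Let softminE E : softmin E = - ln (partition_fun E) / beta.
Proof. by rewrite /softmin !mulNr mulrC. Qed.

Lemma softmin_le E c : softmin E <= E c.
Proof.
have h : - beta * E c <= ln (partition_fun E).
  rewrite -[leLHS]expRK ler_ln ?posrE ?expR_gt0 ?partition_fun_gt0//.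
  by rewrite /partition_fun (bigD1 c)//= lerDl sumr_ge0// => d _; exact: expR_ge0.
by rewrite softminE ler_pdivrMr//; lra.
Qed.

(** Every term of the partition function is at most [expR (- beta * x)]; counting the terms costs
    the entropy. *)
Lemma softmin_ge E (x : R) : (forall c, x <= E c) ->
  x - ln (#|N|%:R) / beta <= softmin E.
Proof.
move=> xE; have N0 : 0 < #|N|%:R :> R by rewrite ltr0n; apply/card_gt0P; exists c0.
have Z0 := partition_fun_gt0 E.
have h : partition_fun E <= #|N|%:R * expR (- beta * x).
  rewrite (_ : _ * _ = \sum_(c : N) expR (- beta * x)); last first.
    by rewrite sumr_const mulr_natl.
  apply: ler_sum => c _.
  by rewrite ler_expR !mulNr lerN2 ler_wpM2l// ltW.
have : ln (partition_fun E) <= ln #|N|%:R - beta * x.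
  rewrite -[X in _ - X]opprK -mulNr -[X in _ - - X]expRK opprK -lnM ?posrE ?expR_gt0//.
  by rewrite ler_ln ?posrE// mulr_gt0 ?expR_gt0.
move=> hl; rewrite softminE ler_pdivlMr//.
by rewrite mulrBl divfK ?gt_eqF//; lra.
Qed.

Variables H H1 H2 H3 : N -> R -> R.
Hypothesis dH : forall (c : N) (a : R), is_derive a (1 : R) (H c) (H1 c a).
Hypothesis dH1 : forall (c : N) (a : R), is_derive a (1 : R) (H1 c) (H2 c a).
Hypothesis dH2 : forall (c : N) (a : R), is_derive a (1 : R) (H2 c) (H3 c a).

Let E a c := H c a.
Let p a := gibbs (E a).
Let Z a := partition_fun (E a).

Let dZ (a : R) : is_derive a 1 Z (- beta * (Z a * avg (p a) (H1^~ a))).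
Proof.
rewrite /avg mulr_sumr mulr_sumr; apply: is_derive_big => c.
apply: is_derive_eq (is_derive_comp (is_derive_expR _) (is_derive_cmul _ (dH c a))) _.
rewrite /p /gibbs -/(Z a); have : Z a != 0 by rewrite gt_eqF// partition_fun_gt0.
by move=> Z0; field.
Qed.

Let dp (a : R) c : is_derive a 1 (fun a => p a c)
  (- beta * (p a c * (H1 c a - avg (p a) (H1^~ a)))).
Proof.
have Z0 : Z a != 0 by rewrite gt_eqF// partition_fun_gt0.
have := is_derive_mul
  (is_derive_comp (is_derive_expR _) (is_derive_cmul (- beta) (dH c a)))
  (is_deriveV Z0 (dZ a)).
move/is_derive_eq; apply; rewrite /p /gibbs -/(Z a) /GRing.scale/=.
by rewrite /E; field.
Qed.

(** Differentiating the Gibbs weights contributes [- beta] times the covariance of [h] and [H1]. *)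
Lemma is_derive_avg (h h' : N -> R -> R) (a : R) :
  (forall c, is_derive a 1 (h c) (h' c a)) ->
  is_derive a 1 (fun a => avg (p a) (h^~ a))
   (avg (p a) (h'^~ a) -
    beta * (avg (p a) (fun c => h c a * H1 c a) - avg (p a) (h^~ a) * avg (p a) (H1^~ a))).
Proof.
move=> dh; set m := avg (p a) (H1^~ a).
have := is_derive_big (index_enum N) (fun c => is_derive_mul (dp a c) (dh c)).
move/is_derive_eq; apply; rewrite -/m /avg big_split/= addrC; congr (_ + _).
rewrite -mulNr [X in _ * (_ - X)]mulr_suml -sumrB mulr_sumr.
by apply: eq_bigr => c _; ring.
Qed.

(** The derivatives of a free energy: a mean, a mean minus [beta] times a variance, and so on. They
    are left in the unexpanded form in which [is_derive_avg] produces them. *)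
Definition softmin1 a := avg (p a) (H1^~ a).
Definition softmin2 a := avg (p a) (H2^~ a) -
  beta * (avg (p a) (fun c => H1 c a * H1 c a) - softmin1 a * softmin1 a).
Definition softmin3 a :=
  avg (p a) (H3^~ a) -
  beta * (avg (p a) (fun c => H2 c a * H1 c a) - avg (p a) (H2^~ a) * softmin1 a) -
  beta * (avg (p a) (fun c => H2 c a * H1 c a + H1 c a * H2 c a) -
    beta * (avg (p a) (fun c => H1 c a * H1 c a * H1 c a) -
            avg (p a) (fun c => H1 c a * H1 c a) * softmin1 a) -
    (softmin2 a * softmin1 a + softmin1 a * softmin2 a)).

Lemma is_derive_softmin (a : R) :
  is_derive a 1 (fun a => softmin (H^~ a)) (softmin1 a).
Proof.
have Z0 : 0 < Z a by exact: partition_fun_gt0.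
have := is_derive_cmul (- beta^-1) (is_derive_comp (is_derive1_ln Z0) (dZ a)).
move/is_derive_eq; apply; rewrite -/(softmin1 a).
have : Z a != 0 by rewrite gt_eqF.
have : beta != 0 by rewrite gt_eqF.
by move=> ? ?; field; apply/andP.
Qed.

Lemma is_derive_softmin1 (a : R) : is_derive a 1 softmin1 (softmin2 a).
Proof. exact: is_derive_avg. Qed.

Lemma is_derive_softmin2 (a : R) : is_derive a 1 softmin2 (softmin3 a).
Proof.
apply: is_derive_sub; first exact: is_derive_avg.
apply: is_derive_cmul; apply: is_derive_sub.
  apply: (@is_derive_avg (fun c a => H1 c a * H1 c a)
    (fun c a => H2 c a * H1 c a + H1 c a * H2 c a)) => c.
  exact: is_derive_mul.
by apply: is_derive_mul; exact: is_derive_softmin1.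
Qed.

End gibbs.

Section third_derivative.
Context {R : realType} {N : finType}.
Variables (c0 : N) (beta : R).
Hypothesis beta_gt0 : 0 < beta.
Variables H H1 H2 H3 : N -> R -> R.
Hypothesis dH : forall (c : N) (a : R), is_derive a (1 : R) (H c) (H1 c a).
Hypothesis dH1 : forall (c : N) (a : R), is_derive a (1 : R) (H1 c) (H2 c a).
Hypothesis dH2 : forall (c : N) (a : R), is_derive a (1 : R) (H2 c) (H3 c a).
Variables g g1 g2 g3 : R -> R.
Hypothesis dg : forall a : R, is_derive a (1 : R) g (g1 a).
Hypothesis dg1 : forall a : R, is_derive a (1 : R) g1 (g2 a).
Hypothesis dg2 : forall a : R, is_derive a (1 : R) g2 (g3 a).

Let F a := softmin beta (H^~ a).
Let F1 := softmin1 beta H H1.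
Let F2 := softmin2 beta H H1 H2.
Let F3 := softmin3 beta H H1 H2 H3.

Definition smooth1 a := g1 (F a) * F1 a.
Definition smooth2 a := g2 (F a) * F1 a * F1 a + g1 (F a) * F2 a.
Definition smooth3 a :=
  (g3 (F a) * F1 a * F1 a + g2 (F a) * F2 a) * F1 a + g2 (F a) * F1 a * F2 a +
  (g2 (F a) * F1 a * F2 a + g1 (F a) * F3 a).

Lemma is_derive_smooth (a : R) :
  is_derive a (1 : R) (fun a => g (F a)) (smooth1 a).
Proof. exact: is_derive_comp (dg _) (is_derive_softmin c0 beta_gt0 dH a). Qed.

Let dgF (h h' : R -> R) (a : R) : (forall b : R, is_derive b (1 : R) h (h' b)) ->
  is_derive a (1 : R) (fun a => h (F a)) (h' (F a) * F1 a).
Proof. by move=> dh; exact: is_derive_comp (dh _) (is_derive_softmin c0 beta_gt0 dH a). Qed.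

Let dF1 (a : R) : is_derive a (1 : R) F1 (F2 a).
Proof. exact: (@is_derive_softmin1 R N c0 beta H H1 H2 dH dH1 a). Qed.

Let dF2 (a : R) : is_derive a (1 : R) F2 (F3 a).
Proof. exact: (@is_derive_softmin2 R N c0 beta H H1 H2 H3 dH dH1 dH2 a). Qed.

Lemma is_derive_smooth1 (a : R) : is_derive a (1 : R) smooth1 (smooth2 a).
Proof. exact: is_derive_mul (dgF a dg1) (dF1 a). Qed.

Lemma is_derive_smooth2 (a : R) : is_derive a (1 : R) smooth2 (smooth3 a).
Proof.
apply: is_derive_add; last exact: is_derive_mul (dgF a dg1) (dF2 a).
exact: is_derive_mul (is_derive_mul (dgF a dg2) (dF1 a)) (dF1 a).
Qed.

Section bound.
(** In the application [k] is of order 1/m, [l] bounds the coefficient of the entry, and [u], [v],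
    [w] are powers of one function 1 + psi. Being similarly ordered, [u] and [v] fall under
    Chebyshev's inequality. *)
Variables (a K k l : R) (u v w : N -> R).
Hypotheses (k0 : 0 <= k) (l0 : 0 <= l).
Hypothesis u0 : forall c, 0 <= u c.
Hypothesis H1u : forall c, `|H1 c a| <= k * l * u c.
Hypothesis H2v : forall c, `|H2 c a| <= k * l ^+ 2 * v c.
Hypothesis H3w : forall c, `|H3 c a| <= k * l ^+ 3 * w c.
Hypothesis uv : forall c d, 0 <= (u c - u d) * (v c - v d).
Hypothesis gK1 : forall x, `|g1 x| <= K.
Hypothesis gK2 : forall x, `|g2 x| <= K.
Hypothesis gK3 : forall x, `|g3 x| <= K.

Let p := gibbs beta (H^~ a).
Let p0 c : 0 <= p c. Proof. exact: gibbs_ge0. Qed.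
Let p1 : \sum_c p c = 1. Proof. exact: gibbs_sum. Qed.
Let U := avg p u.
Let U2 := avg p (fun c => u c * u c).
Let U3 := avg p (fun c => u c * u c * u c).
Let V := avg p v.
Let UV := avg p (fun c => u c * v c).
Let W := avg p w.

Let U_ge0 : 0 <= U. Proof. exact: avg_ge0. Qed.
Let UU : U * U <= U2.
Proof. by apply: chebyshev_avg => // c d; rewrite -expr2 sqr_ge0. Qed.
Let U2U : U2 * U <= U3.
Proof.
apply: (chebyshev_avg (f := fun c => u c * u c)) => // c d.
rewrite (_ : _ * _ = (u c + u d) * (u c - u d) ^+ 2); last by ring.
by rewrite mulr_ge0 ?addr_ge0 ?sqr_ge0.
Qed.
Let U_V : U * V <= UV.
Proof. exact: chebyshev_avg. Qed.

Let normM_le (x y X Y : R) : `|x| <= X -> `|y| <= Y -> `|x * y| <= X * Y.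
Proof. by move=> hx hy; rewrite normrM ler_pM. Qed.

Let avg_le (h h' : N -> R) (t : R) :
  (forall c, `|h c| <= t * h' c) -> `|avg p h| <= t * avg p h'.
Proof. by move=> hh; rewrite -avgZ; exact: avg_norm_le. Qed.

Let hh11 c : `|H1 c a * H1 c a| <= (k * l) ^+ 2 * (u c * u c).
Proof.
by apply: le_trans (normM_le (H1u c) (H1u c)) _; rewrite expr2 mulrACA.
Qed.
Let hh12 c : `|H2 c a * H1 c a| <= k ^+ 2 * l ^+ 3 * (u c * v c).
Proof.
apply: le_trans (normM_le (H2v c) (H1u c)) _.
by rewrite le_eqVlt; apply/orP; left; apply/eqP; ring.
Qed.
Let hh111 c : `|H1 c a * H1 c a * H1 c a| <= (k * l) ^+ 3 * (u c * u c * u c).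
Proof.
apply: le_trans (normM_le (hh11 c) (H1u c)) _.
by rewrite le_eqVlt; apply/orP; left; apply/eqP; ring.
Qed.

Let F1_le : `|F1 a| <= k * l * U.
Proof. exact: avg_le. Qed.

Let avg11 : `|avg p (fun c => H1 c a * H1 c a)| <= (k * l) ^+ 2 * U2.
Proof. exact: avg_le. Qed.

Let F2_le : `|F2 a| <= k * l ^+ 2 * V + 2 * beta * (k * l) ^+ 2 * U2.
Proof.
apply: le_trans (ler_normB _ _) _; apply: lerD; first exact: avg_le.
rewrite normrM gtr0_norm//.
have f11 : `|F1 a * F1 a| <= (k * l) ^+ 2 * U2.
  apply: le_trans (normM_le F1_le F1_le) _.
  by have := ler_wpM2l (sqr_ge0 (k * l)) UU; lra.
have h := le_trans (ler_normB _ _) (lerD avg11 f11).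
by have := ler_wpM2l (ltW beta_gt0) h; lra.
Qed.

Let kl3 : 0 <= (k * l) ^+ 3. Proof. by rewrite exprn_ge0// mulr_ge0. Qed.
Let kkl3 : 0 <= k ^+ 2 * l ^+ 3. Proof. by rewrite mulr_ge0 ?exprn_ge0. Qed.

Let F21_le : `|F2 a * F1 a| <= k ^+ 2 * l ^+ 3 * UV + 2 * beta * (k * l) ^+ 3 * U3.
Proof.
apply: le_trans (normM_le F2_le F1_le) _.
have h1 := ler_wpM2l kkl3 U_V.
have h2 := ler_wpM2l (mulr_ge0 (ltW beta_gt0) kl3) U2U.
by lra.
Qed.

Let F3_le : `|F3 a| <= k * l ^+ 3 * W + 6 * beta * (k ^+ 2 * l ^+ 3) * UV +
  6 * beta ^+ 2 * (k * l) ^+ 3 * U3.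
Proof.
have b0 := ltW beta_gt0.
have a3 : `|avg p (H3^~ a)| <= k * l ^+ 3 * W by exact: avg_le.
have a21 : `|avg p (fun c => H2 c a * H1 c a)| <= k ^+ 2 * l ^+ 3 * UV by exact: avg_le.
have a2 : `|avg p (H2^~ a) * F1 a| <= k ^+ 2 * l ^+ 3 * UV.
  have h : `|avg p (H2^~ a)| <= k * l ^+ 2 * V by exact: avg_le.
  apply: le_trans (normM_le h F1_le) _.
  by have := ler_wpM2l kkl3 U_V; lra.
have a12 : `|avg p (fun c => H2 c a * H1 c a + H1 c a * H2 c a)| <=
    (2 * (k ^+ 2 * l ^+ 3)) * UV.
  apply: avg_le => c; have := hh12 c; rewrite [H1 c a * _]mulrC -mulr2n normrMn.
  by rewrite -mulr_natl; lra.
have a111 : `|avg p (fun c => H1 c a * H1 c a * H1 c a)| <= (k * l) ^+ 3 * U3.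
  exact: avg_le.
have a11 : `|avg p (fun c => H1 c a * H1 c a) * F1 a| <= (k * l) ^+ 3 * U3.
  apply: le_trans (normM_le avg11 F1_le) _.
  by have := ler_wpM2l kl3 U2U; lra.
have a21' := F21_le.
have bm (t T : R) : `|t| <= T -> `|beta * t| <= beta * T.
  by move=> tT; rewrite normrM gtr0_norm// ler_wpM2l.
have s1 : `|avg p (fun c => H2 c a * H1 c a) - avg p (H2^~ a) * F1 a| <=
    2 * (k ^+ 2 * l ^+ 3) * UV.
  by apply: le_trans (ler_normB _ _) _; lra.
have s2 : `|avg p (fun c => H1 c a * H1 c a * H1 c a) -
    avg p (fun c => H1 c a * H1 c a) * F1 a| <= 2 * (k * l) ^+ 3 * U3.
  by apply: le_trans (ler_normB _ _) _; lra.
have s3 : `|F2 a * F1 a + F1 a * F2 a| <=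
    2 * (k ^+ 2 * l ^+ 3 * UV + 2 * beta * (k * l) ^+ 3 * U3).
  by rewrite [F1 a * _]mulrC; apply: le_trans (ler_normD _ _) _; lra.
apply: le_trans (ler_normB _ _) _.
apply: le_trans (lerD (ler_normB _ _) (lexx _)) _.
apply: le_trans (lerD (lerD a3 (bm _ _ s1)) (bm _ _
  (le_trans (ler_normB _ _) (lerD (le_trans (ler_normB _ _) (lerD a12 (bm _ _ s2))) s3)))) _.
lra.
Qed.

(** Chebyshev's inequality merges every product of averages into the average of a product, so that
    only the averages of [u ^+ 3], [u * v] and [w] survive. Each factor [beta] comes with an
    additional factor [k], and [beta * k] does not grow with m. *)
Lemma smooth3_le : `|smooth3 a| <= K * l ^+ 3 *
  (k ^+ 3 * U3 + 3 * (k ^+ 2 * UV + 2 * beta * k ^+ 3 * U3) +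
   (k * W + 6 * beta * k ^+ 2 * UV + 6 * beta ^+ 2 * k ^+ 3 * U3)).
Proof.
have K0 : 0 <= K := le_trans (normr_ge0 _) (gK1 0).
have f111 : `|F1 a * F1 a * F1 a| <= (k * l) ^+ 3 * U3.
  apply: le_trans (normM_le (normM_le F1_le F1_le) F1_le) _.
  have h1 := ler_wpM2l kl3 U2U.
  have h2 := ler_wpM2l (mulr_ge0 kl3 U_ge0) UU; lra.
rewrite (_ : smooth3 a = g3 (F a) * (F1 a * F1 a * F1 a) +
  3 * (g2 (F a) * (F2 a * F1 a)) + g1 (F a) * F3 a); last by rewrite /smooth3; ring.
apply: le_trans (ler_normD _ _) _.
apply: le_trans (lerD (ler_normD _ _) (lexx _)) _.
have -> : `|3 * (g2 (F a) * (F2 a * F1 a))| = 3 * `|g2 (F a) * (F2 a * F1 a)|.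
  by rewrite normrM ger0_norm.
have e1 := normM_le (gK3 (F a)) f111.
have e2 := normM_le (gK2 (F a)) F21_le.
have e3 := normM_le (gK1 (F a)) F3_le.
rewrite exprMn in e1 e2 e3.
by lra.
Qed.

End bound.
End third_derivative.

Section power_facts.
Context {R : realType}.
Implicit Types x y a b p q : R.

Lemma powR_le x y p : 0 <= p -> 0 <= x -> x <= y -> x `^ p <= y `^ p.
Proof.
move=> p0 x0 xy; apply: ge0_ler_powR => //; rewrite nnegrE//.
exact: le_trans xy.
Qed.

Lemma powR_ge1 x p : 1 <= x -> 0 <= p -> 1 <= x `^ p.
Proof. by move=> x1 p0; rewrite -[leLHS](powRr0 x) ler_powR. Qed.

Lemma powR_le1 x p : 0 <= x <= 1 -> 0 <= p -> x `^ p <= 1.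
Proof.
by move=> /andP[x0 x1] p0; rewrite (le_trans (powR_le p0 x0 x1))// powR1.
Qed.

Lemma powR_le_1D x p q : 0 <= p -> p <= q -> 0 <= x -> x `^ p <= 1 + x `^ q.
Proof.
move=> p0 pq x0; have [x1|x1] := leP x 1.
  by rewrite (le_trans (powR_le1 _ p0)) ?x0// lerDl powR_ge0.
by rewrite (le_trans (ler_powR (ltW x1) pq))// lerDr.
Qed.

Lemma powR_norm_even x p r : 0 <= p -> p <= r.*2%:R -> `|x| `^ p <= 1 + x ^+ r.*2.
Proof.
move=> p0 pr; apply: le_trans (powR_le_1D p0 pr (normr_ge0 _)) _.
by rewrite powR_mulrn// -mul2n !exprM real_normK ?num_real.
Qed.

(** The sum is at most three times its largest term. *)
Lemma powR_sum3 a b p : 0 <= a -> 0 <= b -> 0 <= p ->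
  (1 + a + b) `^ p <= 3 `^ p * (1 + a `^ p + b `^ p).
Proof.
move=> a0 b0 p0.
have key x : 0 <= x -> 1 + a + b <= 3 * x ->
    (1 + a + b) `^ p <= 3 `^ p * x `^ p.
  move=> x0 h; rewrite -powRM//; apply: powR_le => //.
  by rewrite addr_ge0// addr_ge0.
have ap := powR_ge0 a p; have bp := powR_ge0 b p.
have t0 : 0 <= 3 `^ p :> R := powR_ge0 _ _.
have [ab|ba] := leP a b.
  have [b1|b1] := leP b 1.
    apply: le_trans (key 1 _ _) _ => //; first by lra.
    by rewrite powR1 /= ler_wpM2l//; lra.
  by apply: le_trans (key b _ _) _ => //; [lra|rewrite ler_wpM2l//; lra].
have [a1|a1] := leP a 1.
  apply: le_trans (key 1 _ _) _ => //; first by lra.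
  by rewrite powR1 /= ler_wpM2l//; lra.
by apply: le_trans (key a _ _) _ => //; [lra|rewrite ler_wpM2l//; lra].
Qed.

(** Turns the growth condition into a bound of 1 + psi by a single product, which can be raised to a
    real power factor by factor. *)
Lemma powR_growth (y Li q0 : R) : 1 <= Li -> 0 <= q0 -> 0 <= y ->
  2 + Li * (1 + y `^ q0) <= 4 * Li * (1 + y) `^ q0.
Proof.
move=> L1 q00 y0.
have h1 : 1 <= (1 + y) `^ q0 by apply: powR_ge1 => //; rewrite lerDl.
have h2 : y `^ q0 <= (1 + y) `^ q0 by apply: powR_le => //; rewrite lerDr.
have L0 : 0 <= Li by lra.
have h3 := ler_wpM2l L0 h1; have h4 := ler_wpM2l L0 h2.
lra.
Qed.

End power_facts.

(** * Taylor expansion of the soft-minimum in one entry *)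

Section entry_expansion.
Context {R : realType} {N : finType}.
Variables (c0 : N) (mm b D Li L K q0 q1 q2 q3 l : R) (r : nat).
(** At the net point [c], the affected row takes the value [s c + theta c * x] when its entry is
    [x]; [rest c] collects the energy of all other rows and of f. *)
Variables (psi psi1 psi2 psi3 g g1 g2 g3 : R -> R) (s theta rest : N -> R).
Hypotheses (mm1 : 1 <= mm) (b1 : 1 <= b) (D1 : 1 <= D) (Li1 : 1 <= Li) (L1 : 1 <= L).
Hypotheses (q00 : 0 <= q0) (q10 : 0 <= q1) (q20 : 0 <= q2) (q30 : 0 <= q3).
Hypotheses (l0 : 0 <= l) (lL : l <= L).
Hypothesis theta_le : forall c, `|theta c| <= l.
Hypothesis dpsi : forall y : R, is_derive y (1 : R) psi (psi1 y).
Hypothesis dpsi1 : forall y : R, is_derive y (1 : R) psi1 (psi2 y).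
Hypothesis dpsi2 : forall y : R, is_derive y (1 : R) psi2 (psi3 y).
Hypothesis psi_ge0 : forall y, 0 <= psi y.
Hypothesis psi1_le : forall y, `|psi1 y| <= D * (1 + psi y `^ q1).
Hypothesis psi2_le : forall y, `|psi2 y| <= D * (1 + psi y `^ q2).
Hypothesis psi3_le : forall y, `|psi3 y| <= D * (1 + psi y `^ q3).
Hypothesis psi_growth : forall y, psi y <= 1 + Li * (1 + `|y| `^ q0).
Hypothesis dg : forall a : R, is_derive a (1 : R) g (g1 a).
Hypothesis dg1 : forall a : R, is_derive a (1 : R) g1 (g2 a).
Hypothesis dg2 : forall a : R, is_derive a (1 : R) g2 (g3 a).
Hypothesis gK1 : forall x, `|g1 x| <= K.
Hypothesis gK2 : forall x, `|g2 x| <= K.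
Hypothesis gK3 : forall x, `|g3 x| <= K.

Let q := qq q1 q2 q3.
Let p := q0 * q.
Hypothesis pr : p <= r.*2%:R.
Let beta := b * mm.

Let m0 : 0 < mm. Proof. exact: lt_le_trans mm1. Qed.
Let beta_gt0 : 0 < beta. Proof. by rewrite mulr_gt0//; exact: lt_le_trans b1. Qed.
Let q_ge0 : 0 <= q. Proof. by rewrite /q /qq !le_max q30. Qed.
Let q1q : 3 * q1 <= q. Proof. by rewrite /q /qq !le_max lexx !orbT. Qed.
Let q12q : q1 + q2 <= q. Proof. by rewrite /q /qq !le_max lexx !orbT. Qed.
Let q3q : q3 <= q. Proof. by rewrite /q /qq !le_max lexx. Qed.

Let Y c x := s c + theta c * x.
Let H c x := mm^-1 * psi (Y c x) + rest c.
Let H1 c x := mm^-1 * (psi1 (Y c x) * theta c).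
Let H2 c x := mm^-1 * (psi2 (Y c x) * theta c * theta c).
Let H3 c x := mm^-1 * (psi3 (Y c x) * theta c * theta c * theta c).

Let dY c (x : R) : is_derive x (1 : R) (Y c) (theta c).
Proof.
apply: is_derive_eq (is_derive_add (is_derive_cst _ _ _)
  (is_derive_cmul _ (is_derive_id _ _))) _.
by rewrite add0r mulr1.
Qed.

Let dH (c : N) (x : R) : is_derive x (1 : R) (H c) (H1 c x).
Proof.
apply: is_derive_eq (is_derive_add (is_derive_cmul _
  (is_derive_comp (dpsi _) (dY c x))) (is_derive_cst _ _ _)) _.
by rewrite addr0.
Qed.

Let dH1 (c : N) (x : R) : is_derive x (1 : R) (H1 c) (H2 c x).
Proof.
apply: is_derive_eq (is_derive_cmul _ (is_derive_mul
  (is_derive_comp (dpsi1 _) (dY c x)) (is_derive_cst _ _ _))) _.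
by rewrite mulr0 addr0.
Qed.

Let dH2 (c : N) (x : R) : is_derive x (1 : R) (H2 c) (H3 c x).
Proof.
apply: is_derive_eq (is_derive_cmul _ (is_derive_mul (is_derive_mul
  (is_derive_comp (dpsi2 _) (dY c x)) (is_derive_cst _ _ _))
  (is_derive_cst _ _ _))) _.
by rewrite !mulr0 !addr0.
Qed.

Let Gf c x := 1 + psi (Y c x).
Let Gf1 c x : 1 <= Gf c x. Proof. by rewrite lerDl. Qed.
Let Gf0 c x : 0 <= Gf c x. Proof. exact: le_trans (Gf1 c x). Qed.

Let powG_mono c d x (t t' : R) : 0 <= t -> 0 <= t' ->
  0 <= (Gf c x `^ t - Gf d x `^ t) * (Gf c x `^ t' - Gf d x `^ t').
Proof.
move=> t0 t'0; have [h|h] := leP (Gf c x) (Gf d x).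
  by apply: mulr_le0; rewrite subr_le0; exact: powR_le.
by apply: mulr_ge0; rewrite subr_ge0; apply: powR_le => //; exact: ltW.
Qed.

Let D_le c x (t z : R) : 0 <= t -> `|z| <= D * (1 + psi (Y c x) `^ t) ->
  `|z| <= 2 * D * Gf c x `^ t.
Proof.
have hm1 := mm1; have hb1 := b1; have hD1 := D1; have hLi1 := Li1; have hL1 := L1.
move=> t0 h; apply: le_trans h _.
have h1 : 1 <= Gf c x `^ t by exact: powR_ge1.
have h2 : psi (Y c x) `^ t <= Gf c x `^ t by apply: powR_le => //; rewrite lerDr.
have D0 : 0 <= D by lra.
have := ler_wpM2l D0 h1; have := ler_wpM2l D0 h2; lra.
Qed.

Let theta_pow c k : `|theta c| ^+ k <= l ^+ k.
Proof. by rewrite lerXn2r. Qed.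

Let H_bound c x (t : R) k (z : R) : 0 <= t -> `|z| <= D * (1 + psi (Y c x) `^ t) ->
  `|mm^-1 * (z * theta c ^+ k)| <= 2 * D / mm * l ^+ k * Gf c x `^ t.
Proof.
move=> t0 /(D_le t0) h.
rewrite !normrM normfV (gtr0_norm m0) normrX.
have := ler_pM (normr_ge0 z) (exprn_ge0 k (normr_ge0 (theta c))) h (theta_pow c k).
have i0 : 0 <= mm^-1 by rewrite invr_ge0 ltW.
by move/(ler_wpM2l i0); lra.
Qed.

Let avg_third x (Q : R) :
  avg (gibbs beta (H^~ x)) (fun c => Gf c x `^ q) <= Q ->
  `|smooth3 beta H H1 H2 H3 g1 g2 g3 x| <=
    K * l ^+ 3 * (23 * (2 * D) ^+ 3 / mm * b ^+ 2) * Q.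
Proof.
have hm1 := mm1; have hb1 := b1; have hD1 := D1; have hLi1 := Li1; have hL1 := L1.
move=> hQ; have K0 : 0 <= K := le_trans (normr_ge0 _) (gK1 0).
have p0 c : 0 <= gibbs beta (H^~ x) c by exact: gibbs_ge0.
have Gq c t : t <= q -> Gf c x `^ t <= Gf c x `^ q by move=> tq; exact: ler_powR.
have Gn c : Gf c x != 0 by rewrite gt_eqF// (lt_le_trans ltr01).
have Gadd c t t' : Gf c x `^ t * Gf c x `^ t' = Gf c x `^ (t + t').
  by rewrite powRD// Gn implybT.
have Q0 : 0 <= Q by apply: le_trans hQ; apply: avg_ge0 => // c; exact: powR_ge0.
have hh1 c : `|H1 c x| <= 2 * D / mm * l * Gf c x `^ q1.
  by have := @H_bound c x _ 1 _ q10 (psi1_le (Y c x)); rewrite !expr1.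
have hh2 c : `|H2 c x| <= 2 * D / mm * l ^+ 2 * Gf c x `^ q2.
  rewrite (_ : H2 c x = mm^-1 * (psi2 (Y c x) * theta c ^+ 2)); last by rewrite /H2; ring.
  exact: H_bound (psi2_le _).
have hh3 c : `|H3 c x| <= 2 * D / mm * l ^+ 3 * Gf c x `^ q3.
  rewrite (_ : H3 c x = mm^-1 * (psi3 (Y c x) * theta c ^+ 3)); last by rewrite /H3; ring.
  exact: H_bound (psi3_le _).
have k0 : 0 <= 2 * D / mm by rewrite divr_ge0 ?ltW//; lra.
have := @smooth3_le R N c0 beta beta_gt0 H H1 H2 H3 g1 g2 g3 x K (2 * D / mm) l
  (fun c => Gf c x `^ q1) (fun c => Gf c x `^ q2) (fun c => Gf c x `^ q3)
  k0 l0 (fun c => powR_ge0 _ _) hh1 hh2 hh3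
  (fun c d => powG_mono c d x q10 q20) gK1 gK2 gK3.
move/le_trans; apply.
have Kl0 : 0 <= K * l ^+ 3 by rewrite mulr_ge0 ?exprn_ge0.
rewrite -[leRHS]mulrA; apply: ler_wpM2l => //.
set U3 := avg _ (fun c => _ * _ * _); set UV := avg _ (fun c => _ * _).
set W := avg _ _.
have hU : U3 <= Q.
  apply: le_trans hQ; apply: ler_avg => // c; rewrite !Gadd; apply: Gq.
  by apply: le_trans q1q; lra.
have hUV : UV <= Q.
  by apply: le_trans hQ; apply: ler_avg => // c; rewrite Gadd; apply: Gq.
have hW : W <= Q by apply: le_trans hQ; apply: ler_avg => // c; exact: Gq.
set k := 2 * D / mm; set d := 2 * D.
have d1 : 1 <= d by rewrite /d; lra.
have iv0 : 0 < mm^-1 by rewrite invr_gt0.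
have iv1 : mm^-1 <= 1 by rewrite invf_le1.
have kE : k = d * mm^-1 by [].
(* With [k = d / mm] and [beta = b * mm], each of the coefficients k, k^2, k^3, beta k^2, beta k^3
   and beta^2 k^3 is at most [T * b ^+ 2]; for the last one this is an equality. *)
pose T := d ^+ 3 * mm^-1.
have T0 : 0 <= T by rewrite mulr_ge0 ?exprn_ge0// ltW//; lra.
have d12 : d <= d ^+ 3 by rewrite -[leLHS]expr1 ler_weXn2l.
have d23 : d ^+ 2 <= d ^+ 3 by rewrite ler_weXn2l.
have kT : k <= T by rewrite kE /T ler_wpM2r// ltW.
have d20 : 0 <= d ^+ 2 by exact: sqr_ge0.
have d30 : 0 <= d ^+ 3 by lra.
have k2E : k ^+ 2 * mm <= T.
  have -> : k ^+ 2 * mm = d ^+ 2 * mm^-1 by rewrite kE; field; exact: lt0r_neq0.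
  by rewrite /T ler_wpM2r// ltW.
have k3E : k ^+ 3 * mm ^+ 2 = T.
  by rewrite kE /T; field; exact: lt0r_neq0.
have k20 : 0 <= k ^+ 2 by exact: sqr_ge0.
have k30 : 0 <= k ^+ 3 by rewrite exprn_ge0// kE mulr_ge0// ltW//; lra.
have m0' := ltW m0.
have mm2 : mm <= mm ^+ 2 by rewrite expr2 ler_peMl.
have k2T : k ^+ 2 <= T by apply: le_trans k2E; rewrite ler_peMr.
have k3m : k ^+ 3 * mm <= T by rewrite -k3E ler_wpM2l.
have k3T : k ^+ 3 <= T by apply: le_trans k3m; rewrite ler_peMr.
have bb : b <= b ^+ 2 by rewrite expr2 ler_peMl//; lra.
have b10 : 1 <= b ^+ 2 by lra.
have b00 : 0 <= b by lra.
have Tb : T <= T * b ^+ 2 by rewrite ler_peMr.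
have k2b : beta * k ^+ 2 <= T * b ^+ 2.
  rewrite (_ : beta * _ = (k ^+ 2 * mm) * b); last by rewrite /beta; ring.
  by rewrite ler_pM// mulr_ge0.
have k3b : beta * k ^+ 3 <= T * b ^+ 2.
  rewrite (_ : beta * _ = (k ^+ 3 * mm) * b); last by rewrite /beta; ring.
  by rewrite ler_pM// mulr_ge0.
have k3bb : beta ^+ 2 * k ^+ 3 = T * b ^+ 2.
  by rewrite /beta exprMn -mulrA [mm ^+ 2 * _]mulrC k3E mulrC.
set S := T * b ^+ 2 in Tb k2b k3b k3bb *.
have S0 : 0 <= S by apply: le_trans Tb.
have be0 := ltW beta_gt0.
have prod_le x0 y0 : 0 <= x0 -> x0 <= S -> y0 <= Q -> x0 * y0 <= S * Q.
  move=> x00 xS yQ; apply: le_trans (ler_wpM2l x00 yQ) _.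
  exact: ler_wpM2r.
have e1 := prod_le _ _ k30 (le_trans k3T Tb) hU.
have e2 := prod_le _ _ k20 (le_trans k2T Tb) hUV.
have e3 := prod_le _ _ (mulr_ge0 be0 k30) k3b hU.
have e4 : k * W <= S * Q.
  exact: (prod_le _ _ k0 (le_trans kT Tb) hW).
have e5 := prod_le _ _ (mulr_ge0 be0 k20) k2b hUV.
have e6 : beta ^+ 2 * k ^+ 3 * U3 <= S * Q.
  by apply: prod_le => //; rewrite k3bb.
(* 23 = 1 + 3 + 6 + 1 + 6 + 6 is the sum of the coefficients in [smooth3_le]. *)
rewrite [leRHS](_ : _ = 23 * (S * Q)); last by rewrite /S /T; ring.
by lra.
Qed.

Let row_weight := gibbs beta rest.

(* Reinstating the row tilts the weights by exp (- b psi), a decreasing function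
   of the loss, hence negatively associated with (1 + psi) `^ q. *)
Let leave_one_out x :
  avg (gibbs beta (H^~ x)) (fun c => Gf c x `^ q) <=
  avg row_weight (fun c => Gf c x `^ q).
Proof.
have hm1 := mm1; have hb1 := b1; have hD1 := D1; have hLi1 := Li1; have hL1 := L1.
pose e c := expR (- b * psi (Y c x)).
have w0 c : 0 <= row_weight c by exact: gibbs_ge0.
have w1 : \sum_c row_weight c = 1 by exact: gibbs_sum.
have Hsplit c : expR (- beta * H c x) = expR (- beta * rest c) * e c.
  rewrite -expRD; congr expR; rewrite /H /beta.
  by field; exact: lt0r_neq0.
have Zr := partition_fun_gt0 c0 beta rest.
pose A := \sum_c row_weight c * e c.
have A0 : 0 < A.
  rewrite /A (bigD1 c0)//=; apply: ltr_wpDr.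
    by apply: sumr_ge0 => c _; rewrite mulr_ge0// expR_ge0.
  by rewrite mulr_gt0 ?expR_gt0// divr_gt0 ?expR_gt0.
have ZE : partition_fun beta (H^~ x) = partition_fun beta rest * A.
  rewrite /partition_fun /A /row_weight /gibbs mulr_sumr; apply: eq_bigr => c _.
  by rewrite Hsplit mulrA [_ * (_ / _)]mulrC divfK ?gt_eqF.
have gE c : gibbs beta (H^~ x) c = row_weight c * e c / A.
  rewrite /gibbs ZE Hsplit /row_weight /gibbs.
  by field; rewrite !gt_eqF.
have -> : avg (gibbs beta (H^~ x)) (fun c => Gf c x `^ q) =
    avg row_weight (fun c => Gf c x `^ q * e c) / A.
  rewrite /avg mulr_suml; apply: eq_bigr => c _; rewrite gE; ring.
rewrite ler_pdivrMr//.
have := @chebyshev_sum R N row_weight (fun c => Gf c x `^ q) (fun c => - e c) w0 _.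
rewrite w1 mul1r.
have -> : avg row_weight (fun c => - e c) = - A.
  by rewrite /avg /A -sumrN; apply: eq_bigr => c _; rewrite mulrN.
have -> : avg row_weight (fun c => Gf c x `^ q * - e c) =
    - avg row_weight (fun c => Gf c x `^ q * e c).
  by rewrite /avg -sumrN; apply: eq_bigr => c _; rewrite !mulrN.
rewrite mulrN lerN2; apply => c d.
have eh (y z : R) : y <= z -> expR (- b * z) <= expR (- b * y).
  move=> yz; rewrite ler_expR !mulNr lerN2 ler_wpM2l//; lra.
have [h|h] := leP (psi (Y c x)) (psi (Y d x)).
  rewrite mulr_le0// subr_le0 ?lerN2; last exact: eh.
  by apply: powR_le => //; rewrite lerD2l.
rewrite mulr_ge0// subr_ge0 ?lerN2; last by apply: eh; exact: ltW.
by apply: powR_le => //; rewrite lerD2l ltW.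
Qed.

(** An even integer power replaces the real power [p] of [|s c / L|], because [weighted_even_moment]
    can integrate it. *)
Definition entry_moment := avg row_weight (fun c => (s c / L) ^+ r.*2).

Let Gf_le c x : Gf c x `^ q <=
  (4 `^ q * 3 `^ p * Li `^ q * L `^ p) * (2 + (s c / L) ^+ r.*2 + `|x| `^ p).
Proof.
have hm1 := mm1; have hb1 := b1; have hD1 := D1; have hLi1 := Li1; have hL1 := L1.
have L0 : 0 < L by lra.
have p0 : 0 <= p by rewrite mulr_ge0.
have yle : 1 + `|Y c x| <= L * (1 + `|s c / L| + `|x|).
  have h1 : `|Y c x| <= `|s c| + L * `|x|.
    apply: le_trans (ler_normD _ _) _; rewrite lerD2l normrM ler_wpM2r//.
    exact: le_trans lL.
  rewrite normrM normfV (gtr0_norm L0) !mulrDr mulr1 [L * (_ / _)]mulrC divfK ?gt_eqF//.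
  lra.
apply: (@le_trans _ _ ((4 * Li * (L * (1 + `|s c / L| + `|x|)) `^ q0) `^ q)).
  apply: powR_le => //; rewrite /Gf.
  have := powR_growth Li1 q00 (normr_ge0 (Y c x)).
  have := psi_growth (Y c x).
  have h : (1 + `|Y c x|) `^ q0 <= (L * (1 + `|s c / L| + `|x|)) `^ q0.
    by apply: powR_le => //; rewrite addr_ge0.
  have h4 : 0 <= 4 * Li by lra.
  by have := ler_wpM2l h4 h; lra.
have z0 : 0 <= 1 + `|s c / L| + `|x| by rewrite !addr_ge0.
have Li0 : 0 <= Li by lra.
have E (w : R) : 0 <= w -> (4 * Li * w) `^ q = 4 `^ q * Li `^ q * w `^ q.
  by move=> w0; rewrite powRM ?mulr_ge0// (powRM q (ler0n _ 4) Li0).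
rewrite E ?powR_ge0// (powRM _ (ltW L0) z0) powRM ?powR_ge0// -!powRrM -/p.
have h := powR_sum3 (normr_ge0 (s c / L)) (normr_ge0 x) p0.
have h2 := powR_norm_even (s c / L) p0 pr.
have t4 : 0 <= 4 `^ q :> R := powR_ge0 _ _.
have tL : 0 <= Li `^ q := powR_ge0 _ _.
have tp : 0 <= L `^ p := powR_ge0 _ _.
have t3 : 0 <= 3 `^ p :> R := powR_ge0 _ _.
have h3 : (1 + `|s c / L| + `|x|) `^ p <= 3 `^ p * (2 + (s c / L) ^+ r.*2 + `|x| `^ p).
  by apply: le_trans h _; rewrite ler_wpM2l//; lra.
have := ler_wpM2l (mulr_ge0 (mulr_ge0 t4 tL) tp) h3.
lra.
Qed.

(** 23 terms in [avg_third], 8 from [(2 * D) ^+ 3], the power of 4 from [powR_growth] and the power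
    of 3 from [powR_sum3]. *)
Definition entry_const : R := 23 * 8 * 4 `^ q * 3 `^ p.

(** Taylor's bound needs the third derivative at all [y] with [|y| <= |x|]. After [leave_one_out]
    the weights no longer depend on [y], so the remainder involves the entry through explicit powers
    of [|x|] only. *)
Lemma entry_expansion : exists d0 d1 d2 : R, forall x,
  `|g (softmin beta (fun c => mm^-1 * psi (s c + theta c * x) + rest c)) -
     (d0 + d1 * x + d2 * x ^+ 2)| <=
  (entry_const * K * D ^+ 3 * l ^+ 3 / mm * b ^+ 2 * (Li `^ q * L `^ p)) *
  (2 + entry_moment + `|x| `^ p) * `|x| ^+ 3.
Proof.
have K0 : 0 <= K := le_trans (normr_ge0 _) (gK1 0).
exists (g (softmin beta (H^~ 0))), (smooth1 beta H H1 g1 0),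
  (smooth2 beta H H1 H2 g1 g2 0 / 2) => x.
apply: (@taylor2_bound R (fun x => g (softmin beta (H^~ x))) _ _
  (smooth3 beta H H1 H2 H3 g1 g2 g3)).
- by move=> y; exact: (is_derive_smooth c0 beta_gt0 dH dg).
- by move=> y; exact: (is_derive_smooth1 c0 beta_gt0 dH dH1 dg1).
- by move=> y; exact: (is_derive_smooth2 c0 beta_gt0 dH dH1 dH2 dg1 dg2).
move=> y yx.
have w0 c : 0 <= row_weight c by exact: gibbs_ge0.
have p0 : 0 <= p by rewrite mulr_ge0.
have C0 : 0 <= 4 `^ q * 3 `^ p * Li `^ q * L `^ p.
  by rewrite !mulr_ge0 ?powR_ge0.
have h : avg (gibbs beta (H^~ y)) (fun c => Gf c y `^ q) <=
    (4 `^ q * 3 `^ p * Li `^ q * L `^ p) * (2 + entry_moment + `|x| `^ p).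
  apply: le_trans (leave_one_out y) _.
  apply: (@le_trans _ _ (avg row_weight (fun c =>
     (4 `^ q * 3 `^ p * Li `^ q * L `^ p) * (2 + (s c / L) ^+ r.*2 + `|x| `^ p)))).
    apply: ler_avg => // c; apply: le_trans (Gf_le c y) _.
    by rewrite ler_wpM2l// lerD2l; exact: powR_le.
  rewrite avgZ ler_wpM2l// /entry_moment /avg.
  rewrite (eq_bigr (fun c => row_weight c * (2 + `|x| `^ p) +
     row_weight c * (s c / L) ^+ r.*2)); last by move=> c _; ring.
  rewrite big_split/= -mulr_suml gibbs_sum//; lra.
apply: le_trans (avg_third h) _.
rewrite /entry_const le_eqVlt; apply/orP; left; apply/eqP; ring.
Qed.

End entry_expansion.

(** * Universality of the soft-minimum over a finite net *)

Section softmin_universality.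
Context {R : realType} {N : finType} {m n : nat}.
Notation I := ('I_m * 'I_n)%type.
Variables (c0 : N) (v : N -> 'I_n -> R) (fv : N -> R).
Variables (psi psi1 psi2 psi3 : 'I_m -> R -> R) (g g1 g2 g3 : R -> R).
Variables (Li : 'I_m -> R) (b D L K q0 q1 q2 q3 : R) (r : nat).
Hypotheses (m_gt0 : (0 < m)%N).
Hypotheses (b1 : 1 <= b) (D1 : 1 <= D) (Li1 : forall i, 1 <= Li i) (L1 : 1 <= L).
Hypotheses (q00 : 0 <= q0) (q10 : 0 <= q1) (q20 : 0 <= q2) (q30 : 0 <= q3).
Hypothesis v_le : forall c j, `|v c j| <= L.
Hypothesis dpsi : forall i (y : R), is_derive y (1 : R) (psi i) (psi1 i y).
Hypothesis dpsi1 : forall i (y : R), is_derive y (1 : R) (psi1 i) (psi2 i y).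
Hypothesis dpsi2 : forall i (y : R), is_derive y (1 : R) (psi2 i) (psi3 i y).
Hypothesis psi_ge0 : forall i y, 0 <= psi i y.
Hypothesis psi1_le : forall i y, `|psi1 i y| <= D * (1 + psi i y `^ q1).
Hypothesis psi2_le : forall i y, `|psi2 i y| <= D * (1 + psi i y `^ q2).
Hypothesis psi3_le : forall i y, `|psi3 i y| <= D * (1 + psi i y `^ q3).
Hypothesis psi_growth : forall i y, psi i y <= 1 + Li i * (1 + `|y| `^ q0).
Hypothesis dg : forall a : R, is_derive a (1 : R) g (g1 a).
Hypothesis dg1 : forall a : R, is_derive a (1 : R) g1 (g2 a).
Hypothesis dg2 : forall a : R, is_derive a (1 : R) g2 (g3 a).
Hypothesis gK0 : forall x, `|g x| <= K.
Hypothesis gK1 : forall x, `|g1 x| <= K.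
Hypothesis gK2 : forall x, `|g2 x| <= K.
Hypothesis gK3 : forall x, `|g3 x| <= K.

Let q := qq q1 q2 q3.
Let p := q0 * q.
Hypothesis pr : p <= r.*2%:R.

Variables (mu nu : I -> probability R R) (s : I -> R) (Mh : R).
Hypothesis Mh0 : 0 <= Mh.
Hypothesis mu1 : forall k, (mu k).-integrable setT (fun x => x%:E).
Hypothesis nu1 : forall k, (nu k).-integrable setT (fun x => x%:E).
Hypothesis mu2 : forall k, (mu k).-integrable setT (fun x => (x ^+ 2)%:E).
Hypothesis nu2 : forall k, (nu k).-integrable setT (fun x => (x ^+ 2)%:E).
Hypothesis mu_mean : forall k, (\int[mu k]_x x%:E = 0)%E.
Hypothesis nu_mean : forall k, (\int[nu k]_x x%:E = 0)%E.
Hypothesis mu_var : forall k, (\int[mu k]_x (x ^+ 2)%:E = (s k)%:E)%E.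
Hypothesis nu_var : forall k, (\int[nu k]_x (x ^+ 2)%:E = (s k)%:E)%E.
(** The first two bounds integrate the Taylor remainder of the swapped entry; the even moments serve
    for the sum of the other entries in its row. *)
Definition moments_le (la : probability R R) : Prop :=
  [/\ (\int[la]_x (`|x| ^+ 3)%:E <= Mh%:E)%E,
      (\int[la]_x (`|x| `^ p * `|x| ^+ 3)%:E <= Mh%:E)%E &
      forall l, (0 < l <= r)%N -> (\int[la]_x (x ^+ l.*2)%:E <= Mh%:E)%E].
Hypothesis mu_mom : forall k, moments_le (mu k).
Hypothesis nu_mom : forall k, moments_le (nu k).

Let mm : R := m%:R.
Let sm : R := Num.sqrt m%:R.
Let beta := b * mm.

Let mm1 : 1 <= mm. Proof. by rewrite ler1n. Qed.
Let mm0 : 0 < mm. Proof. exact: lt_le_trans mm1. Qed.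
Let sm0 : 0 < sm. Proof. by rewrite sqrtr_gt0. Qed.
Let sm1 : 1 <= sm. Proof. by rewrite -[leLHS]sqrtr1 ler_wsqrtr. Qed.
Let smE : sm ^+ 2 = mm. Proof. by rewrite sqr_sqrtr// ler0n. Qed.
Let L0 : 0 < L. Proof. exact: lt_le_trans L1. Qed.
Let K0 : 0 <= K. Proof. exact: le_trans (gK0 0). Qed.

Definition row_val (c : N) (i : 'I_m) (a : coords R I) : R :=
  \sum_j a (i, j) / Num.sqrt m%:R * v c j.

Definition net_energy (a : coords R I) (c : N) : R :=
  m%:R^-1 * (\sum_i psi i (row_val c i a)) + fv c.

Let rest (i : 'I_m) (a : coords R I) (c : N) : R :=
  m%:R^-1 * (\sum_(i' | i' != i) psi i' (row_val c i' a)) + fv c.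

Let others (k : I) : seq I := [seq (k.1, j) | j <- enum 'I_n & j != k.2].

(** Divided by [L] so that the coefficients are at most 1 in absolute value, as
    [weighted_even_moment] demands. *)
Let coef (c : N) (k : I) : R := v c k.2 / L.

Let partial_row (k : I) (a : coords R I) (c : N) : R :=
  L / sm * lincomb (coef c) (others k) a.

Let partial_rowE k a c :
  partial_row k a c = \sum_(j | j != k.2) a (k.1, j) / sm * v c j.
Proof.
rewrite /partial_row /lincomb /others big_map big_filter big_enum_cond/= mulr_sumr.
apply: eq_bigr => j _; rewrite /coef/=; field.
by rewrite !gt_eqF.
Qed.

Let energy_upd (k : I) (a : coords R I) (x : R) : net_energy (upd k a x) =
  fun c => mm^-1 * psi k.1 (partial_row k a c + v c k.2 / sm * x) + rest k.1 a c.
Proof.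
apply/funext => c; rewrite /net_energy (bigD1 k.1)//= mulrDr -addrA; congr (_ * _ + _).
  congr (psi _ _); rewrite /row_val (bigD1 k.2)//= -surjective_pairing updE addrC.
  rewrite partial_rowE; congr (_ + _); last by rewrite -/sm; ring.
  by apply: eq_bigr => j jk; rewrite updNE//; apply: contra_neq jk => <-.
congr (_ * _ + _); apply: eq_bigr => i ik; congr (psi _ _).
by apply: eq_bigr => j _; rewrite updNE//; apply: contra_neq ik => <-.
Qed.

Let rest_upd (i : 'I_m) j a x : rest i (upd (i, j) a x) = rest i a.
Proof.
apply/funext => c; congr (_ * _ + _); apply: eq_bigr => i' ik; congr (psi _ _).
by apply: eq_bigr => j' _; rewrite updNE// xpair_eqE (negbTE ik).
Qed.

Let mpsi i : measurable_fun setT (psi i).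
Proof. by apply: continuous_measurable_fun; exact: is_derive_continuous (dpsi i). Qed.

Lemma measurable_row_val c i : measurable_fun setT (row_val c i).
Proof.
apply: measurable_sum => j; apply: measurable_funM => //.
by apply: measurable_funM => //; exact: measurable_coord.
Qed.

Let mrow_loss c i : measurable_fun setT (fun a => psi i (row_val c i a)).
Proof. exact: measurableT_comp (mpsi i) (measurable_row_val c i). Qed.

Let mrest i c : measurable_fun setT (fun a => rest i a c).
Proof.
rewrite /rest; apply: measurable_funD => //; apply: measurable_funM => //.
rewrite (_ : (fun a => \sum_(i' | i' != i) _) =
    fun a => \sum_i' (if i' != i then psi i' (row_val c i' a) else 0)).
  by apply: measurable_sum => i'; case: (i' != i) => //; exact: mrow_loss.
by apply/funext => a; rewrite big_mkcond.
Qed.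

Lemma measurable_net_energy c : measurable_fun setT (fun a => net_energy a c).
Proof.
by apply: measurable_funD => //; apply: measurable_funM => //; exact: measurable_sum.
Qed.

Let mZ (E : coords R I -> N -> R) : (forall c, measurable_fun setT (fun a => E a c)) ->
  measurable_fun setT (fun a => partition_fun beta (E a)).
Proof.
move=> mE; apply: measurable_sum => c; apply: measurableT_comp => //.
exact: measurable_funM.
Qed.

Let mlnZ (E : coords R I -> N -> R) : (forall c, measurable_fun setT (fun a => E a c)) ->
  measurable_fun setT (fun a => ln (partition_fun beta (E a))).
Proof. by move=> mE; apply: measurableT_comp; [exact: measurable_ln|exact: mZ]. Qed.

Lemma measurable_softmin_energy :
  measurable_fun setT (fun a => g (softmin beta (net_energy a))).
Proof.
apply: measurableT_comp.
  by apply: continuous_measurable_fun; exact: is_derive_continuous dg.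
by apply: measurable_funM => //; apply: mlnZ; exact: measurable_net_energy.
Qed.

Let W i c (a : coords R I) := gibbs beta (rest i a) c.

Let mW i c : measurable_fun setT (W i c).
Proof.
rewrite (_ : W i c = fun a => expR (- beta * rest i a c - ln (partition_fun beta (rest i a)))).
  apply: measurableT_comp => //; apply: measurable_funB; last exact: mlnZ.
  exact: measurable_funM.
apply/funext => a; rewrite expRD expRN lnK//.
by rewrite posrE partition_fun_gt0.
Qed.

Let W0 i c a : 0 <= W i c a. Proof. exact: gibbs_ge0. Qed.
Let W1 i a : \sum_c W i c a = 1. Proof. exact: gibbs_sum. Qed.

Let Tm (k : I) (a : coords R I) := entry_moment mm b L r (partial_row k a) (rest k.1 a).

Let TmE k a : Tm k a =
  \sum_c mm^-1 ^+ r * (W k.1 c a * lincomb (coef c) (others k) a ^+ r.*2).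
Proof.
rewrite /Tm /entry_moment /avg; apply: eq_bigr => c _.
rewrite -/beta -/(W k.1 c a) mulrCA; congr (_ * _).
rewrite /partial_row.
rewrite (_ : _ / L = sm^-1 * lincomb (coef c) (others k) a); last first.
  by field; rewrite !gt_eqF.
rewrite exprMn; congr (_ * _).
by rewrite -mul2n exprM [sm^-1 ^+ 2]exprVn smE.
Qed.

Let mlin k c : measurable_fun setT (fun a => W k.1 c a * lincomb (coef c) (others k) a ^+ r.*2).
Proof.
by apply: measurable_funM => //; apply: measurable_funX; exact: measurable_lincomb.
Qed.

Let lin0 k c a : 0 <= W k.1 c a * lincomb (coef c) (others k) a ^+ r.*2.
Proof. by rewrite mulr_ge0// expr_double_ge0. Qed.

Let im0 : 0 <= mm^-1 ^+ r. Proof. by rewrite exprn_ge0// invr_ge0 ltW. Qed.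

Let Tm0 k a : 0 <= Tm k a.
Proof. by rewrite TmE sumr_ge0// => c _; rewrite mulr_ge0. Qed.

Let mTm k : measurable_fun setT (Tm k).
Proof.
rewrite (_ : Tm k = fun a => \sum_c mm^-1 ^+ r * (W k.1 c a * lincomb (coef c) (others k) a ^+ r.*2)).
  by apply: measurable_sum => c; apply: measurable_funM.
by apply/funext => a; rewrite TmE.
Qed.

Let size_others k : (size (others k) <= n)%N.
Proof.
rewrite size_map size_filter (leq_trans (count_size _ _))//.
by rewrite -cardT card_ord.
Qed.

Let uniq_others k : uniq (others k).
Proof.
rewrite map_inj_uniq; last by move=> j j' [].
by rewrite filter_uniq// enum_uniq.
Qed.

(** n^r comes from the at most n terms of a row sum, m^(-r) from the scaling of the entries by 1 /
    sqrt m. *)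
Definition moment_bound : R := moment_const Mh r * (n%:R / m%:R) ^+ r.

(** For each net point [c], the weight [W k.1 c] is unchanged when row [k.1] is updated, so
    [weighted_even_moment] applies. The resulting bounds are proportional to the mean weights, which
    add up to 1: the size of the net does not enter. *)
Let integral_Tm k (la : I -> probability R R) (pi : probability (coords R I) R) :
  product_law pi la ->
  (forall k, (la k).-integrable setT (fun x => x%:E)) ->
  (forall k, \int[la k]_x x%:E = 0)%E ->
  (forall k, moments_le (la k)) ->
  (\int[pi]_a (Tm k a)%:E <= moment_bound%:E)%E.
Proof.
move=> hpi la1 la_mean la_mom.
have Wfin c : (\int[pi]_a (W k.1 c a)%:E)%E \is a fin_num.
  rewrite ge0_fin_numE; last by apply: integral_ge0 => a _; rewrite lee_fin.
  apply: (@le_lt_trans _ _ (\int[pi]_a 1%:E)%E); last by rewrite integral_prob_cst ltry.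
  apply: le_lower_integral => a; rewrite lee_fin//.
  by rewrite -(W1 k.1 a) (bigD1 c)//= lerDl sumr_ge0.
pose w c := fine (\int[pi]_a (W k.1 c a)%:E)%E.
have wE c : (\int[pi]_a (W k.1 c a)%:E = (w c)%:E)%E by rewrite fineK.
have w1 : \sum_c w c = 1.
  apply: EFin_inj; rewrite -sumEFin.
  under eq_bigr do rewrite -wE.
  rewrite -ge0_integral_sum//; last 2 first.
  - by move=> c; exact/measurable_EFinP.
  - by move=> c a _; rewrite lee_fin.
  under eq_integral do rewrite sumEFin W1.
  by rewrite integral_prob_cst.
under eq_integral do rewrite TmE -sumEFin.
rewrite ge0_integral_sum//; last 2 first.
- by move=> c; apply/measurable_EFinP; exact: measurable_funM.
- by move=> c a _; rewrite lee_fin mulr_ge0.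
rewrite (_ : moment_bound = \sum_c moment_bound * w c); last first.
  by rewrite -mulr_sumr w1 mulr1.
rewrite -sumEFin.
apply: lee_sum => c _.
under eq_integral do rewrite EFinM.
rewrite ge0_integralZl//; last 2 first.
- exact/measurable_EFinP.
- by move=> a _; rewrite lee_fin.
have H := @weighted_even_moment R I pi la Mh (w c) r (W k.1 c) (coef c) (others k)
  hpi Mh0 (uniq_others k) (mW k.1 c) (W0 k.1 c) (wE c) _ _ la1 la_mean _.
apply: le_trans (lee_wpmul2l _ (H _ _ _)) _ => //.
- by move=> _ /mapP[j _ ->] a x; rewrite /W rest_upd.
- by move=> k'; rewrite /coef normrM normfV (gtr0_norm L0) ler_pdivrMr// mul1r.
- by move=> k' l hl; have [_ _] := la_mom k'; apply.
rewrite -EFinM lee_fin /moment_bound expr_div_n.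
have w0 : 0 <= w c by rewrite -lee_fin -wE; apply: integral_ge0 => a _; rewrite lee_fin.
have hs : (size (others k))%:R ^+ r <= n%:R ^+ r :> R.
  by rewrite lerXn2r ?nnegrE// ler_nat.
have mc0 := moment_const_ge0 r Mh0.
have := ler_wpM2l (mulr_ge0 (mulr_ge0 im0 mc0) w0) hs.
rewrite exprVn -/mm; lra.
Qed.

Let Cst i := entry_const q0 q1 q2 q3 * K * D ^+ 3 * (L / sm) ^+ 3 / mm * b ^+ 2 *
  (Li i `^ q * L `^ p).

Let Cst0 i : 0 <= Cst i.
Proof.
have D0 : 0 <= D := le_trans ler01 D1; have b0 : 0 <= b := le_trans ler01 b1.
rewrite /Cst /entry_const; apply: mulr_ge0; last by rewrite mulr_ge0 ?powR_ge0.
apply: mulr_ge0; last exact: exprn_ge0.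
apply: divr_ge0; last exact: ltW.
apply: mulr_ge0; last by rewrite exprn_ge0// divr_ge0// ltW.
apply: mulr_ge0; last exact: exprn_ge0.
by apply: mulr_ge0 => //; rewrite !mulr_ge0 ?powR_ge0.
Qed.

Let G (k : I) a := Cst k.1 * Mh * (3 + Tm k a).

Let integral_rho i (t : R) (la : probability R R) : 0 <= t -> moments_le la ->
  (\int[la]_x (Cst i * (2 + t + `|x| `^ p) * `|x| ^+ 3)%:E <=
    (Cst i * Mh * (3 + t))%:E)%E.
Proof.
move=> t0 [m3 mp _].
have E x : (Cst i * (2 + t + `|x| `^ p) * `|x| ^+ 3)%:E =
    ((Cst i * (2 + t))%:E * (`|x| ^+ 3)%:E + (Cst i)%:E * (`|x| `^ p * `|x| ^+ 3)%:E)%E.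
  by rewrite -!EFinM -EFinD; congr EFin; ring.
have mx3 : measurable_fun setT (fun x : R => `|x| ^+ 3).
  by apply: measurable_funX; exact: normr_measurable.
have mxp : measurable_fun setT (fun x : R => `|x| `^ p * `|x| ^+ 3).
  apply: measurable_funM => //; apply: (measurableT_comp (measurable_powR p)).
  exact: normr_measurable.
have x30 (x : R) : 0 <= `|x| ^+ 3 by rewrite exprn_ge0.
have xp0 (x : R) : 0 <= `|x| `^ p * `|x| ^+ 3 by rewrite mulr_ge0 ?powR_ge0.
have Ct0 : 0 <= Cst i * (2 + t) by rewrite mulr_ge0 ?addr_ge0.
under eq_integral do rewrite E.
rewrite ge0_integralD//; last 4 first.
- by move=> x _; rewrite mule_ge0// lee_fin.
- by apply: measurable_funeM; exact/measurable_EFinP.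
- by move=> x _; rewrite mule_ge0// lee_fin.
- by apply: measurable_funeM; exact/measurable_EFinP.
rewrite ge0_integralZl//; last exact/measurable_EFinP.
rewrite ge0_integralZl//; last 2 first.
- exact/measurable_EFinP.
- by rewrite lee_fin.
apply: (@le_trans _ _ ((Cst i * (2 + t))%:E * Mh%:E + (Cst i)%:E * Mh%:E)%E).
  by apply: leeD; apply: lee_wpmul2l; rewrite ?lee_fin.
by rewrite -!EFinM -EFinD lee_fin le_eqVlt; apply/orP; left; apply/eqP; ring.
Qed.

(** A swap costs of the order of m^(-5/2): the cube of 1 / sqrt m from Taylor's formula and 1/m from
    the normalisation of the cost. Summing over n entries in each row leaves n / (m sqrt m) times a
    mean over the rows. The leading 2 is that of [lindeberg_swap]. *)
Definition swap_error : R := 2 * entry_const q0 q1 q2 q3 * Mh * (3 + moment_bound) *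
  (n%:R / (m%:R * Num.sqrt m%:R)) * (m%:R^-1 * \sum_i Li i `^ q) *
  (L ^+ 3 * L `^ p) * K * D ^+ 3 * b ^+ 2.

(** Adding [K] makes the integrand non-negative, as the resampling formula requires; the shift
    cancels in the difference. *)
Lemma softmin_universality (pi pi' : probability (coords R I) R) :
  product_law pi mu -> product_law pi' nu ->
  (`| \int[pi]_a (g (softmin beta (net_energy a)) + K)%:E -
      \int[pi']_a (g (softmin beta (net_energy a)) + K)%:E | <= swap_error%:E)%E.
Proof.
move=> hpi hpi'.
have mphi : measurable_fun setT (fun a => g (softmin beta (net_energy a)) + K).
  by apply: measurable_funD => //; exact: measurable_softmin_energy.
have phi0 a : 0 <= g (softmin beta (net_energy a)) + K.
  by have := gK0 (softmin beta (net_energy a)); rewrite ler_norml => /andP[]; lra.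
have phiK a : g (softmin beta (net_energy a)) + K <= 2 * K.
  by have := gK0 (softmin beta (net_energy a)); rewrite ler_norml => /andP[]; lra.
have mG k : measurable_fun setT (G k).
  by apply: measurable_funM => //; apply: measurable_funD.
have G0 k a : 0 <= G k a.
  by rewrite /G mulr_ge0 ?addr_ge0// mulr_ge0.
have := @lindeberg_swap R I mu nu s mu1 nu1 mu2 nu2 mu_mean nu_mean mu_var nu_var
  _ (2 * K) (fun k => Cst k.1 * Mh * (3 + moment_bound)) mphi phi0 phiK G mG G0 _ _
  pi pi' hpi hpi'.
move=> H; apply: le_trans (H _ _) _.
- move=> k a.
  have l0 : 0 <= L / sm by rewrite divr_ge0// ltW.
  have lL : L / sm <= L by rewrite ler_pdivrMr// ler_peMr// ltW.
  have thl c : `|v c k.2 / sm| <= L / sm.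
    by rewrite normrM normfV (gtr0_norm sm0) ler_wpM2r// invr_ge0 ltW.
  have [d0 [d1 [d2 h]]] := entry_expansion c0 (partial_row k a) (rest k.1 a)
    mm1 b1 D1 (Li1 k.1) L1 q00 q10 q20 q30 l0 lL thl (dpsi k.1) (dpsi1 k.1)
    (dpsi2 k.1) (psi_ge0 k.1) (psi1_le k.1) (psi2_le k.1) (psi3_le k.1)
    (psi_growth k.1) dg dg1 dg2 gK1 gK2 gK3 pr.
  exists (d0 + K), d1, d2, (fun x => Cst k.1 * (2 + Tm k a + `|x| `^ p) * `|x| ^+ 3); split.
  + apply: measurable_funM; last by apply: measurable_funX; exact: normr_measurable.
    apply: measurable_funM => //; apply: measurable_funD => //.
    by apply: (measurableT_comp (measurable_powR p)); exact: normr_measurable.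
  + move=> x; rewrite energy_upd; apply: le_trans (h x).
    rewrite le_eqVlt; apply/orP; left; apply/eqP; congr (`|_|); ring.
  + exact: integral_rho.
  + exact: integral_rho.
- move=> k J pi0 hpi0.
  have la1 k' : (hybrid_law mu nu J k').-integrable setT (fun x => x%:E).
    by rewrite /hybrid_law; case: ifP.
  have la_mean k' : (\int[hybrid_law mu nu J k']_x x%:E = 0)%E.
    by rewrite /hybrid_law; case: ifP.
  have la_mom k' : moments_le (hybrid_law mu nu J k').
    by rewrite /hybrid_law; case: ifP.
  have := integral_Tm k hpi0 la1 la_mean la_mom => hT.
  rewrite /G.
  have CM0 : 0 <= Cst k.1 * Mh by rewrite mulr_ge0.
  under eq_integral do rewrite EFinM EFinD.
  rewrite ge0_integralZl//; last 2 first.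
  + by apply: emeasurable_funD => //; exact/measurable_EFinP.
  + by move=> a _; rewrite -EFinD lee_fin addr_ge0.
  rewrite [leRHS]EFinM; apply: lee_wpmul2l => //.
  rewrite ge0_integralD//; last 2 first.
  + by move=> a _; rewrite lee_fin.
  + exact/measurable_EFinP.
  by rewrite integral_prob_cst [leRHS]EFinD; apply: leeD2l.
rewrite lee_fin /swap_error.
rewrite -(pair_bigA_idem (addr0 _) (fun i (j : 'I_n) => Cst i * Mh * (3 + moment_bound)))/=.
under eq_bigr do rewrite sumr_const card_ord -mulr_natl.
rewrite (eq_bigr (fun i => (n%:R * entry_const q0 q1 q2 q3 * K * D ^+ 3 * (L / sm) ^+ 3 / mm *
   b ^+ 2 * L `^ p * Mh * (3 + moment_bound)) * Li i `^ q)); last first.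
  by move=> i _; rewrite /Cst; ring.
rewrite -mulr_sumr le_eqVlt; apply/orP; left; apply/eqP.
rewrite -/sm -/mm -smE; field.
exact: lt0r_neq0.
Qed.

End softmin_universality.

(** * Reduction of the infimum to a finite net *)

Section finite_net.
Context {R : realType} {n : nat}.

Lemma logplus_ge1 (x : R) : 1 <= logplus x.
Proof. by rewrite le_max lexx. Qed.

Lemma ln_le_logplus (x : R) : ln x <= logplus x.
Proof. by rewrite le_max lexx orbT. Qed.

(** The cube is cut into cells of side [delta] and each cell that meets [S] is represented by one of
    its points in [S]: net points outside [S] could undercut the infimum. *)
Lemma finite_net (L delta : R) (S : set 'cV[R]_n) (s0 : 'cV[R]_n) :
  1 <= L -> 0 < delta <= 1 -> S `<=` cube L -> S s0 ->
  exists (N : finType) (c0 : N) (v : N -> 'cV[R]_n),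
    [/\ forall c, S (v c),
        forall w, S w -> exists c, forall i, `|w i 0 - v c i 0| <= delta &
        ln (#|N|%:R) <= n%:R * (3 * logplus (L / delta))].
Proof.
move=> L1 /andP[d0 d1] SL Ss0.
pose k := Num.truncn (2 * L / delta).
pose cell (w : 'cV[R]_n) : {ffun 'I_n -> 'I_k.+1} :=
  [ffun i => inord (Num.truncn ((w i 0 + L) / delta))].
have cellE w i : S w -> (Num.truncn ((w i 0 + L) / delta)%R < k.+1)%N.
  move=> /SL /(_ i) /andP[w1 w2]; rewrite ltnS; apply: le_truncn.
  by rewrite ler_pM2r ?invr_gt0//; lra.
(* Cells disjoint from [S] receive the default point [s0], which lies in [S] as well. *)
exists {ffun 'I_n -> 'I_k.+1}, (cell s0), (fun c => xget s0 [set w | S w /\ cell w = c]).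
split.
- by move=> c; case: xgetP => [x _ [Sx _]|_].
- move=> w Sw; exists (cell w) => i.
  have [] := @xgetPex _ s0 [set w' | S w' /\ cell w' = cell w] (ex_intro _ w (conj Sw erefl)).
  set w' := xget _ _ => Sw' e.
  have := congr1 (fun f : {ffun 'I_n -> 'I_k.+1} => (f i : nat)) e.
  rewrite /= !ffunE !inordK ?cellE// => ee.
  have p0 (u : 'cV[R]_n) : S u -> 0 <= (u i 0 + L) / delta.
    move=> /SL /(_ i) /andP[u1 u2]; apply: divr_ge0; [lra|exact: ltW].
  have /andP[a1 a2] := truncn_itv (p0 _ Sw).
  have /andP[b1 b2] := truncn_itv (p0 _ Sw').
  rewrite ee in b1 b2.
  have h : `|(w i 0 + L) / delta - (w' i 0 + L) / delta| <= 1.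
    rewrite ler_norml; move: a2 b2; rewrite -!natr1 => a2 b2.
    by apply/andP; split; lra.
  move: h; rewrite -mulrBl normrM normfV (gtr0_norm d0) ler_pdivrMr// mul1r.
  by rewrite (_ : _ - _ = w i 0 - w' i 0)//; ring.
rewrite card_ffun !card_ord natrX lnXn ?ltr0Sn// -[leLHS]mulr_natl ler_wpM2l//.
have k3 : k.+1%:R <= 3 * (L / delta).
  have h0 : 0 <= 2 * L / delta by rewrite divr_ge0 ?ltW//; lra.
  have /andP[h1 _] := truncn_itv h0.
  have h2 : 1 <= L / delta by rewrite ler_pdivlMr//; lra.
  by rewrite -natr1; move: h1; rewrite -/k -mulrA; lra.
have Ld0 : 0 < L / delta by rewrite divr_gt0//; lra.
apply: (@le_trans _ _ (ln (3 * (L / delta)))).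
  by rewrite ler_ln ?posrE ?ltr0Sn// mulr_gt0.
rewrite lnM ?posrE//.
(* Together with [logplus >= 1], this absorbs the factor 3 inside the logarithm into
   [3 * logplus]. *)
have l3 : ln (3 : R) <= 2.
  rewrite (_ : 3 = 1 + 2 :> R); last by ring.
  by apply: le_ln1Dx; lra.
have := ln_le_logplus (L / delta); have := logplus_ge1 (L / delta); lra.
Qed.

End finite_net.

Section infimum_softmin.
Context {R : realType} {T : Type} {N : finType}.

Lemma inf_softmin_dist (beta eta : R) (c0 : N) (S : set T) (v : N -> T)
    (H : T -> R) (E : N -> R) : 0 < beta ->
  (forall c, S (v c)) -> (forall c, `|H (v c) - E c| <= eta) ->
  (forall w, S w -> exists c, `|H w - E c| <= eta) ->
  `|inf [set H w | w in S] - softmin beta E| <= eta + ln (#|N|%:R) / beta.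
Proof.
move=> beta0 Sv Hv Hw.
(* This also shows that the set is bounded below, so that [inf] is a genuine infimum and not its
   default value. *)
have lb : lbound [set H w | w in S] (softmin beta E - eta).
  move=> _ [w Sw <-]; have [c] := Hw w Sw; rewrite ler_norml => /andP[h1 h2].
  by have := softmin_le c0 beta0 E c; lra.
have ne : [set H w | w in S] !=set0 by exists (H (v c0)), (v c0).
have h1 := lb_le_inf ne lb.
have h2 : inf [set H w | w in S] - eta - ln (#|N|%:R) / beta <= softmin beta E.
  apply: (softmin_ge c0 beta0) => c; have := Hv c; rewrite ler_norml => /andP[h3 h4].
  have : inf [set H w | w in S] <= H (v c).
    by apply: ge_inf; [exists (softmin beta E - eta)|exists (v c)].
  lra.
have lnN : 0 <= ln (#|N|%:R : R) / beta.
  apply: divr_ge0; last exact: ltW.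
  by rewrite ln_ge0// ler1n; apply/card_gt0P; exists c0.
rewrite ler_norml; apply/andP; split; lra.
Qed.

End infimum_softmin.

Section smoothed_increment.
Context {R : realType}.

(** [rr] stands for the sum of the absolute values of the entries in a row. By the mean value
    theorem, the derivative bound costs [1 + rr] to the power [q0 * q1], and the increment one more
    factor. *)
Lemma smooth_loss_increment (phi phi1 : R -> R) (D Li L q0 q1 rr delta x y : R) :
  1 <= D -> 1 <= Li -> 1 <= L -> 0 <= q0 -> 0 <= q1 -> 0 <= rr -> 0 <= delta ->
  (forall z : R, is_derive z (1 : R) phi (phi1 z)) ->
  (forall z, 0 <= phi z) ->
  (forall z, `|phi1 z| <= D * (1 + phi z `^ q1)) ->
  (forall z, phi z <= 1 + Li * (1 + `|z| `^ q0)) ->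
  `|x| <= L * rr -> `|y| <= L * rr -> `|x - y| <= delta * rr ->
  `|phi x - phi y| <=
    delta * (D * (2 * 4 `^ q1) * Li `^ q1 * L `^ (q0 * q1) * (1 + rr) `^ (q0 * q1 + 1)).
Proof.
move=> D1 L1i L1 q00 q10 rr0 d0 dphi phi0 phi1_le growth.
wlog xy : x y / x <= y.
  move=> H hx hy hxy; have [xy|yx] := leP x y; first exact: H.
  by rewrite distrC; apply: H => //; [exact: ltW|rewrite distrC].
move=> hx hy hxy.
have cphi : {within `[x, y], continuous phi}.
  by apply: continuous_subspaceT; exact: is_derive_continuous dphi.
have [z /[!in_itv]/= /andP[xz zy] hz] := MVT_segment xy (fun z _ => dphi z) cphi.
rewrite distrC hz normrM [`|y - x|]distrC.
have zL : `|z| <= L * rr.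
  move: hx hy; rewrite !ler_norml => /andP[h1 h2] /andP[h3 h4].
  by apply/andP; split; lra.
have Li0 : 0 <= Li by lra. have D0 : 0 <= D by lra. have L0 : 0 <= L by lra.
have rr1 : 1 <= 1 + rr by lra.
have b1 : `|phi1 z| <= D * (2 * 4 `^ q1) * Li `^ q1 * L `^ (q0 * q1) * (1 + rr) `^ (q0 * q1).
  apply: le_trans (phi1_le z) _.
  have g4 : 1 + phi z <= 4 * Li * (L * (1 + rr)) `^ q0.
    have h := powR_growth L1i q00 (normr_ge0 z).
    have h2 : (1 + `|z|) `^ q0 <= (L * (1 + rr)) `^ q0 by apply: powR_le => //; lra.
    have h4 : 0 <= 4 * Li by lra.
    by have := ler_wpM2l h4 h2; have := growth z; lra.
  have p1 : 1 <= (1 + phi z) `^ q1 by apply: powR_ge1 => //; rewrite lerDl.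
  have p2 : phi z `^ q1 <= (1 + phi z) `^ q1 by apply: powR_le => //; rewrite lerDr.
  have p3 : (1 + phi z) `^ q1 <=
      4 `^ q1 * Li `^ q1 * (L `^ (q0 * q1) * (1 + rr) `^ (q0 * q1)).
    apply: le_trans (powR_le q10 _ g4) _; first by rewrite addr_ge0.
    rewrite powRM ?powR_ge0 ?mulr_ge0// (powRM q1 (ler0n _ 4) Li0).
    by rewrite -powRrM powRM//; lra.
  have p4 : 1 + phi z `^ q1 <= 2 * (4 `^ q1 * Li `^ q1 * (L `^ (q0 * q1) * (1 + rr) `^ (q0 * q1))).
    by lra.
  by have := ler_wpM2l D0 p4; lra.
have e1 : rr <= 1 + rr by lra.
have B0 : 0 <= D * (2 * 4 `^ q1) * Li `^ q1 * L `^ (q0 * q1) * (1 + rr) `^ (q0 * q1).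
  exact: le_trans b1.
have rn : 1 + rr != 0 by rewrite gt_eqF//; lra.
rewrite (powRD (x := 1 + rr)); last by rewrite rn implybT.
rewrite (powRr1 (a := 1 + rr)); last by lra.
have h3 := ler_pM (normr_ge0 _) (normr_ge0 _) b1 hxy.
have h4 := ler_wpM2l (mulr_ge0 d0 B0) e1.
lra.
Qed.

End smoothed_increment.

(** * Moments of the entries and error of the net *)

Section entry_laws.
Context d (T : measurableType d) (R : realType) (P : probability T R).
Variables (X : {RV P >-> R}) (M q0 q1 q2 q3 : R) (r : nat).
Hypotheses (q00 : 0 <= q0) (q30 : 0 <= q3).
Let q := qq q1 q2 q3.
Let qb := qbar q0 q1 q2 q3.
Hypothesis r_le : r.*2%:R <= q0 * q + 2.
Hypothesis XM : (\int[P]_t (`|X t| `^ qb)%:E <= M%:E)%E.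
Let la := distribution P X.

Let q_ge0 : 0 <= q. Proof. by rewrite /q /qq !le_max q30. Qed.
Let qb3 : 3 <= qb. Proof. by rewrite lerDr mulr_ge0. Qed.

Let mnorm (s : R) : measurable_fun setT (fun x : R => `|x| `^ s).
Proof. by apply: (measurableT_comp (measurable_powR s)); exact: normr_measurable. Qed.

Let la_qb : (\int[la]_x (`|x| `^ qb)%:E <= M%:E)%E.
Proof.
rewrite /la ge0_integral_distribution//.
by apply/measurable_EFinP; exact: mnorm.
Qed.

Lemma abs_moment_le (s : R) : 0 <= s <= qb ->
  (\int[la]_x (`|x| `^ s)%:E <= (1 + M)%:E)%E.
Proof.
move=> /andP[s0 sq].
apply: (@le_trans _ _ (\int[la]_x (1%:E + (`|x| `^ qb)%:E))%E).
  apply: le_lower_integral => x; first by rewrite lee_fin powR_ge0.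
  by rewrite -EFinD lee_fin; exact: powR_le_1D.
rewrite ge0_integralD//; last by apply/measurable_EFinP; exact: mnorm.
by rewrite integral_prob_cst [leRHS]EFinD leeD2l.
Qed.

Let int_pow (k : nat) : k%:R <= qb -> (\int[la]_x (`|x| ^+ k)%:E <= (1 + M)%:E)%E.
Proof.
move=> kq; have := @abs_moment_le k%:R; rewrite ler0n kq => /(_ isT).
by under eq_integral do rewrite powR_mulrn//.
Qed.

Lemma law_integrable : la.-integrable setT (fun x => x%:E).
Proof.
apply/integrableP; split; first exact/measurable_EFinP.
apply: (@le_lt_trans _ _ (1 + M)%:E); last exact: ltry.
have /int_pow : 1%:R <= qb by apply: le_trans qb3; rewrite ler_nat.
by under eq_integral do rewrite expr1.
Qed.

Lemma law_integrable2 : la.-integrable setT (fun x => (x ^+ 2)%:E).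
Proof.
apply/integrableP; split; first by apply/measurable_EFinP; exact: exprn_measurable.
apply: (@le_lt_trans _ _ (1 + M)%:E); last exact: ltry.
have /int_pow h : 2%:R <= qb by apply: le_trans qb3; rewrite ler_nat.
by apply: le_trans h; apply: le_lower_integral => x; rewrite ?abse_ge0//= normrX.
Qed.

Lemma law_mean : ('E_P[X] = 0 -> \int[la]_x x%:E = 0)%E.
Proof.
rewrite unlock => <-; rewrite /la integral_distribution//.
have h := law_integrable.
apply/integrableP; split; first exact/measurable_EFinP.
have /integrableP[_] := h; rewrite /la ge0_integral_distribution//.
by apply: measurableT_comp => //; exact/measurable_EFinP.
Qed.

Lemma law_second : (\int[la]_x (x ^+ 2)%:E = 'E_P[fun t => (X t ^+ 2)%R])%E.
Proof.
rewrite unlock /la ge0_integral_distribution//.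
- by apply/measurable_EFinP; exact: exprn_measurable.
- by move=> x; rewrite lee_fin sqr_ge0.
Qed.

Lemma law_moments_le : 0 <= M -> moments_le q0 q1 q2 q3 r (1 + M) la.
Proof.
move=> M0; split.
- by apply: int_pow.
- apply: le_trans (le_trans la_qb _); last by rewrite lee_fin lerDr.
  apply: le_lower_integral => x; first by rewrite lee_fin mulr_ge0 ?powR_ge0 ?exprn_ge0.
  rewrite lee_fin -powR_mulrn// -powRD//.
  by rewrite gt_eqF// (lt_le_trans _ qb3).
move=> l /andP[_ lr]; have := @int_pow l.*2.
under eq_integral do rewrite -mul2n exprM real_normK ?num_real// -exprM mul2n.
apply; have : l.*2%:R <= r.*2%:R :> R by rewrite ler_nat leq_double.
by move: r_le; rewrite /qb /qbar -/q; lra.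
Qed.

End entry_laws.

Section row_sums.
Context {R : realType} {n : nat}.

(** The row sum is at most n times its largest term, and a power of the largest term is at most the
    sum of the powers. The crude power of n lost here is what the smallness [delta < omega n q0 q1]
    pays for. *)
Lemma row_sum_pow_le (x : 'I_n -> R) (sm kap p1 qb : R) :
  0 < sm -> 1 <= kap -> n%:R / sm <= kap -> 0 < p1 <= qb -> (0 < n)%N ->
  (1 + \sum_j `|x j| / sm) `^ p1 <=
    \sum_j kap `^ p1 * 3 `^ p1 * (3 + `|x j| `^ qb).
Proof.
move=> sm0 kap1 nk /andP[p10 pq] n0.
have p1' := ltW p10.
have kap0 : 0 <= kap by lra.
have [j hj] : exists j, forall j', `|x j'| <= `|x j|.
  case: (@arg_maxP _ _ _ (Ordinal n0) xpredT (fun j => `|x j|)) => // j _ hj.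
  by exists j => j'; exact: hj.
have h1 : 1 + \sum_j `|x j| / sm <= kap * (1 + `|x j|).
  have : \sum_j `|x j| / sm <= \sum_(j' < n) `|x j| / sm.
    by apply: ler_sum => j' _; rewrite ler_wpM2r// invr_ge0 ltW.
  rewrite sumr_const card_ord -[_ *+ n]mulr_natl.
  have -> : n%:R * (`|x j| / sm) = (n%:R / sm) * `|x j| by ring.
  by have := ler_wpM2r (normr_ge0 (x j)) nk; lra.
have term0 j' : 0 <= kap `^ p1 * 3 `^ p1 * (3 + `|x j'| `^ qb).
  by rewrite !mulr_ge0 ?powR_ge0// addr_ge0// powR_ge0.
apply: (@le_trans _ _ (kap `^ p1 * 3 `^ p1 * (3 + `|x j| `^ qb))); last first.
  by rewrite (bigD1 j)//= lerDl sumr_ge0.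
apply: le_trans (powR_le p1' _ h1) _.
  by rewrite addr_ge0// sumr_ge0// => j' _; rewrite divr_ge0// ltW.
rewrite powRM ?addr_ge0// -mulrA ler_wpM2l ?powR_ge0//.
have := powR_sum3 (normr_ge0 (x j)) (lexx 0) p1'; rewrite addr0 => h2.
apply: le_trans h2 _; rewrite ler_wpM2l ?powR_ge0//.
have := powR_le_1D p1' pq (normr_ge0 (x j)).
have := @powR_le1 R 0 p1 _ p1'; rewrite lexx ler01 => /(_ isT); lra.
Qed.

End row_sums.

Section net_approximation.
Context d (T : measurableType d) (R : realType) (P : probability T R) (m n : nat).
Variables (A0 : 'I_m -> 'I_n -> {RV P >-> R}).
Variables (psi phi phi1 : 'I_m -> R -> R) (f : 'cV[R]_n -> R) (S : set 'cV[R]_n).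
Variables (Li : 'I_m -> R) (D L q0 q1 q2 q3 Mrho osc_f delta beta M K kap : R).
Variables (g g1 : R -> R) (N : finType) (c0 : N) (v : N -> 'cV[R]_n).
Hypotheses (m_gt0 : (0 < m)%N) (n_gt0 : (0 < n)%N).
Hypotheses (D1 : 1 <= D) (Li1 : forall i, 1 <= Li i) (L1 : 1 <= L).
Hypotheses (q00 : 0 <= q0) (q10 : 0 <= q1).
Hypotheses (delta0 : 0 <= delta) (beta0 : 0 < beta) (kap1 : 1 <= kap).
Hypothesis n_kap : n%:R / Num.sqrt m%:R <= kap.
Hypothesis SL : S `<=` cube L.
Hypothesis phi_psi : forall i x, `|psi i x - phi i x| <= Mrho.
Hypothesis dphi : forall i (z : R), is_derive z (1 : R) (phi i) (phi1 i z).
Hypothesis phi_ge0 : forall i z, 0 <= phi i z.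
Hypothesis phi1_le : forall i z, `|phi1 i z| <= D * (1 + phi i z `^ q1).
Hypothesis phi_growth : forall i z, phi i z <= 1 + Li i * (1 + `|z| `^ q0).
Hypothesis f_osc : forall w w', cube L w -> cube L w' ->
  (forall i, `|w i 0 - w' i 0| <= delta) -> `|f w - f w'| <= osc_f.
Hypothesis Sv : forall c, S (v c).
Hypothesis v_net : forall w, S w -> exists c, forall i, `|w i 0 - v c i 0| <= delta.
Hypothesis dg : forall a : R, is_derive a (1 : R) g (g1 a).
Hypothesis gK0 : forall x, `|g x| <= K.
Hypothesis gK1 : forall x, `|g1 x| <= K.
Hypothesis A0M : forall i j,
  (\int[P]_t (`|A0 i j t| `^ qbar q0 q1 q2 q3)%:E <= M%:E)%E.

Let sm : R := Num.sqrt m%:R.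
Let qb := qbar q0 q1 q2 q3.
Let p1 := q0 * q1 + 1.
Notation I := ('I_m * 'I_n)%type.

Let sm0 : 0 < sm. Proof. by rewrite sqrtr_gt0 ltr0n. Qed.
Let K0 : 0 <= K. Proof. exact: le_trans (gK0 0). Qed.
Let mm0 : 0 < m%:R :> R. Proof. by rewrite ltr0n. Qed.

Definition entry_vector (t : T) : coords R I := fun k => A0 k.1 k.2 t.

Lemma measurable_entry_vector : measurable_fun setT entry_vector.
Proof. by apply: measurable_to_coords => k; exact: measurable_funP. Qed.

Let en := net_energy (fun c j => v c j 0) (fun c => f (v c)) phi.

Let RR (i : 'I_m) (t : T) : R := \sum_j `|A0 i j t| / sm.

Let RR0 i t : 0 <= RR i t.
Proof. by apply: sumr_ge0 => j _; rewrite divr_ge0// ltW. Qed.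

Let lin (w : 'cV[R]_n) i t := (scaled_matrix A0 t *m w) i 0.

Let linE w i t : lin w i t = \sum_j A0 i j t / sm * w j 0.
Proof. by rewrite /lin mxE; apply: eq_bigr => j _; rewrite mxE. Qed.

Let lin_le (w : 'I_n -> R) (B : R) i t : (forall j, `|w j| <= B) ->
  `|\sum_j A0 i j t / sm * w j| <= B * RR i t.
Proof.
move=> wB; apply: le_trans (ler_norm_sum _ _ _) _.
rewrite mulr_sumr; apply: ler_sum => j _.
rewrite normrM normrM normfV (gtr0_norm sm0) mulrC ler_wpM2r//.
by rewrite divr_ge0// ltW.
Qed.

Let cube_le (w : 'cV[R]_n) j : cube L w -> `|w j 0| <= L.
Proof. by move=> /(_ j); rewrite ler_norml. Qed.

Let row_err i t : R :=
  delta * (D * (2 * 4 `^ q1) * Li i `^ q1 * L `^ (q0 * q1) * (1 + RR i t) `^ p1).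

Let D0 : 0 <= D. Proof. exact: le_trans D1. Qed.

Let eta t : R := Mrho + osc_f + \sum_i m%:R^-1 * row_err i t.

Let cost_close t w c : S w -> (forall i, `|w i 0 - v c i 0| <= delta) ->
  `|cost psi f w (scaled_matrix A0 t) - en (entry_vector t) c| <= eta t.
Proof.
move=> Sw wc.
have Lw := SL Sw; have Lv := SL (Sv c).
have term i : `|psi i (lin w i t) - phi i (lin (v c) i t)| <= Mrho + row_err i t.
  rewrite (_ : _ - _ = (psi i (lin w i t) - phi i (lin w i t)) +
    (phi i (lin w i t) - phi i (lin (v c) i t))); last by ring.
  apply: le_trans (ler_normD _ _) _; apply: lerD => //.
  apply: (@smooth_loss_increment _ _ (phi1 i)) => //.
  - by rewrite linE; apply: lin_le => j; exact: cube_le.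
  - by rewrite linE; apply: lin_le => j; exact: cube_le.
  - rewrite !linE -sumrB (eq_bigr (fun j => A0 i j t / sm * (w j 0 - v c j 0))).
      exact: (@lin_le (fun j => w j 0 - v c j 0) delta i t wc).
    by move=> j _; rewrite mulrBr.
rewrite (_ : cost _ _ _ _ - _ = \sum_i m%:R^-1 * (psi i (lin w i t) - phi i (lin (v c) i t)) +
  (f w - f (v c))); last first.
  rewrite /cost /en /net_energy -mulr_sumr sumrB.
  rewrite [X in _ - (_ * X + _)](eq_bigr (fun i => phi i (lin (v c) i t))); last first.
    by move=> i _; rewrite linE.
  by rewrite -/(lin w); ring.
apply: le_trans (ler_normD _ _) _.
have h1 := f_osc Lw Lv wc.
have h2 : `|\sum_i m%:R^-1 * (psi i (lin w i t) - phi i (lin (v c) i t))| <=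
    Mrho + \sum_i m%:R^-1 * row_err i t.
  apply: le_trans (ler_norm_sum _ _ _) _.
  rewrite (_ : Mrho = \sum_(i < m) m%:R^-1 * Mrho); last first.
    by rewrite sumr_const card_ord -[RHS]mulr_natl mulrA divff ?gt_eqF// mul1r.
  rewrite -big_split/=; apply: ler_sum => i _.
  by rewrite normrM normfV (gtr0_norm mm0) -mulrDr ler_wpM2l// invr_ge0 ltW.
by rewrite /eta; lra.
Qed.

Let lipschitz x y : `|g x - g y| <= K * `|x - y|.
Proof.
wlog xy : x y / x <= y.
  by move=> H; have [/H//|/ltW/H] := leP x y; rewrite distrC [`|y - x|]distrC.
have cg : {within `[x, y], continuous g}.
  by apply: continuous_subspaceT; exact: is_derive_continuous dg.
have [z _ hz] := MVT_segment xy (fun z _ => dg z) cg.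
by rewrite distrC hz normrM [`|y - x|]distrC ler_wpM2r.
Qed.

Let noise : R := m%:R^-1 * \sum_i Li i `^ q1.

Definition net_error : R := delta * (D * (2 * 4 `^ q1)) * noise * L `^ (q0 * q1) *
  (n%:R * (kap `^ p1 * 3 `^ p1 * (3 + M))).

Let mRR i : measurable_fun setT (fun t => (1 + RR i t) `^ p1).
Proof.
apply: (measurableT_comp (measurable_powR p1)); apply: measurable_funD => //.
apply: measurable_sum => j; apply: measurable_funM => //.
exact: measurableT_comp.
Qed.

Let p1qb : 0 < p1 <= qb.
Proof.
have q1q : 3 * q1 <= qq q1 q2 q3 by rewrite /qq !le_max lexx !orbT.
have h := mulr_ge0 q00 q10; have h' := ler_wpM2l q00 q1q.
by rewrite /p1 /qb /qbar; apply/andP; split; lra.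
Qed.

Let integral_RR i :
  (\int[P]_t ((1 + RR i t) `^ p1)%:E <= (n%:R * (kap `^ p1 * 3 `^ p1 * (3 + M)))%:E)%E.
Proof.
have k3 : 0 <= kap `^ p1 * 3 `^ p1 by rewrite mulr_ge0 ?powR_ge0.
have mA j : measurable_fun setT (fun t => `|A0 i j t| `^ qb).
  by apply: (measurableT_comp (measurable_powR qb)); exact: measurableT_comp.
have mA3 j : measurable_fun setT (fun t => 3 + `|A0 i j t| `^ qb).
  exact: measurable_funD.
apply: (@le_trans _ _ (\int[P]_t (\sum_j (kap `^ p1 * 3 `^ p1)%:E * (3 + `|A0 i j t| `^ qb)%:E))%E).
  apply: le_lower_integral => t; first by rewrite lee_fin powR_ge0.
  under eq_bigr do rewrite -EFinM.
  by rewrite sumEFin lee_fin; exact: row_sum_pow_le.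
rewrite ge0_integral_sum//; last 2 first.
- by move=> j; apply: measurable_funeM; exact/measurable_EFinP.
- by move=> j t _; rewrite -EFinM lee_fin mulr_ge0// addr_ge0// powR_ge0.
apply: (@le_trans _ _ (\sum_(j < n) (kap `^ p1 * 3 `^ p1 * (3 + M))%:E)%E).
  apply: lee_sum => j _; rewrite ge0_integralZl; [|exact: measurableT|exact/measurable_EFinP| |]; last 2 first.
  - by move=> t _; rewrite lee_fin addr_ge0// powR_ge0.
  - by rewrite lee_fin.
  rewrite [leRHS]EFinM; apply: lee_wpmul2l; first by rewrite lee_fin.
  under eq_integral do rewrite EFinD.
  rewrite ge0_integralD//; last exact/measurable_EFinP.
  by rewrite integral_prob_cst [leRHS]EFinD; apply: leeD2l.
by rewrite sumEFin sumr_const card_ord lee_fin mulr_natl.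
Qed.

(** The minimum and the soft-minimum are compared outcome by outcome, with an error that is random
    through the row sums; this error is measurable and only its mean enters. The factor 2 is that of
    [integral_approx]. *)
Lemma expectation_min_cost_approx :
  (`| 'E_P[fun t => g (min_cost psi f S (scaled_matrix A0 t))] -
      \int[P]_t (g (softmin beta (en (entry_vector t))))%:E | <=
   (2 * (K * (Mrho + osc_f + ln (#|N|%:R) / beta + net_error)))%:E)%E.
Proof.
rewrite unlock.
pose cst := K * (Mrho + osc_f + ln (#|N|%:R) / beta).
pose ci i := K * (m%:R^-1 * (delta * (D * (2 * 4 `^ q1) * Li i `^ q1 * L `^ (q0 * q1)))).
have ci0 i : 0 <= ci i.
  by rewrite /ci; do ![apply: mulr_ge0 => //]; rewrite ?powR_ge0.
pose e t := cst + \sum_i ci i * (1 + RR i t) `^ p1.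
have lnN : 0 <= ln (#|N|%:R : R) / beta.
  apply: divr_ge0; last exact: ltW.
  by rewrite ln_ge0// ler1n; apply/card_gt0P; exists c0.
have cst0 : 0 <= cst.
  rewrite /cst mulr_ge0// !addr_ge0//.
    exact: le_trans (phi_psi (Ordinal m_gt0) 0).
  apply: le_trans (f_osc (SL (Sv c0)) (SL (Sv c0)) _) => // i.
  by rewrite subrr normr0.
have me : measurable_fun setT e.
  apply: measurable_funD => //; apply: measurable_sum => i.
  exact: measurable_funM.
have mh' : measurable_fun setT (fun t => g (softmin beta (en (entry_vector t)))).
  have h := measurable_softmin_energy (fun c j => v c j 0) (fun c => f (v c))
    (beta / m%:R) dphi dg.
  rewrite divfK ?gt_eqF// in h.
  exact: measurableT_comp h measurable_entry_vector.
apply: le_trans (integral_approx (K := K) P mh' me _ _) _ => //.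
  move=> t.
  apply: le_trans (lipschitz _ _) _.
  rewrite (_ : e t = K * (eta t + ln (#|N|%:R) / beta)); last first.
    rewrite /e [X in cst + X](_ : _ = K * \sum_i m%:R^-1 * row_err i t).
      by rewrite /cst /eta; ring.
    by rewrite mulr_sumr; apply: eq_bigr => i _; rewrite /ci /row_err; ring.
  rewrite ler_wpM2l//; apply: (@inf_softmin_dist R _ N beta (eta t) c0 S v
    (fun w => cost psi f w (scaled_matrix A0 t)) (en (entry_vector t))) => //.
  - by move=> c; apply: cost_close => // i; rewrite subrr normr0.
  - by move=> w Sw; have [c hc] := v_net Sw; exists c; exact: cost_close.
rewrite [leRHS]EFinM; apply: lee_wpmul2l => //.
under eq_integral do rewrite EFinD -sumEFin.
rewrite ge0_integralD; [|exact: measurableT|by []|by []| |]; last 2 first.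
- by move=> t _; apply: sume_ge0 => i _; rewrite lee_fin mulr_ge0 ?powR_ge0.
- by apply: emeasurable_sum => i; apply/measurable_EFinP; exact: measurable_funM.
rewrite integral_prob_cst mulrDr [leRHS]EFinD; apply: leeD2l.
rewrite ge0_integral_sum//; last 2 first.
- by move=> i; apply/measurable_EFinP; exact: measurable_funM.
- by move=> i t _; rewrite lee_fin mulr_ge0 ?powR_ge0.
apply: (@le_trans _ _ (\sum_i (ci i * (n%:R * (kap `^ p1 * 3 `^ p1 * (3 + M))))%:E)%E).
  apply: lee_sum => i _; under eq_integral do rewrite EFinM.
  rewrite ge0_integralZl; [|exact: measurableT|exact/measurable_EFinP| |]; last 2 first.
  - by move=> t _; rewrite lee_fin powR_ge0.
  - by rewrite lee_fin.
  by rewrite [leRHS]EFinM; apply: lee_wpmul2l => //; rewrite lee_fin.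
rewrite sumEFin lee_fin -mulr_suml /net_error /noise /ci.
rewrite (eq_bigr (fun i => (K * (m%:R^-1 * (delta * (D * (2 * 4 `^ q1) * L `^ (q0 * q1))))) * Li i `^ q1)); last first.
  by move=> i _; ring.
by rewrite -mulr_sumr le_eqVlt; apply/orP; left; apply/eqP; ring.
Qed.

End net_approximation.

(** * Optimisation of the parameters *)

Section rates.
Context {R : realType}.
Implicit Types x y : R.

Lemma powR_third_cube x : 0 <= x -> (x `^ (1 / 3)) ^+ 3 = x.
Proof.
move=> x0; rewrite -powR_mulrn ?powR_ge0// -powRrM mul1r mulVf ?powRr1//.
Qed.

(* AM-GM: 3 y t^2 <= y^3 + 2 t^3 with t the cube root of the mean of the y^3 *)
Lemma mean_le_cubic_mean (m : nat) (y : 'I_m -> R) : (0 < m)%N ->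
  (forall i, 0 < y i) ->
  m%:R^-1 * \sum_i y i <= (m%:R^-1 * \sum_i y i ^+ 3) `^ (1 / 3).
Proof.
move=> m0 y0; set X := m%:R^-1 * \sum_i y i ^+ 3.
have mm0 : 0 < m%:R :> R by rewrite ltr0n.
have X0 : 0 < X.
  rewrite mulr_gt0 ?invr_gt0// (bigD1 (Ordinal m0))//=.
  by rewrite ltr_wpDr ?exprn_gt0// sumr_ge0// => i _; rewrite exprn_ge0// ltW.
set t := X `^ (1 / 3); have t0 : 0 < t by exact: powR_gt0.
have t3 : t ^+ 3 = X by exact/powR_third_cube/ltW.
have key i : 3 * t ^+ 2 * y i <= y i ^+ 3 + 2 * t ^+ 3.
  rewrite -subr_ge0 (_ : _ - _ = (y i - t) ^+ 2 * (y i + 2 * t)); last by ring.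
  by rewrite mulr_ge0 ?sqr_ge0//; have := y0 i; lra.
have : 3 * t ^+ 2 * (m%:R^-1 * \sum_i y i) <= 3 * t ^+ 2 * t.
  rewrite [leLHS](_ : _ = m%:R^-1 * \sum_i 3 * t ^+ 2 * y i); last first.
    by rewrite mulrCA; congr (_ * _); rewrite mulr_sumr.
  apply: (@le_trans _ _ (m%:R^-1 * \sum_(i < m) (y i ^+ 3 + 2 * t ^+ 3))).
    by rewrite ler_wpM2l ?invr_ge0 ?ler0n//; apply: ler_sum => i _; exact: key.
  rewrite big_split/= mulrDr -/X -t3 sumr_const card_ord -[(2 * t ^+ 3) *+ m]mulr_natl [m%:R^-1 * (_ * _)]mulrA mulVf ?gt_eqF//.
  rewrite mul1r le_eqVlt; apply/orP; left; apply/eqP; ring.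
by rewrite ler_pM2l// mulr_gt0// exprn_gt0.
Qed.

Variables (m n : nat) (tau L q0 q1 q2 q3 ell : R) (Li : 'I_m -> R).
Hypotheses (m0 : (0 < m)%N) (n0 : (0 < n)%N) (tau01 : 0 < tau < 1).
Hypotheses (taumn : tau <= m%:R / n%:R) (L1 : 1 <= L) (ell1 : 1 <= ell).
Hypothesis q00 : 0 <= q0.
Hypothesis Li1 : forall i, 1 <= Li i.

Let q := qq q1 q2 q3.
Let qb := qbar q0 q1 q2 q3.
Let X := m%:R^-1 * \sum_i Li i `^ q.

(** The second summand in [delta_inf], with [ell] in place of [logplus (L / delta)]. *)
Definition rate : R := X `^ (1 / 3) * (L `^ (qb / 3) * ell `^ (2 / 3) / n%:R `^ (1 / 6)).

Let n1 : 1 <= n%:R :> R. Proof. by rewrite ler1n. Qed.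
Let nn0 : 0 < n%:R :> R. Proof. by rewrite ltr0n. Qed.
Let mm0 : 0 < m%:R :> R. Proof. by rewrite ltr0n. Qed.
Let tau0 : 0 < tau. Proof. by case/andP: tau01. Qed.
Let q1q : 3 * q1 <= q. Proof. by rewrite /q /qq !le_max lexx !orbT. Qed.

Let L0 : 0 < L. Proof. exact: lt_le_trans L1. Qed.
Let ell0 : 0 < ell. Proof. exact: lt_le_trans ell1. Qed.

Let X0 : 0 < X.
Proof.
rewrite mulr_gt0 ?invr_gt0// (bigD1 (Ordinal m0))//=.
rewrite ltr_wpDr ?powR_gt0//; last exact: lt_le_trans (Li1 _).
by rewrite sumr_ge0// => i _; exact: powR_ge0.
Qed.

Lemma rate_gt0 : 0 < rate.
Proof.
have nz := lt0r_neq0 nn0.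
by rewrite mulr_gt0 ?powR_gt0// divr_gt0 ?powR_gt0// mulr_gt0 ?powR_gt0.
Qed.

Lemma rate_cube : rate ^+ 3 = X * L `^ qb * ell ^+ 2 / Num.sqrt n%:R.
Proof.
rewrite /rate exprMn powR_third_cube ?(ltW X0)// expr_div_n exprMn.
rewrite -!(powR_mulrn 3) ?powR_ge0// -!powRrM.
rewrite divfK// divfK// -[ell ^+ 2]powR_mulrn ?(ltW ell0)//.
rewrite (_ : 1 / 6 * 3%:R = 2^-1); last by field.
by rewrite powR12_sqrt ?(ltW nn0)// !mulrA.
Qed.

(** The net error carries the mean of the powers [q1] of [Li]. Since [3 * q1 <= q] and [Li i >= 1],
    it is at most the cubic mean of the powers [q / 3]; the other factors are compared using that L,
    ell and n are at least 1. *)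
Lemma mean_low_power_le_rate :
  m%:R^-1 * (\sum_i Li i `^ q1) * L `^ (q0 * q1) / Num.sqrt n%:R <= rate.
Proof.
rewrite /rate -!mulrA [leLHS]mulrA; apply: ler_pM.
- by rewrite mulr_ge0 ?invr_ge0 ?ler0n// sumr_ge0// => i _; exact: powR_ge0.
- by rewrite mulr_ge0 ?powR_ge0// invr_ge0 sqrtr_ge0.
- have := @mean_le_cubic_mean m (fun i => Li i `^ (q / 3)) m0 _.
  rewrite (eq_bigr (fun i => Li i `^ q) (F1 := fun i => (Li i `^ (q / 3)) ^+ 3)).
    move=> h; apply: le_trans (h _); last by move=> i; rewrite powR_gt0// (lt_le_trans _ (Li1 i)).
    rewrite ler_wpM2l ?invr_ge0 ?ler0n//; apply: ler_sum => i _.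
    by apply: ler_powR => //; have := q1q; lra.
  by move=> i _; rewrite -powR_mulrn ?powR_ge0// -powRrM divfK.
apply: ler_pM.
- exact: powR_ge0.
- by rewrite invr_ge0 sqrtr_ge0.
- apply: ler_powR => //; rewrite /qb /qbar -/q.
  by have := q1q; move=> /(ler_wpM2l q00); lra.
rewrite -[leLHS]mul1r; apply: ler_pM => //.
  by apply: powR_ge1.
rewrite lef_pV2 ?posrE ?sqrtr_gt0 ?powR_gt0// -powR12_sqrt ?(ltW nn0)//.
by apply: ler_powR => //; lra.
Qed.

(** A bound for n / sqrt m that involves n and tau only, by n / m <= 1 / tau. *)
Let kap : R := (n%:R / tau) `^ 2^-1.

Let ntau0 : 0 < n%:R / tau. Proof. by rewrite divr_gt0. Qed.

Lemma kap_ge1 : 1 <= kap.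
Proof.
apply: powR_ge1; last by rewrite invr_ge0.
by rewrite ler_pdivlMr// mul1r; case/andP: tau01 => _ /ltW t1; exact: le_trans n1.
Qed.

Let nm_tau : n%:R / m%:R <= tau^-1.
Proof.
rewrite -[leLHS]invrK invf_div lef_pV2// posrE// divr_gt0//.
Qed.

Lemma sqrt_m_kap : n%:R / Num.sqrt m%:R <= kap.
Proof.
rewrite /kap powR12_sqrt ?(ltW ntau0)//.
rewrite -[leLHS](@ger0_norm R) ?divr_ge0 ?sqrtr_ge0 ?ler0n// -sqrtr_sqr ler_sqrt ?(ltW ntau0)//.
rewrite expr_div_n sqr_sqrtr ?ler0n// expr2 -mulrA ler_wpM2l ?ler0n//.
Qed.

(** The origin of [omega]: the net error grows like n times the power (q0 q1 + 1) / 2 of n, and the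
    exponent - (q0 q1 + 4) / 2 brings this down to - 1/2. *)
Lemma delta_kap (delta : R) : delta < omega n q0 q1 ->
  delta * (n%:R * kap `^ (q0 * q1 + 1)) <= (tau^-1) `^ ((q0 * q1 + 1) / 2) / Num.sqrt n%:R.
Proof.
move=> dom.
have w0 : 0 <= n%:R * kap `^ (q0 * q1 + 1) by rewrite mulr_ge0 ?powR_ge0.
apply: le_trans (ler_wpM2r w0 (ltW dom)) _.
have ti0 : 0 <= tau^-1 by rewrite invr_ge0 ltW.
have -> : kap `^ (q0 * q1 + 1) = n%:R `^ ((q0 * q1 + 1) / 2) * (tau^-1) `^ ((q0 * q1 + 1) / 2).
  by rewrite /kap -powRrM [2^-1 * _]mulrC powRM// ltW.
have nz : n%:R != 0 :> R by rewrite gt_eqF.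
have -> : (Num.sqrt n%:R)^-1 = n%:R `^ (- 2^-1) :> R by rewrite powRN powR12_sqrt ?ltW.
rewrite /omega; set w := n%:R `^ _; set u := n%:R `^ _; set t := _ `^ _.
rewrite (_ : w * _ = t * (w * n%:R `^ 1 * u)); last by rewrite powRr1 ?ltW//; ring.
rewrite /w /u -!powRD ?nz ?implybT// le_eqVlt; apply/orP; left; apply/eqP.
by congr (_ * _ `^ _); field.
Qed.

(** By [rate_cube], the choice b = ell / rate turns X L^qb b^2 into rate times sqrt n; the ratios n
    / m are then absorbed by tau. *)
Lemma swap_rate (b : R) : b * rate = ell ->
  n%:R / (m%:R * Num.sqrt m%:R) * X * (L ^+ 3 * L `^ (q0 * q)) * b ^+ 2 <=
    tau^-1 * Num.sqrt tau^-1 * rate.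
Proof.
move=> be; have r0 := rate_gt0.
have sm0 : 0 < Num.sqrt m%:R :> R by rewrite sqrtr_gt0.
have sn0 : 0 < Num.sqrt n%:R :> R by rewrite sqrtr_gt0.
have -> : L ^+ 3 * L `^ (q0 * q) = L `^ qb.
  rewrite -powR_mulrn ?(ltW L0)// -powRD; last by rewrite (gt_eqF L0) implybT.
  by rewrite addrC.
have rE : X * L `^ qb * b ^+ 2 = rate * Num.sqrt n%:R.
  apply: (mulfI (x := rate ^+ 2)); first by rewrite expf_neq0// gt_eqF.
  transitivity (X * L `^ qb * (b * rate) ^+ 2); first by ring.
  rewrite be; transitivity (rate ^+ 3 * Num.sqrt n%:R); last by ring.
  by rewrite rate_cube divfK ?gt_eqF.
rewrite (_ : _ * b ^+ 2 = n%:R / (m%:R * Num.sqrt m%:R) * (X * L `^ qb * b ^+ 2)); last by ring.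
rewrite rE (_ : _ * (_ * _) = (n%:R / m%:R) * (Num.sqrt n%:R / Num.sqrt m%:R) * rate); last first.
  by field; rewrite !gt_eqF.
rewrite ler_wpM2r ?(ltW r0)//.
have e : Num.sqrt n%:R / Num.sqrt m%:R = Num.sqrt (n%:R / m%:R) :> R.
  by rewrite sqrtrM ?ler0n// sqrtrV// ler0n.
apply: ler_pM; rewrite ?divr_ge0 ?sqrtr_ge0 ?ler0n//.
by rewrite e ler_wsqrtr.
Qed.

End rates.

(** * Universality at fixed values of the two scales *)

Section core_inequality.
Context {R : realType}.

Lemma law_entry_vector d (T : measurableType d) (P : probability T R) (m n : nat)
    (A0 : 'I_m -> 'I_n -> {RV P >-> R}) : independent_entries A0 ->
  exists pi : probability (coords R ('I_m * 'I_n)%type) R,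
    product_law pi (fun k => distribution P (A0 k.1 k.2)) /\
    forall h : coords R ('I_m * 'I_n)%type -> \bar R, measurable_fun setT h ->
      (forall a, 0 <= h a)%E ->
      (\int[pi]_a h a = \int[P]_t h (entry_vector A0 t))%E.
Proof.
move=> ind.
pose V0 : T -> coords R ('I_m * 'I_n)%type := entry_vector A0.
pose mV := isMeasurableFun.Build _ _ _ _ V0 (measurable_entry_vector A0).
pose V : {mfun T >-> coords R ('I_m * 'I_n)%type} := HB.pack V0 mV.
exists (distribution P V); split; last first.
  by move=> h mh h0; rewrite ge0_integral_distribution.
move=> B mB; have := ind (finset.setTfor _) B mB => /= H.
transitivity (P (\bigcap_(i in [set` finset.setTfor ('I_m * 'I_n)%type])
    (fun t => A0 i.1 i.2 t) @^-1` B i)).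
  congr (P _); apply/seteqP; split => [t ht i _|t ht i]; first exact: ht.
  by apply: ht; rewrite /= finset.in_setT.
rewrite H; apply: eq_big => // i; rewrite finset.in_setT //.
Qed.

Lemma fin_num_of_dist (x y : \bar R) (r : R) : y \is a fin_num ->
  (`| x - y | <= r%:E)%E -> x \is a fin_num.
Proof. by case: x => //; case: y. Qed.

Lemma abse_dist_fine (x y : \bar R) (r : R) :
  x \is a fin_num -> y \is a fin_num ->
  (`| x - y | <= r%:E)%E = (`|fine x - fine y| <= r).
Proof. by case: x => // x; case: y => // y _ _; rewrite -EFinB lee_fin. Qed.

Lemma sube_shift (x y : \bar R) (r : R) : x \is a fin_num -> y \is a fin_num ->
  (x + r%:E - (y + r%:E) = x - y)%E.
Proof.
case: x => // x; case: y => // y _ _; rewrite -!EFinD -?EFinB.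
by congr EFin; ring.
Qed.

Variables (tau q0 q1 q2 q3 M : R).
Let q := qq q1 q2 q3.
Let qb := qbar q0 q1 q2 q3.

(** Twice this integer lies between q0 q and q0 q + 2: large enough to dominate the power q0 q, and
    small enough for the moments of order qbar = q0 q + 3. *)
Definition moment_order : nat := (Num.truncn (q0 * q / 2)).+1.

Definition swap_const : R := 2 * entry_const q0 q1 q2 q3 * (1 + M) *
  (3 + moment_const (1 + M) moment_order * (tau^-1) ^+ moment_order) *
  (tau^-1 * Num.sqrt tau^-1).

Definition net_const : R := 2 * 4 `^ q1 * 3 `^ (q0 * q1 + 1) * (3 + M) *
  (tau^-1) `^ ((q0 * q1 + 1) / 2).

(** 4 = 2 * 2 counts the two matrices and the factor 2 of [integral_approx]; 12 = 4 * 3, with the 3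
    coming from the entropy of the net. The summand 4 also covers the trivial bound used when the
    rate exceeds 1. *)
Definition univ_const : R := 4 + 4 * net_const + 12 * tau^-1 + swap_const.

Hypotheses (tau01 : 0 < tau < 1).
Hypotheses (q00 : 0 <= q0) (q10 : 0 <= q1) (q20 : 0 <= q2) (q30 : 0 <= q3).
Hypothesis M0 : 0 <= M.

Let tau0 : 0 < tau. Proof. by case/andP: tau01. Qed.
Let q_ge0 : 0 <= q. Proof. by rewrite /q /qq !le_max q30. Qed.

Lemma moment_order_bounds :
  q0 * q <= moment_order.*2%:R /\ moment_order.*2%:R <= q0 * q + 2.
Proof.
have h0 : 0 <= q0 * q / 2 by rewrite divr_ge0// mulr_ge0.
have /andP[h1 h2] := truncn_itv h0.
rewrite /moment_order; set k := Num.truncn _ in h1 h2 *.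
have -> : (k.+1).*2%:R = 2 * (k%:R + 1) :> R by rewrite -mul2n natrM natr1.
have kE : k.+1%:R = k%:R + 1 :> R by rewrite natr1.
by rewrite kE in h2; split; lra.
Qed.

Lemma entry_const_ge0 : 0 <= entry_const q0 q1 q2 q3.
Proof. by rewrite /entry_const !mulr_ge0 ?powR_ge0. Qed.

Lemma swap_const_ge0 : 0 <= swap_const.
Proof.
have ti : 0 <= tau^-1 by rewrite invr_ge0 ltW.
have M1 : 0 <= 1 + M by rewrite addr_ge0.
apply: mulr_ge0; last by rewrite mulr_ge0 ?sqrtr_ge0.
apply: mulr_ge0.
  by apply: mulr_ge0 => //; apply: mulr_ge0 => //; exact: entry_const_ge0.
by rewrite addr_ge0// mulr_ge0 ?exprn_ge0//; exact: moment_const_ge0.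
Qed.

Lemma net_const_ge0 : 0 <= net_const.
Proof.
rewrite /net_const; apply: mulr_ge0; last exact: powR_ge0.
by apply: mulr_ge0; rewrite ?addr_ge0// !mulr_ge0 ?powR_ge0.
Qed.

Lemma univ_const_gt0 : 0 < univ_const.
Proof.
have ti : 0 <= tau^-1 by rewrite invr_ge0 ltW.
by have := net_const_ge0; have := swap_const_ge0; rewrite /univ_const; lra.
Qed.

Variables (m n : nat).
Hypotheses (m_gt0 : (0 < m)%N) (n_gt0 : (0 < n)%N).
Hypothesis taumn : tau <= m%:R / n%:R.
Variables (Li : 'I_m -> R) (psi phi phi1 phi2 phi3 : 'I_m -> R -> R).
Variables (f : 'cV[R]_n -> R) (Mrho D L delta osc_f K : R) (S : set 'cV[R]_n).
Variables (g g1 g2 g3 : R -> R).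
Hypotheses (D1 : 1 <= D) (Li1 : forall i, 1 <= Li i) (L1 : 1 <= L).
Hypothesis SL : S `<=` cube L.
Hypothesis phi_psi : forall i x, `|psi i x - phi i x| <= Mrho.
Hypothesis dphi : forall i (z : R), is_derive z (1 : R) (phi i) (phi1 i z).
Hypothesis dphi1 : forall i (z : R), is_derive z (1 : R) (phi1 i) (phi2 i z).
Hypothesis dphi2 : forall i (z : R), is_derive z (1 : R) (phi2 i) (phi3 i z).
Hypothesis phi_ge0 : forall i z, 0 <= phi i z.
Hypothesis phi1_le : forall i z, `|phi1 i z| <= D * (1 + phi i z `^ q1).
Hypothesis phi2_le : forall i z, `|phi2 i z| <= D * (1 + phi i z `^ q2).
Hypothesis phi3_le : forall i z, `|phi3 i z| <= D * (1 + phi i z `^ q3).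
Hypothesis phi_growth : forall i z, phi i z <= 1 + Li i * (1 + `|z| `^ q0).
Hypothesis f_osc : forall w w', cube L w -> cube L w' ->
  (forall i, `|w i 0 - w' i 0| <= delta) -> `|f w - f w'| <= osc_f.
Hypothesis delta_bounds : 0 < delta < omega n q0 q1.
Hypothesis dg : forall a : R, is_derive a (1 : R) g (g1 a).
Hypothesis dg1 : forall a : R, is_derive a (1 : R) g1 (g2 a).
Hypothesis dg2 : forall a : R, is_derive a (1 : R) g2 (g3 a).
Hypothesis gK0 : forall x, `|g x| <= K.
Hypothesis gK1 : forall x, `|g1 x| <= K.
Hypothesis gK2 : forall x, `|g2 x| <= K.
Hypothesis gK3 : forall x, `|g3 x| <= K.

Context d (T : measurableType d) (P : probability T R).
Variables (A0 B0 : 'I_m -> 'I_n -> {RV P >-> R}).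
Hypotheses (indA : independent_entries A0) (indB : independent_entries B0).
Hypothesis meanA : forall i j, ('E_P[A0 i j] = 0)%E.
Hypothesis meanB : forall i j, ('E_P[B0 i j] = 0)%E.
Hypothesis varAB : forall i j, ('E_P[fun t => (A0 i j t ^+ 2)%R] =
  'E_P[fun t => (B0 i j t ^+ 2)%R])%E.
Hypothesis momA : forall i j, (\int[P]_t (`|A0 i j t| `^ qb)%:E <= M%:E)%E.
Hypothesis momB : forall i j, (\int[P]_t (`|B0 i j t| `^ qb)%:E <= M%:E)%E.

Let ell := logplus (L / delta).
Let e := rate n L q0 q1 q2 q3 ell Li.
Let mean_cost (A : 'I_m -> 'I_n -> {RV P >-> R}) : \bar R :=
  ('E_P[fun t => g (min_cost psi f S (scaled_matrix A t))])%E.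

Let K0 : 0 <= K. Proof. exact: le_trans (gK0 0). Qed.
Let e0 : 0 < e.
Proof. by apply: rate_gt0 => //; exact: logplus_ge1. Qed.
Let D3 : 1 <= D ^+ 3. Proof. exact: exprn_ege1. Qed.
Let Mrho0 : 0 <= Mrho. Proof. exact: le_trans (phi_psi (Ordinal m_gt0) 0). Qed.

(** The integrand may fail to be measurable, so it is compared with 0 through [integral_approx],
    hence [2 * K] and not [K]. *)
Let mean_cost_le (A : 'I_m -> 'I_n -> {RV P >-> R}) : (`|mean_cost A| <= (2 * K)%:E)%E.
Proof.
have := @integral_approx _ T R P 0
  (fun t => g (min_cost psi f S (scaled_matrix A t))) (fun=> 0) (fun=> K).
rewrite /mean_cost unlock !integral_prob_cst sube0 EFinM; apply => //.
- by move=> _; rewrite normr0.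
- by move=> t; rewrite subr0.
Qed.

Let gK x : 0 <= g x + K.
Proof. by have := gK0 x; rewrite ler_norml => /andP[]; lra. Qed.

Let n1 : 1 <= n%:R :> R. Proof. by rewrite ler1n. Qed.
Let mm0 : 0 < m%:R :> R. Proof. by rewrite ltr0n. Qed.
Let nn0 : 0 < n%:R :> R. Proof. by rewrite ltr0n. Qed.
Let ell1 : 1 <= ell. Proof. exact: logplus_ge1. Qed.

Let nm_tau : n%:R / m%:R <= tau^-1.
Proof.
rewrite ler_pdivrMr// ler_pdivlMl//.
by move: taumn; rewrite ler_pdivlMr.
Qed.

Let log_card_le (N : nat) (b : R) : 0 < b -> b * e = ell ->
  ln (N%:R) <= n%:R * (3 * ell) -> ln (N%:R) / (b * m%:R) <= 3 * tau^-1 * e.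
Proof.
move=> b0 be lnN; rewrite ler_pdivrMr ?mulr_gt0//; apply: le_trans lnN _.
rewrite -be; have h := nm_tau; rewrite ler_pdivrMr// in h.
have h0 : 0 <= 3 * (b * e) by rewrite be mulr_ge0// (le_trans ler01).
by have := ler_wpM2r h0 h; lra.
Qed.

Let net_error_le : net_error n Li D L q0 q1 delta M ((n%:R / tau) `^ 2^-1) <=
  net_const * D * e.
Proof.
have /andP[d0 dom] := delta_bounds.
have D0 : 0 <= D := le_trans ler01 D1.
have h1 := delta_kap n_gt0 tau01 dom.
have h2 := mean_low_power_le_rate q1 q2 q3 m_gt0 n_gt0 L1 ell1 q00 Li1.
rewrite /net_error /net_const.
move: h1 h2; rewrite -/e; set N := m%:R^-1 * _; set W := L `^ _; set Q := _ `^ (_ + 1).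
set Z := _ `^ (_ / 2); set V := Num.sqrt _ => h1 h2.
have N0 : 0 <= N by rewrite mulr_ge0 ?invr_ge0 ?ler0n// sumr_ge0// => i _; exact: powR_ge0.
have W0 : 0 <= W by exact: powR_ge0.
have Z0 : 0 <= Z by exact: powR_ge0.
pose C := D * (2 * 4 `^ q1) * 3 `^ (q0 * q1 + 1) * (3 + M).
have C0 : 0 <= C by rewrite !mulr_ge0 ?powR_ge0 ?addr_ge0.
have h3 := ler_wpM2l (mulr_ge0 C0 (mulr_ge0 N0 W0)) h1.
have h4 := ler_wpM2l (mulr_ge0 C0 Z0) h2.
rewrite [leLHS](_ : _ = C * (N * W) * (delta * (n%:R * Q))); last by rewrite /C; ring.
apply: le_trans h3 _.
rewrite [leLHS](_ : _ = C * Z * (N * W / V)); last by ring.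
by apply: le_trans h4 _; rewrite /C le_eqVlt; apply/orP; left; apply/eqP; ring.
Qed.

Let swap_error_le b : 0 < b -> b * e = ell ->
  swap_error (n := n) Li b D L K q0 q1 q2 q3 moment_order (1 + M) <=
  swap_const * K * D ^+ 3 * e.
Proof.
move=> b0 be; have h := swap_rate m_gt0 n_gt0 tau01 taumn L1 ell1 Li1 be.
rewrite /swap_error /swap_const; move: h; rewrite -/e -/q.
set X := m%:R^-1 * _; set Z := _ / (_ * _); set W := L ^+ 3 * _; set V := tau^-1 * Num.sqrt _ => h.
have M1 : 0 <= 1 + M by rewrite addr_ge0.
have mc := moment_const_ge0 moment_order M1.
have ti : 0 <= tau^-1 by rewrite invr_ge0 ltW.
have mb : moment_bound (n := n) (m := m) moment_order (1 + M) <=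
    moment_const (1 + M) moment_order * tau^-1 ^+ moment_order.
  rewrite /moment_bound; apply: ler_wpM2l => //.
  by apply: lerXn2r => //; rewrite nnegrE// divr_ge0.
move: mb; set a := moment_bound _ _; set c := moment_const (1 + M) moment_order * tau^-1 ^+ moment_order => mb.
have c0 : 0 <= c by rewrite /c mulr_ge0 ?exprn_ge0.
pose F := 2 * entry_const q0 q1 q2 q3 * (1 + M).
have F0 : 0 <= F by rewrite /F !mulr_ge0 ?entry_const_ge0.
have D0 : 0 <= D ^+ 3 by exact: le_trans D3.
have ve0 : 0 <= V * e.
  by rewrite mulr_ge0 ?(ltW e0)// mulr_ge0// sqrtr_ge0.
have kd : 0 <= K * D ^+ 3 by rewrite mulr_ge0.
have ac : F * (3 + a) <= F * (3 + c) by rewrite ler_wpM2l// lerD2l.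
have X0 : 0 <= X by rewrite mulr_ge0 ?invr_ge0 ?ler0n// sumr_ge0// => i _; exact: powR_ge0.
have z0 : 0 <= Z * X * W * b ^+ 2.
  rewrite mulr_ge0 ?sqr_ge0// mulr_ge0//; last first.
    by rewrite mulr_ge0 ?powR_ge0// exprn_ge0// (le_trans ler01).
  by rewrite mulr_ge0// divr_ge0 ?mulr_ge0 ?sqrtr_ge0.
rewrite [leLHS](_ : _ = (K * D ^+ 3) * (F * (3 + a) * (Z * X * W * b ^+ 2))); last first.
  by rewrite /F; ring.
rewrite [leRHS](_ : _ = (K * D ^+ 3) * (F * (3 + c) * (V * e))); last first.
  by rewrite /F; ring.
apply: ler_wpM2l => //.
apply: le_trans (ler_wpM2r z0 ac) _; apply: ler_wpM2l => //.
by rewrite mulr_ge0// addr_ge0.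
Qed.

Let four_points (x1 x2 y1 y2 B C : R) : `|y1 - y2| <= C -> `|x1 - y1| <= B ->
  `|x2 - y2| <= B -> `|x1 - x2| <= 2 * B + C.
Proof.
rewrite !ler_norml => /andP[h1 h2] /andP[h3 h4] /andP[h5 h6].
by apply/andP; split; lra.
Qed.

Let collect (lnb err sw : R) : lnb <= 3 * tau^-1 * e -> err <= net_const * D * e ->
  sw <= swap_const * K * D ^+ 3 * e -> 0 <= osc_f ->
  2 * (2 * (K * (Mrho + osc_f + lnb + err))) + sw <=
  univ_const * K * (Mrho + D ^+ 3 * (osc_f + e)).
Proof.
move=> h1 h2 h3 osc0.
have ti : 0 <= tau^-1 by rewrite invr_ge0 ltW.
have D0 : 0 <= D := le_trans ler01 D1.
have DD : D <= D ^+ 3 by rewrite -[leLHS]expr1 ler_weXn2l.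
have nc := net_const_ge0; have sc := swap_const_ge0.
have e' := ltW e0.
have DE : D * e <= D ^+ 3 * e by rewrite ler_wpM2r.
have EE : e <= D ^+ 3 * e by rewrite ler_peMl.
have OO : osc_f <= D ^+ 3 * osc_f by rewrite ler_peMl.
have h3' : sw <= K * (swap_const * (D ^+ 3 * e)).
  by apply: le_trans h3 _; rewrite le_eqVlt; apply/orP; left; apply/eqP; ring.
rewrite [D ^+ 3 * (_ + _)]mulrDr; move: h3' DE EE OO {h3}.
set E := D ^+ 3 * e; set O := D ^+ 3 * osc_f => h3 DE EE OO.
have E0 : 0 <= E by exact: le_trans EE.
have O0 : 0 <= O by exact: le_trans OO.
have b1 : lnb <= 3 * tau^-1 * E.
  by apply: le_trans h1 _; rewrite ler_wpM2l// mulr_ge0.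
have b2 : err <= net_const * E.
  by apply: le_trans h2 _; rewrite -mulrA ler_wpM2l.
have b3 : Mrho + osc_f + lnb + err <= Mrho + O + 3 * tau^-1 * E + net_const * E by lra.
have b4 := ler_wpM2l K0 b3.
have b5 : 4 * (Mrho + O + 3 * tau^-1 * E + net_const * E) + swap_const * E <=
    univ_const * (Mrho + (O + E)).
  have := mulr_ge0 nc Mrho0; have := mulr_ge0 nc O0; have := mulr_ge0 ti Mrho0.
  have := mulr_ge0 ti O0; have := mulr_ge0 sc Mrho0; have := mulr_ge0 sc O0.
  by have MM := Mrho0; rewrite /univ_const; lra.
have b6 := ler_wpM2l K0 b5.
lra.
Qed.

(* The choice b = ell / e makes both the entropy of the net and the swapping
   error of order e; it satisfies b >= 1 only when e <= 1. For e > 1 the bound is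
   trivial. *)
Let S_nonempty_bound (s0 : 'cV[R]_n) : S s0 -> e <= 1 -> 0 <= osc_f ->
  (`| mean_cost A0 - mean_cost B0 | <=
    (univ_const * K * (Mrho + D ^+ 3 * (osc_f + e)))%:E)%E.
Proof.
move=> Ss0 e1 osc0.
have /andP[d0 dom] := delta_bounds.
have d1 : delta <= 1.
  apply: le_trans (ltW dom) _; rewrite /omega -[leRHS](powRr0 n%:R).
  by apply: ler_powR => //; have := mulr_ge0 q00 q10; lra.
have d01 : 0 < delta <= 1 by rewrite d0.
have [N [c0 [v [Sv vnet lnN]]]] := finite_net L1 d01 SL Ss0.
pose b := ell / e.
have be : b * e = ell by rewrite divfK// gt_eqF.
have b1 : 1 <= b by rewrite ler_pdivlMr// mul1r (le_trans e1).
have b0 : 0 < b by exact: lt_le_trans b1.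
pose beta := b * m%:R.
have beta0 : 0 < beta by rewrite mulr_gt0.
pose kap : R := (n%:R / tau) `^ 2^-1.
have kap1 : 1 <= kap by exact: kap_ge1.
have nkap : n%:R / Num.sqrt m%:R <= kap by exact: sqrt_m_kap.
have apx (A : 'I_m -> 'I_n -> {RV P >-> R})
  (momM : forall i j, (\int[P]_t (`|A i j t| `^ qb)%:E <= M%:E)%E) :=
  expectation_min_cost_approx c0 m_gt0 n_gt0 D1 Li1 L1 q00 q10
    (ltW d0) beta0 kap1 nkap SL phi_psi dphi phi_ge0 phi1_le phi_growth f_osc Sv vnet
    dg gK0 gK1 momM.
have apxA := apx A0 momA; have apxB := apx B0 momB; rewrite {apx}.
set en := net_energy _ _ _ in apxA apxB.
set err := net_error _ _ _ _ _ _ _ _ _ in apxA apxB.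
have [piA [lawA intA]] := law_entry_vector indA.
have [piB [lawB intB]] := law_entry_vector indB.
have [pr rp] := moment_order_bounds.
have M1 : 0 <= 1 + M by rewrite addr_ge0.
pose s (k : 'I_m * 'I_n) := fine (\int[distribution P (A0 k.1 k.2)]_x (x ^+ 2)%:E)%E.
have varA k : (\int[distribution P (A0 k.1 k.2)]_x (x ^+ 2)%:E = (s k)%:E)%E.
  by rewrite fineK//; apply: integrable_fin_num => //;
    exact: (law_integrable2 q00 q30 (momA _ _)).
have varB k : (\int[distribution P (B0 k.1 k.2)]_x (x ^+ 2)%:E = (s k)%:E)%E.
  by rewrite -varA !law_second varAB.
have := @softmin_universality R N m n c0 (fun c j => v c j 0) (fun c => f (v c))
  phi phi1 phi2 phi3 g g1 g2 g3 Li b D L K q0 q1 q2 q3 moment_order m_gt0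
  b1 D1 Li1 L1 q00 q10 q20 q30
  (fun c j => ltac:(by have := SL (Sv c) j; rewrite ler_norml))
  dphi dphi1 dphi2 phi_ge0 phi1_le phi2_le phi3_le phi_growth dg dg1 dg2
  gK0 gK1 gK2 gK3 pr
  (fun k => distribution P (A0 k.1 k.2)) (fun k => distribution P (B0 k.1 k.2)) s
  (1 + M) M1
  (fun k => law_integrable q00 q30 (momA k.1 k.2))
  (fun k => law_integrable q00 q30 (momB k.1 k.2))
  (fun k => law_integrable2 q00 q30 (momA k.1 k.2))
  (fun k => law_integrable2 q00 q30 (momB k.1 k.2))
  (fun k => law_mean q00 q30 (momA k.1 k.2) (meanA k.1 k.2))
  (fun k => law_mean q00 q30 (momB k.1 k.2) (meanB k.1 k.2))
  varA varB
  (fun k => law_moments_le q00 q30 rp (momA k.1 k.2) M0)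
  (fun k => law_moments_le q00 q30 rp (momB k.1 k.2) M0)
  piA piB lawA lawB.
rewrite -/en -/beta => swapAB.
have men : measurable_fun setT (fun a => g (softmin beta (en a))).
  exact: (measurable_softmin_energy _ _ b dphi dg).
have menV (A : 'I_m -> 'I_n -> {RV P >-> R}) :
    measurable_fun setT (fun t => g (softmin beta (en (entry_vector A t)))).
  exact: measurableT_comp men (measurable_entry_vector A).
have intV (A : 'I_m -> 'I_n -> {RV P >-> R}) :
    P.-integrable setT (fun t => (g (softmin beta (en (entry_vector A t))))%:E).
  apply: (@le_integrable _ _ _ _ _ measurableT _ (EFin \o cst K)).
  - exact/measurable_EFinP.
  - by move=> t _; rewrite /= lee_fin (ger0_norm K0).
  - exact: finite_measure_integrable_cst.
have shift (A : 'I_m -> 'I_n -> {RV P >-> R}) pi0 :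
   (forall h : coords R ('I_m * 'I_n)%type -> \bar R, measurable_fun setT h ->
      (forall a, 0 <= h a)%E ->
      (\int[pi0]_a h a = \int[P]_t h (entry_vector A t))%E) ->
   (\int[pi0]_a (g (softmin beta (en a)) + K)%:E =
    \int[P]_t (g (softmin beta (en (entry_vector A t))))%:E + K%:E)%E.
  move=> H; rewrite H; last 2 first.
  - by apply/measurable_EFinP; exact: measurable_funD.
  - by move=> a; rewrite lee_fin.
  under eq_integral do rewrite EFinD.
  rewrite integralD//; last exact: finite_measure_integrable_cst.
  by rewrite integral_prob_cst.
rewrite (shift A0 piA intA) (shift B0 piB intB) in swapAB.
have yA := integrable_fin_num measurableT (intV A0).
have yB := integrable_fin_num measurableT (intV B0).
have xA := fin_num_of_dist yA apxA.
have xB := fin_num_of_dist yB apxB.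
rewrite (sube_shift _ yA yB) (abse_dist_fine _ yA yB) in swapAB.
rewrite (abse_dist_fine _ xA yA) in apxA.
rewrite (abse_dist_fine _ xB yB) in apxB.
rewrite (abse_dist_fine _ xA xB).
apply: le_trans (four_points swapAB apxA apxB) _.
exact: (collect (log_card_le b0 be lnN) net_error_le (swap_error_le b0 be) osc0).
Qed.

Lemma universality_fixed_scale : (`| mean_cost A0 - mean_cost B0 | <=
    (univ_const * K * (Mrho + D ^+ 3 * (osc_f + e)))%:E)%E.
Proof.
have osc0 : 0 <= osc_f.
  have c0 : cube L (0 : 'cV[R]_n).
    by move=> i; rewrite mxE oppr_le0 !(le_trans ler01).
  by apply: le_trans (f_osc c0 c0 _) => // i; rewrite subrr normr0; case/andP: delta_bounds => /ltW.
have DD : 0 <= D ^+ 3 by exact: le_trans D3.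
have uc := univ_const_gt0.
have rhs0 : 0 <= univ_const * K * (Mrho + D ^+ 3 * (osc_f + e)).
  have oe : 0 <= osc_f + e by rewrite addr_ge0// ltW.
  by rewrite mulr_ge0 ?(mulr_ge0 (ltW uc))// addr_ge0// mulr_ge0.
have [e1|e1] := leP e 1.
  (* For empty [S] both minima are the constant [inf set0], and the expectations coincide. *)
  have [S0|/set0P[s0 Ss0]] := eqVneq S set0; last exact: S_nonempty_bound Ss0 e1 osc0.
  have E A : mean_cost A = ('E_P[cst (g (inf set0))])%E.
    rewrite /mean_cost; congr expectation; apply/funext => t.
    by rewrite /min_cost S0 image_set0.
  by rewrite !E expectation_cst subee// abse0 lee_fin.
(* For [e > 1], the difference is at most [4 * K], while the right-hand side is at least
   [univ_const * K]. *)
apply: le_trans (lee_abs_sub _ _) _.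
apply: le_trans (leeD (mean_cost_le A0) (mean_cost_le B0)) _.
rewrite -EFinD lee_fin.
have h1 : 1 <= Mrho + D ^+ 3 * (osc_f + e).
  have h2 : 1 <= osc_f + e by rewrite (le_trans (ltW e1))// lerDr.
  have := ler_wpM2l DD h2; have := Mrho0; have := D3; lra.
have h4 : 4 <= univ_const.
  have ti : 0 <= tau^-1 by rewrite invr_ge0 ltW.
  by have := net_const_ge0; have := swap_const_ge0; rewrite /univ_const; lra.
have h5 := ler_wpM2r K0 h4.
have h6 : 0 <= univ_const * K by rewrite mulr_ge0// ltW.
have := ler_wpM2l h6 h1; lra.
Qed.

End core_inequality.

(** * Passage to the infima over both scales *)

Section rf_bounds.
Context {R : realType} {m n : nat}.
Variables (q0 q1 q2 q3 rhobar L : R) (Li : 'I_m -> R) (Mpsi Dpsi : R -> R).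
Variable f : 'cV[R]_n -> R.
Hypotheses (m0 : (0 < m)%N) (n0 : (0 < n)%N) (L1 : 1 <= L).
Hypothesis Li1 : forall i, 1 <= Li i.
Hypothesis MD : forall rho : R, 0 < rho < rhobar ->
  0 <= Mpsi rho /\ Mpsi rho <= 1 <= Dpsi rho.

Let e delta := rate n L q0 q1 q2 q3 (logplus (L / delta)) Li.
Let r := rf q0 q1 q2 q3 rhobar Li Mpsi Dpsi f L.
Let dinf := delta_inf q0 q1 q2 q3 Li f L.

Lemma osc_ge0 delta : 0 <= delta -> (0 <= osc f L delta)%E.
Proof.
move=> d0; apply: ereal_sup_ubound; exists 0, 0; split.
- by move=> i; rewrite mxE oppr_le0 !(le_trans ler01).
- by move=> i; rewrite mxE oppr_le0 !(le_trans ler01).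
- by move=> i; rewrite subrr normr0.
- by rewrite subrr normr0.
Qed.

Lemma osc_ub delta w w' : cube L w -> cube L w' ->
  (forall i, `|w i 0 - w' i 0| <= delta) -> (`|f w - f w'|%:E <= osc f L delta)%E.
Proof. by move=> hw hw' hd; apply: ereal_sup_ubound; exists w, w'. Qed.

Lemma rf_ge (a : \bar R) : (forall delta : R, 0 < delta < omega n q0 q1 ->
    (a <= osc f L delta + (e delta)%:E)%E) -> (0 <= a)%E -> (a <= r)%E.
Proof.
move=> h a0; apply: le_ereal_inf_tmp => _ [rho hrho <-].
have [M0 /andP[M1 D1]] := MD hrho.
have D3 : 1 <= Dpsi rho ^+ 3 by exact: exprn_ege1.
have ad : (a <= dinf)%E.
  by apply: le_ereal_inf_tmp => _ [delta hd <-]; exact: h.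
rewrite -[a]add0e; apply: leeD; first by rewrite lee_fin.
rewrite -[a]mul1e; apply: lee_pmul => //.
Qed.

(** [delta] enters the rate only through [logplus >= 1], so the rate at [ell = 1] is a positive
    lower bound for all scales. Positivity matters when [Kg g] is infinite. *)
Lemma rf_gt0 : (0 < r)%E.
Proof.
pose c := rate n L q0 q1 q2 q3 1 Li.
have c0 : 0 < c by apply: rate_gt0.
apply: (@lt_le_trans _ _ c%:E); first by rewrite lte_fin.
apply: rf_ge; last by rewrite lee_fin ltW.
move=> delta /andP[/ltW /osc_ge0 o0 _]; rewrite -[c%:E]add0e; apply: leeD => //.
rewrite lee_fin /c /e /rate ler_wpM2l ?powR_ge0// ler_wpM2r ?invr_ge0 ?powR_ge0//.
rewrite ler_wpM2l ?powR_ge0//; apply: ge0_ler_powR => //; rewrite ?nnegrE//.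
  by rewrite (le_trans ler01)// logplus_ge1.
exact: logplus_ge1.
Qed.

(** Scales with infinite oscillation contribute +oo to the infimum, so estimates at finite
    oscillations suffice. If [x] is +oo, the hypothesis excludes every finite oscillation and the
    right-hand side is +oo too. *)
Lemma le_rf (x : \bar R) (A : R) : 0 < A -> (0 <= x)%E ->
  (forall rho delta o : R, 0 < rho < rhobar -> 0 < delta < omega n q0 q1 ->
    osc f L delta = o%:E ->
    (x <= (A * (Mpsi rho + Dpsi rho ^+ 3 * (o + e delta)))%:E)%E) ->
  (x <= A%:E * r)%E.
Proof.
move=> A0 x0 h; rewrite -lee_pdivrMl//.
apply: le_ereal_inf_tmp => _ [rho hrho <-].
have [M0 /andP[M1 D1]] := MD hrho.
have D3 : 1 <= Dpsi rho ^+ 3 by exact: exprn_ege1.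
have D30 : 0 < Dpsi rho ^+ 3 by exact: lt_le_trans D3.
have osc_cases delta : 0 < delta < omega n q0 q1 ->
    osc f L delta = +oo%E \/ exists o, osc f L delta = o%:E.
  move=> /andP[/ltW d0 _]; have := osc_ge0 d0.
  by case: (osc f L delta) => [y _|_|] //; [right; exists y|left].
rewrite -/dinf; case: x x0 h => [x x0 h | _ h | x0 h]; last by [].
  have hd : (((Dpsi rho ^+ 3)^-1 * (A^-1 * x - Mpsi rho))%:E <= dinf)%E.
    apply: le_ereal_inf_tmp => _ [delta hd <-].
    have [->|[y yE]] := osc_cases delta hd; first by rewrite addye// leey.
    have := h rho delta y hrho hd yE; rewrite yE -EFinD !lee_fin => h'.
    by rewrite ler_pdivrMl// lerBlDr ler_pdivrMl// addrC.
  apply: (@le_trans _ _ ((Mpsi rho)%:E + (Dpsi rho ^+ 3)%:E *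
      ((Dpsi rho ^+ 3)^-1 * (A^-1 * x - Mpsi rho))%:E)%E).
    rewrite -!EFinM -EFinD lee_fin mulrA divff ?gt_eqF// mul1r.
    by rewrite addrC subrK.
  by apply: leeD2l; apply: lee_wpmul2l => //; rewrite lee_fin ltW.
have -> : dinf = +oo%E.
  apply/eqP; rewrite -leye_eq; apply: le_ereal_inf_tmp => _ [delta hd <-].
  have [->|[y yE]] := osc_cases delta hd; first by rewrite addye.
  by have := h rho delta y hrho hd yE.
by rewrite [X in (_ <= _ + X)%E]gt0_muley ?lte_fin// addey// leey.
Qed.

End rf_bounds.

Section smooth_functions.
Context {R : realType}.
Implicit Types f g : R -> R.

Lemma C3_is_derive f (k : nat) (x : R) : C3 f -> (k < 3)%N ->
  is_derive x (1 : R) (derive1n k f) (derive1n k.+1 f x).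
Proof.
move=> [df _] k3; have := derivableP (df k k3 x).
by rewrite -derive1E.
Qed.

Lemma supnorm_le f (K : R) : (supnorm f <= K%:E)%E -> forall x, `|f x| <= K.
Proof.
move=> h x; rewrite -lee_fin; apply: le_trans h.
by apply: ereal_sup_ubound; exists x.
Qed.

Lemma supnorm_ge0 f : (0 <= supnorm f)%E.
Proof.
apply: (@le_trans _ _ (`|f 0|%:E)); first by rewrite lee_fin.
by apply: ereal_sup_ubound; exists 0.
Qed.

Lemma supnorm_le_Kg g (l : 'I_4) : (supnorm (derive1n l g) <= Kg g)%E.
Proof.
rewrite /Kg; apply: le_trans (le_bigmax _ (fun l : 'I_4 => supnorm (derive1n l g)) l) _.
rewrite -[leLHS]add0e; apply: leeD => //; by rewrite lee_fin.
Qed.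

Lemma Kg_ge1 g : (1 <= Kg g)%E.
Proof.
rewrite /Kg -[leLHS]adde0; apply: leeD => //.
apply: le_trans (supnorm_ge0 g) _.
exact: (le_bigmax _ (fun l : 'I_4 => supnorm (derive1n l g)) ord0).
Qed.

End smooth_functions.

Section expectation_universality.
Context {R : realType}.
Variables (tau q0 q1 q2 q3 M : R).

(* [M] is negative only when the moment hypothesis cannot hold *)
Definition theorem_const : R := univ_const tau q0 q1 q2 q3 (Num.max M 0).

Hypotheses (tau01 : 0 < tau < 1).
Hypotheses (q00 : 0 <= q0) (q10 : 0 <= q1) (q20 : 0 <= q2) (q30 : 0 <= q3).

Lemma theorem_const_gt0 : 0 < theorem_const.
Proof. by apply: univ_const_gt0 => //; rewrite le_max lexx orbT. Qed.

Variables (m n : nat).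
Hypotheses (m_gt0 : (0 < m)%N) (n_gt0 : (0 < n)%N).
Hypothesis taumn : tau <= m%:R / n%:R.
Variables (rhobar : R) (Lpsi : 'I_m -> R) (Mpsi Dpsi : R -> R).
Variables (psi : 'I_m -> R -> R) (f : 'cV[R]_n -> R).
Hypothesis loss : loss_assumption q0 q1 q2 q3 rhobar Lpsi Mpsi Dpsi psi.
Context d (T : measurableType d) (P : probability T R).
Variables (A0 B0 : 'I_m -> 'I_n -> {RV P >-> R}).
Hypotheses (indA : independent_entries A0) (indB : independent_entries B0).
Hypothesis meanAB : forall i j, ('E_P[A0 i j] = 0 /\ 'E_P[B0 i j] = 0)%E.
Hypothesis varAB : forall i j, ('E_P[fun t => (A0 i j t ^+ 2)%R] =
  'E_P[fun t => (B0 i j t ^+ 2)%R])%E.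
Hypothesis momAB : max_moment A0 B0 (qbar q0 q1 q2 q3) = M%:E.
Variables (L : R) (S : set 'cV[R]_n).
Hypotheses (L1 : 1 <= L) (SL : S `<=` cube L).

Let qb := qbar q0 q1 q2 q3.

Let moment_sum_le i j :
  (\int[P]_t (`|A0 i j t| `^ qb)%:E + \int[P]_t (`|B0 i j t| `^ qb)%:E <= M%:E)%E.
Proof.
have E (X : T -> R) : (\int[P]_t (X t)%:E = 'E_P[X])%E by rewrite unlock.
pose G i j := ('E_P[fun t => (`|A0 i j t| `^ qb)%R] + 'E_P[fun t => (`|B0 i j t| `^ qb)%R])%E.
rewrite -momAB (E (fun t => `|A0 i j t| `^ qb)) (E (fun t => `|B0 i j t| `^ qb)) -/(G i j).
exact: le_trans (le_bigmax _ (G i) j)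
  (le_bigmax _ (fun i => \big[maxe/-oo%E]_(j < n) G i j) i).
Qed.

Let momA_ge0 (A : 'I_m -> 'I_n -> {RV P >-> R}) i j :
  (0 <= \int[P]_t (`|A i j t| `^ qb)%:E)%E.
Proof. by apply: integral_ge0 => t _; rewrite lee_fin powR_ge0. Qed.

Let M0 : 0 <= M.
Proof.
rewrite -lee_fin; apply: le_trans (moment_sum_le (Ordinal m_gt0) (Ordinal n_gt0)).
exact: adde_ge0.
Qed.

Let momA i j : (\int[P]_t (`|A0 i j t| `^ qb)%:E <= M%:E)%E.
Proof. by apply: le_trans (moment_sum_le i j); rewrite leeDl. Qed.

Let momB i j : (\int[P]_t (`|B0 i j t| `^ qb)%:E <= M%:E)%E.
Proof. by apply: le_trans (moment_sum_le i j); rewrite leeDr. Qed.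

Lemma expectation_universality (g : R -> R) : C3 g ->
  (`| 'E_P[fun t => g (min_cost psi f S (scaled_matrix A0 t))]
      - 'E_P[fun t => g (min_cost psi f S (scaled_matrix B0 t))] |
   <= theorem_const%:E * Kg g * rf q0 q1 q2 q3 rhobar Lpsi Mpsi Dpsi f L)%E.
Proof.
move=> gC3.
have uc0 := theorem_const_gt0.
have r0 := rf_gt0 q0 q1 q2 q3 f m_gt0 n_gt0 L1 (loss_L loss) (loss_MD loss).
have Kg1 := Kg_ge1 g; have sK := supnorm_le_Kg g.
move: Kg1 sK; case: (Kg g) => [K K1 sK|_ _|//]; last first.
  (* With [Kg g] infinite the product is +oo because the other two factors are positive; a zero
     factor would make it 0. *)
  rewrite (gt0_muley (x := theorem_const%:E)) ?lte_fin//.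
  by rewrite (gt0_mulye r0) leey.
have K0 : 0 < K by rewrite -lte_fin; apply: lt_le_trans K1.
rewrite -EFinM; apply: (le_rf L1 (loss_MD loss)).
- by rewrite mulr_gt0.
- exact: abse_ge0.
move=> rho delta o hrho hdelta oE.
have [psir hpsir] := loss_smoothing loss.
have {}hpsir := hpsir rho hrho.
have [Mr0 /andP[Mr1 D1]] := loss_MD loss hrho.
have ps0 i x : 0 <= psir rho i x by have [h _ _ _] := hpsir i.
have psC i : C3 (psir rho i) by have [_ h _ _] := hpsir i.
have psM i x : `|psir rho i x - psi i x| <= Mpsi rho.
  by have [_ _ h _] := hpsir i; exact: (supnorm_le h).
have bnd (t x y : R) : 0 <= y -> `|x| / (1 + `|y| `^ t) <= Dpsi rho ->
    `|x| <= Dpsi rho * (1 + y `^ t).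
  move=> y0; rewrite ler_pdivrMr ?(ger0_norm y0)//.
  by rewrite (lt_le_trans ltr01)// lerDl powR_ge0.
have dps i (k : nat) (x : R) (k3 : (k < 3)%N) := C3_is_derive x (psC i) k3.
have dgs (k : nat) (x : R) (k3 : (k < 3)%N) := C3_is_derive x gC3 k3.
have gl (l : nat) x (l4 : (l < 4)%N) : `|derive1n l g x| <= K.
  exact: (supnorm_le (sK (Ordinal l4))).
have MM : Num.max M 0 = M by rewrite max_l.
rewrite /theorem_const MM.
apply: (@universality_fixed_scale R tau q0 q1 q2 q3 M tau01 q00 q10 q20 q30 M0 m n
  m_gt0 n_gt0 taumn Lpsi psi (psir rho) (fun i => derive1n 1 (psir rho i))
  (fun i => derive1n 2 (psir rho i)) (fun i => derive1n 3 (psir rho i)) f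
  (Mpsi rho) (Dpsi rho) L delta o K S g (derive1n 1 g) (derive1n 2 g) (derive1n 3 g)
  D1 (loss_L loss) L1 SL).
- by move=> i x; rewrite distrC.
- by move=> i z; exact: (dps i 0%N).
- by move=> i z; exact: (dps i 1%N).
- by move=> i z; exact: (dps i 2%N).
- exact: ps0.
- by move=> i z; have [_ _ _ /(_ z)[h _ _]] := hpsir i; exact: bnd.
- by move=> i z; have [_ _ _ /(_ z)[_ h _]] := hpsir i; exact: bnd.
- by move=> i z; have [_ _ _ /(_ z)[_ _ h]] := hpsir i; exact: bnd.
(* The smoothed loss exceeds the loss by at most [Mpsi rho <= 1], which is the 1 in the growth
   bound. *)
- move=> i z; have := psM i z; rewrite ler_norml => /andP[_ h1].
  have := loss_growth loss i z; rewrite ler_pdivrMr; last first.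
    by rewrite (lt_le_trans ltr01)// lerDl powR_ge0.
  rewrite ger0_norm ?(loss_ge0 loss)// => h2.
  lra.
- by move=> w w' cw cw' h; rewrite -lee_fin -oE; exact: osc_ub.
- exact: hdelta.
- by move=> z; exact: (dgs 0%N).
- by move=> z; exact: (dgs 1%N).
- by move=> z; exact: (dgs 2%N).
- by move=> x; exact: (gl 0%N).
- by move=> x; exact: (gl 1%N).
- by move=> x; exact: (gl 2%N).
- by move=> x; exact: (gl 3%N).
- exact: indA.
- exact: indB.
- by move=> i j; have [] := meanAB i j.
- by move=> i j; have [] := meanAB i j.
- exact: varAB.
- exact: momA.
- exact: momB.
Qed.

End expectation_universality.

(** * A smooth step function *)

Section truncated_powers.
Context {R : realType}.
Implicit Types (x y : R) (k : nat).

(** Truncated powers, the building blocks of splines. For [k = 0] this is the constant 1 and not a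
    step, so the facts below concern [k >= 1]. *)
Definition tpow k x : R := Num.max x 0 ^+ k.

Lemma tpowS k x : tpow k.+2 x = x * tpow k.+1 x.
Proof.
rewrite /tpow; have [x0|x0] := leP x 0; first by rewrite !expr0n/= mulr0.
by rewrite exprS.
Qed.

Lemma tpow_le0 k x : x <= 0 -> tpow k.+1 x = 0.
Proof. by move=> x0; rewrite /tpow max_r// expr0n. Qed.

Lemma tpow_ge0 k x : 0 <= x -> tpow k x = x ^+ k.
Proof. by move=> x0; rewrite /tpow max_l. Qed.

(** Handles the square of the positive part at its kink, where the positive part itself has no
    derivative. *)
Lemma is_derive_of_quadratic_error (f : R -> R) x (c : R) :
  (forall y, `|f y - f x - c * (y - x)| <= (y - x) ^+ 2) -> is_derive x (1 : R) f c.
Proof.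
move=> H.
have lim : (fun h => h^-1 *: (f (h *: (1 : R) + x) - f x)) @ 0^' --> c.
  apply/cvgrPdist_le => eps eps0; near=> h.
  have h0 : h != 0 by near: h; exact: nbhs_dnbhs_neq.
  have he : `|h| <= eps by near: h; exact: dnbhs0_le.
  apply: le_trans he.
  have := H (h *: 1 + x); rewrite /GRing.scale/= mulr1 addrK => hh.
  rewrite distrC (_ : _ - c = h^-1 * (f (h + x) - f x - c * h)); last first.
    by field.
  rewrite normrM normfV ler_pdivrMl ?normr_gt0//.
  by apply: le_trans hh _; rewrite -normrM -expr2 ger0_norm ?sqr_ge0.
by apply: DeriveDef; [exact: cvgP lim|exact: cvg_lim lim].
Unshelve. all: by end_near.
Qed.

Lemma is_derive_tpow k x : is_derive x (1 : R) (tpow k.+2) (k.+2%:R * tpow k.+1 x).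
Proof.
elim: k => [|k IH].
  apply: is_derive_of_quadratic_error => y; rewrite /tpow expr1.
  have sx := sqr_ge0 x; have sy := sqr_ge0 y; have sxy := sqr_ge0 (y - x).
  have [y0|y0] := leP y 0; have [x0|x0] := leP x 0; rewrite ler_norml.
  - by apply/andP; split; lra.
  - by have := mulr_le0_ge0 y0 (ltW x0) => h; apply/andP; split; lra.
  - by have := mulr_ge0_le0 (ltW y0) x0 => h; apply/andP; split; lra.
  - by apply/andP; split; lra.
have -> : tpow k.+3 = fun y => y * tpow k.+2 y by apply/funext => y; rewrite tpowS.
apply: is_derive_eq (is_derive_mul (is_derive_id _ _) IH) _.
by rewrite mul1r mulrCA -tpowS -[k.+3%:R]natr1; ring.
Qed.

(** The fourth backward difference of [tpow k]. Beyond 4 it is the fourth difference of a monomial: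
    0 in degree below 4, and 4! = 24 in degree 4. Hence [spline 4] divided by 24 is the integral of
    the cubic B-spline. *)
Definition spline (k : nat) x : R :=
  tpow k x - 4 * tpow k (x - 1) + 6 * tpow k (x - 2) - 4 * tpow k (x - 3) + tpow k (x - 4).

Lemma is_derive_spline k x :
  is_derive x (1 : R) (spline k.+2) (k.+2%:R * spline k.+1 x).
Proof.
have sh (c : R) : is_derive x (1 : R) (fun y => tpow k.+2 (y - c)) (k.+2%:R * tpow k.+1 (x - c)).
  apply: is_derive_eq (is_derive_comp (is_derive_tpow _ _)
    (is_derive_sub (is_derive_id _ _) (is_derive_cst c _ _))) _.
  by rewrite subr0 mulr1.
apply: is_derive_eq (is_derive_add (is_derive_sub (is_derive_add (is_derive_sub
  (is_derive_tpow _ _) (is_derive_cmul 4 (sh 1))) (is_derive_cmul 6 (sh 2)))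
  (is_derive_cmul 4 (sh 3))) (sh 4)) _.
by rewrite /spline; ring.
Qed.

Lemma continuous_spline1 : continuous (spline 1).
Proof.
have c1 : continuous (fun x : R => tpow 1 x).
  rewrite (_ : (fun x => _) = fun x => Num.max x 0); last by apply/funext => x; rewrite /tpow expr1.
  by move=> x; apply: continuous_max; [exact: cvg_id|exact: cvg_cst].
have sh (c : R) : continuous (fun x : R => tpow 1 (x - c)).
  move=> x; apply: (@continuous_comp _ _ _ (fun x => x - c) (tpow 1)); last exact: c1.
  by apply: cvgB; [exact: cvg_id|exact: cvg_cst].
move=> x; apply: cvgD; last exact: sh.
apply: cvgB; last by apply: cvgM; [exact: cvg_cst|exact: sh].
apply: cvgD; last by apply: cvgM; [exact: cvg_cst|exact: sh].
by apply: cvgB; [exact: c1|apply: cvgM; [exact: cvg_cst|exact: sh]].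
Qed.

Lemma spline_le0 k x : x <= 0 -> spline k.+1 x = 0.
Proof. by move=> x0; rewrite /spline !tpow_le0; [ring|lra..]. Qed.

Lemma spline4_ge4 x : 4 <= x -> spline 4 x = 24.
Proof. by move=> x4; rewrite /spline !tpow_ge0; [ring|lra..]. Qed.

Lemma spline_ge4 k x : (0 < k < 4)%N -> 4 <= x -> spline k x = 0.
Proof.
move=> hk x4; rewrite /spline !tpow_ge0; [|lra..].
have [->|[->|->]] : k = 1%N \/ k = 2%N \/ k = 3%N by lia.
all: ring.
Qed.

Lemma tpow_norm_le k x : x <= 4 -> `|tpow k x| <= 4 ^+ k.
Proof.
move=> x4; rewrite /tpow ger0_norm ?exprn_ge0 ?le_max ?lexx ?orbT//.
apply: lerXn2r; rewrite ?nnegrE ?le_max ?lexx ?orbT ?ler0n//.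
by rewrite ge_max x4/= ler0n.
Qed.

(** 1024 = 16 * 64: the absolute values of the coefficients sum to 16, and each truncated power is
    at most 4^3 on [0, 4]. *)
Lemma spline_bound k x : (0 < k < 4)%N -> `|spline k x| <= 1024.
Proof.
case: k => // k k4.
have n1024 : (0 : R) <= 1024 by lra.
have [x0|x0] := leP x 0; first by rewrite spline_le0// normr0.
have [x4|x4] := leP 4 x; first by rewrite spline_ge4// normr0.
have b c : 0 <= c -> `|tpow k.+1 (x - c)| <= 64.
  move=> c0; apply: le_trans (tpow_norm_le _ _) _; first by lra.
  apply: (@le_trans _ _ (4 ^+ 3)); last by lra.
  by apply: ler_weXn2l; [rewrite ler1n|lia].
have := b 0 (lexx _); have := b 1 ler01; have := b 2 (ler0n _ 2).
have := b 3 (ler0n _ 3); have := b 4 (ler0n _ 4); rewrite /spline subr0 !ler_norml.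
by move=> /andP[? ?] /andP[? ?] /andP[? ?] /andP[? ?] /andP[? ?]; apply/andP; split; lra.
Qed.

(** [tpow 4 y + tpow 4 (- y)] is y^4, whose fourth difference is 24. The symmetry reduces the bounds
    to [x <= 2], where at most two truncated powers are non-zero. *)
Lemma spline4_sym x : spline 4 x = 24 - spline 4 (4 - x).
Proof.
have refl y : tpow 4 y = y ^+ 4 - tpow 4 (- y).
  have [y0|y0] := leP y 0.
    by rewrite tpow_le0// tpow_ge0 ?oppr_ge0//; ring.
  by rewrite tpow_ge0 ?ltW// (@tpow_le0 3 (- y)) ?oppr_le0 ?ltW// subr0.
rewrite /spline (refl x) (refl (x - 1)) (refl (x - 2)) (refl (x - 3)) (refl (x - 4)).
rewrite (_ : 4 - x - 1 = - (x - 3)); last by ring.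
rewrite (_ : 4 - x - 2 = - (x - 2)); last by ring.
rewrite (_ : 4 - x - 3 = - (x - 1)); last by ring.
rewrite (_ : 4 - x - 4 = - x); last by ring.
rewrite (_ : 4 - x = - (x - 4)); last by ring.
ring.
Qed.

Let spline4_low x : x <= 2 -> 0 <= spline 4 x <= 24.
Proof.
move=> x2; have [x0|x0] := leP x 0; first by rewrite spline_le0// lexx ler0n.
have z2 : tpow 4 (x - 2) = 0 by apply: tpow_le0; lra.
have z3 : tpow 4 (x - 3) = 0 by apply: tpow_le0; lra.
have z4 : tpow 4 (x - 4) = 0 by apply: tpow_le0; lra.
rewrite /spline z2 z3 z4 tpow_ge0 ?(ltW x0)// !mulr0 addr0 subr0 addr0.
have x16 : x ^+ 4 <= 16.
  by rewrite (_ : 16 = 2 ^+ 4); [rewrite lerXn2r ?nnegrE//; lra|ring].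
have x40 : 0 <= x ^+ 4 by rewrite exprn_ge0// ltW.
have [x1|x1] := leP x 1.
  by rewrite tpow_le0 ?subr_le0// mulr0 subr0; lra.
rewrite tpow_ge0; last by lra.
have t0 : 0 <= x - 1 by lra.
have t4 : 0 <= (x - 1) ^+ 4 by rewrite exprn_ge0.
(* [2 * (x - 1) <= x] because [x <= 2]; thus 16 (x - 1)^4 <= x^4, more than the coefficient 4
   requires. *)
have : (2 * (x - 1)) ^+ 4 <= x ^+ 4 by rewrite lerXn2r ?nnegrE; lra.
rewrite exprMn => h; apply/andP; split; lra.
Qed.

Lemma spline4_bounds x : 0 <= spline 4 x <= 24.
Proof.
have [x2|x2] := leP x 2; first exact: spline4_low.
have /andP[h1 h2] : 0 <= spline 4 (4 - x) <= 24 by apply: spline4_low; lra.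
by rewrite spline4_sym; apply/andP; split; lra.
Qed.

End truncated_powers.

Section smooth_step.
Context {R : realType}.

Lemma C3_of_tower (f f1 f2 f3 : R -> R) :
  (forall x : R, is_derive x (1 : R) f (f1 x)) ->
  (forall x : R, is_derive x (1 : R) f1 (f2 x)) ->
  (forall x : R, is_derive x (1 : R) f2 (f3 x)) -> continuous f3 ->
  [/\ C3 f, derive1n 1 f = f1, derive1n 2 f = f2 & derive1n 3 f = f3].
Proof.
move=> d0 d1 d2 c3.
have E (h h' : R -> R) : (forall x : R, is_derive x (1 : R) h (h' x)) -> derive1 h = h'.
  by move=> dh; apply/funext => x; rewrite derive1E; have [] := dh x.
have e1 : derive1n 1 f = f1 by exact: E.
have e2 : derive1n 2 f = f2 by rewrite derive1nS e1; exact: E.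
have e3 : derive1n 3 f = f3 by rewrite derive1nS e2; exact: E.
split => //; split; last by rewrite e3.
move=> [|[|[|//]]] _ x; rewrite ?derive1n0 ?e1 ?e2; first by have [] := d0 x.
  by have [] := d1 x.
by have [] := d2 x.
Qed.

(* The cumulative cubic B-spline, rescaled from [0, 4] to [z + eps, z + 3 eps]. *)
Lemma smooth_step (z eps : R) : 0 < eps -> exists g : R -> R,
  [/\ C3 g, forall x, 0 <= g x <= 1, forall x, x <= z + eps -> g x = 0,
      forall x, z + 3 * eps <= x -> g x = 1 &
      (Kg g <= (8193 * Num.max 1 (eps ^- 3))%:E)%E].
Proof.
move=> eps0; pose s := 2 / eps; pose Y x := s * (x - (z + eps)).
have s0 : 0 < s by rewrite divr_gt0.
have dY (x : R) : is_derive x (1 : R) Y s.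
  apply: is_derive_eq (is_derive_cmul s (is_derive_sub (is_derive_id _ _)
    (is_derive_cst (z + eps) _ _))) _.
  by rewrite subr0 mulr1.
pose G (k : nat) (c : R) x := c * spline k (Y x).
have dG k c (x : R) : is_derive x (1 : R) (G k.+2 c) (G k.+1 (c * s * k.+2%:R) x).
  apply: is_derive_eq (is_derive_cmul c (is_derive_comp (is_derive_spline _ _) (dY x))) _.
  by rewrite /G; ring.
pose g0 := G 4 24^-1.
pose g1 := G 3 (24^-1 * s * 4).
pose g2 := G 2 (24^-1 * s * 4 * s * 3).
pose g3 := G 1 (24^-1 * s * 4 * s * 3 * s * 2).
have cg3 : continuous g3.
  move=> x; apply: cvgM; first exact: cvg_cst.
  apply: (@continuous_comp _ _ _ Y (spline 1)); last exact: continuous_spline1.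
  exact: (is_derive_continuous dY).
have [C e1 e2 e3] := C3_of_tower (dG 2 _) (dG 1 _) (dG 0 _) cg3.
exists g0; split => //.
- move=> x; have /andP[h1 h2] := spline4_bounds (Y x).
  by rewrite /g0 /G; apply/andP; split; lra.
- move=> x xz; rewrite /g0 /G spline_le0 ?mulr0//.
  by rewrite /Y pmulr_rle0// subr_le0.
- move=> x xz; rewrite /g0 /G spline4_ge4; first by lra.
  rewrite /Y /s mulrAC ler_pdivlMr//; lra.
pose m := Num.max 1 (eps ^- 3).
have m1 : 1 <= m by rewrite le_max lexx.
have m3 : eps ^- 3 <= m by rewrite le_max lexx orbT.
have i0 : 0 < eps^-1 by rewrite invr_gt0.
have im : eps^-1 <= m.
  have [h|h] := leP eps^-1 1; first exact: le_trans m1.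
  by apply: le_trans m3; rewrite -exprVn -[leLHS]expr1 ler_weXn2l// ltW.
have im2 : eps^-1 ^+ 2 <= m.
  have [h|h] := leP eps^-1 1.
    by apply: le_trans m1; rewrite exprn_ile1// ltW.
  by apply: le_trans m3; rewrite -exprVn ler_weXn2l// ltW.
rewrite -exprVn in m3.
(* With s = 2 / eps, the coefficients of [g1], [g2], [g3] are s / 6, s^2 / 2 and s^3, the last being
   8 / eps^3; and 8192 = 8 * 1024. *)
have b k c x : 0 <= c -> c <= 8 * m -> (0 < k < 4)%N -> `|G k c x| <= 8192 * m.
  move=> c0 cm k4; rewrite /G normrM (ger0_norm c0).
  have := ler_pM c0 (normr_ge0 _) cm (spline_bound (Y x) k4); lra.
rewrite /Kg (_ : 8193 * m = m + 8192 * m); last by ring.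
rewrite EFinD; apply: leeD; first by rewrite lee_fin.
apply: bigmax_le; first by rewrite leNye.
have sup (h : R -> R) (B : R) : (forall x, `|h x| <= B) -> (supnorm h <= B%:E)%E.
  by move=> hB; apply: ge_ereal_sup => _ [x _ <-]; rewrite lee_fin.
have se : s = 2 * eps^-1 by [].
move=> [[|[|[|[|//]]]] i4] _; apply: sup => x.
- have /andP[h1 h2] := spline4_bounds (Y x).
  by rewrite ?derive1n0 /g0 /G ger0_norm; lra.
- by rewrite e1; apply: b => //; rewrite se; lra.
- by rewrite e2; apply: b => //; rewrite se; [have := sqr_ge0 eps^-1|]; lra.
- rewrite e3; apply: b => //; rewrite se; last by lra.
  by have := exprn_ge0 3 (ltW i0); lra.
Qed.

End smooth_step.

(** [g] composed with [X] dominates the indicator of [EX], and [g] composed with [Y] is dominated by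
    that of [EY]. Only monotonicity of lower integrals is used, so the compositions may be
    non-measurable. *)
Lemma prob_transfer d (T : measurableType d) (R : realType) (P : probability T R)
    (g : R -> R) (X Y : T -> R) (EX EY : set T) (e : \bar R) :
  (forall x, 0 <= g x <= 1) ->
  (forall t, EX t -> g (X t) = 1) -> (forall t, ~ EY t -> g (Y t) = 0) ->
  measurable EX -> measurable EY ->
  (`|'E_P[fun t => g (X t)] - 'E_P[fun t => g (Y t)]| <= e)%E ->
  (P EX <= P EY + e)%E.
Proof.
move=> g01 gX gY mX mY; rewrite unlock => le_e.
have g0 x : 0 <= g x by have /andP[] := g01 x.
have g1 x : g x <= 1 by have /andP[] := g01 x.
have lX : (P EX <= \int[P]_t (g (X t))%:E)%E.
  rewrite -[in leLHS](setIT EX) -(integral_indic P measurableT mX).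
  apply: le_lower_integral => t; first by rewrite lee_fin.
  rewrite lee_fin indicE; case: (boolP (t \in EX)) => //= /set_mem Et.
  by rewrite gX.
have lY : (\int[P]_t (g (Y t))%:E <= P EY)%E.
  rewrite -[in leRHS](setIT EY) -(integral_indic P measurableT mY).
  apply: le_lower_integral => t; first by rewrite lee_fin.
  rewrite lee_fin indicE; case: (boolP (t \in EY)) => //= /negP Et.
  by rewrite gY// => /mem_set.
apply: le_trans lX _; apply: le_trans (leeD lY (lexx e)).
have fY : (\int[P]_t (g (Y t))%:E)%E \is a fin_num.
  rewrite ge0_fin_numE; last by apply: integral_ge0 => t _; rewrite lee_fin.
  by apply: le_lt_trans lY _; apply: le_lt_trans (probability_le1 P mY) _; rewrite ltry.
by rewrite -leeBlDl//; exact: le_trans (lee_abs _) le_e.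
Qed.

Theorem theorem2p3 (R : realType) :
  exists c : R, 0 < c /\
  forall tau q0 q1 q2 q3 M : R,
    0 < tau < 1 -> 0 <= q0 -> 0 <= q1 -> 0 <= q2 -> 0 <= q3 ->
  exists C0 : R, 0 < C0 /\
  forall (m n : nat), (0 < m)%N -> (0 < n)%N ->
    tau <= m%:R / n%:R <= tau^-1 ->
  forall (rhobar : R) (Lpsi : 'I_m -> R) (Mpsi Dpsi : R -> R)
    (psi : 'I_m -> R -> R) (f : 'cV[R]_n -> R),
    loss_assumption q0 q1 q2 q3 rhobar Lpsi Mpsi Dpsi psi ->
    borel_fun f ->
  forall (d : measure_display) (T : measurableType d) (P : probability T R)
    (A0 B0 : 'I_m -> 'I_n -> {RV P >-> R}),
    independent_entries A0 -> independent_entries B0 ->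
    (forall i j, 'E_P[A0 i j] = 0 /\ 'E_P[B0 i j] = 0)%E ->
    (forall i j, 'E_P[fun t => (A0 i j t ^+ 2)%R]
                 = 'E_P[fun t => (B0 i j t ^+ 2)%R])%E ->
    max_moment A0 B0 (qbar q0 q1 q2 q3) = M%:E ->
  forall (L : R) (S : set 'cV[R]_n), 1 <= L -> S `<=` cube L ->
  let A := scaled_matrix A0 in
  let B := scaled_matrix B0 in
  let r := rf q0 q1 q2 q3 rhobar Lpsi Mpsi Dpsi f L in
  (forall g : R -> R, C3 g ->
    (`| 'E_P[fun t => g (min_cost psi f S (A t))]
        - 'E_P[fun t => g (min_cost psi f S (B t))] |
     <= C0%:E * Kg g * r)%E) /\
  (forall z eps : R, 0 < eps ->
    let EA := [set t | (z + 3 * eps < min_cost psi f S (A t))%R] in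
    let EB := [set t | (z + eps < min_cost psi f S (B t))%R] in
    measurable EA -> measurable EB ->
    (P EA <= P EB + (c * C0 * Num.max 1 (eps ^- 3))%:E * r)%E).
Proof.
(* The constant in the bound of [Kg] for the test function of [smooth_step]. *)
exists 8193; split=> [|tau q0 q1 q2 q3 M tau01 q00 q10 q20 q30]; first by rewrite ltr0n.
exists (theorem_const tau q0 q1 q2 q3 M); split; first exact: theorem_const_gt0.
move=> m n m0 n0 /andP[taumn _] rhobar Lpsi Mpsi Dpsi psi f loss _ d T P A0 B0.
move=> indA indB mean var mom L S L1 SL A B r.
have universality := expectation_universality tau01 q00 q10 q20 q30 m0 n0 taumn f
  loss indA indB mean var mom L1 SL.
split; first exact: universality.
move=> z eps eps0 EA EB mEA mEB.
have [g [gC g01 g0 g1 gK]] := smooth_step z eps0.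
apply: (@prob_transfer _ _ _ P g (fun t => min_cost psi f S (A t))
  (fun t => min_cost psi f S (B t))) => //.
- by move=> t /ltW; exact: g1.
- by move=> t /negP; rewrite -leNgt; exact: g0.
apply: le_trans (universality g gC) _; apply: lee_wpmul2r.
  by apply/ltW/rf_gt0 => //; [exact: loss_L loss|exact: loss_MD loss].
rewrite (mulrC 8193) -mulrA EFinM; apply: lee_wpmul2l => //.
by rewrite lee_fin ltW// theorem_const_gt0.
Qed.
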